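(* Let $n\ge1$ and $\lambda\in\mathbb R$, $\lambda\ne0$. Put $\kappa_\lambda=\cosh(\lambda/2)\left(\frac{\lambda}{\sinh\lambda}\right)^{1/2}$, so that $\kappa_\lambda^2=(\lambda/2)\coth(\lambda/2)$, and define $D_\lambda:L^2(\mathbb R^{2n})\to L^2(\mathbb R^{2n})$ by $D_\lambda f(x,u)=\kappa_\lambda^{\,n}\,f(\kappa_\lambda x,\kappa_\lambda u)$. Then $B_\lambda^*\circ T_\lambda\circ B=D_\lambda$, so that $\Psi_\mu^\lambda=D_\lambda\Phi_\mu$ for every $\mu\in\mathbb N^{2n}$. The functions $\Psi_\mu^\lambda$ are eigenfunctions of the deformed Hermite operator $H_\lambda=-\Delta+\left((\lambda/2)\coth(\lambda/2)\right)^2|\xi|^2$ on $\mathbb R^{2n}$ with eigenvalues $(2|\mu|+2n)\,(\lambda/2)\coth(\lambda/2)$.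
   Context: $\mathbb N=\{0,1,2,\dots\}$. For $a,b\in\mathbb C^m$ write $a\cdot b=\sum_j a_jb_j$ and $a^2=a\cdot a$ (no conjugation), and $|a|^2=a\cdot\bar a$. Hermite functions on $\mathbb R^{2n}$: $\Phi_\mu(\xi)=(-1)^{|\mu|}(\pi^{n}\mu!2^{|\mu|})^{-1/2}\left(\partial^\mu e^{-|\xi|^2}\right)e^{\frac12|\xi|^2}$, $\mu\in\mathbb N^{2n}$. Fock space and Bargmann transform: $\mathcal F(\mathbb C^{2n})$ is the Hilbert space of entire functions on $\mathbb C^{2n}$ that are square integrable with respect to $(4\pi)^{-n}e^{-\frac12|\zeta|^2}d\zeta$. The (unitary) Bargmann transform $B:L^2(\mathbb R^{2n})\to\mathcal F(\mathbb C^{2n})$ is $Bf(\zeta)=\pi^{-n}e^{\frac14\zeta^2}\int_{\mathbb R^{2n}}f(\xi)e^{-\frac12(\xi-\zeta)^2}d\xi$. Twisted Fock space: $c_{n,\lambda}=(4\pi)^{-n}\left(\frac{\lambda}{\sinh\lambda}\right)^n$, $w_\lambda(z,w)=4^nc_{n,\lambda}\,e^{\lambda\operatorname{Im}(z\cdot\bar w)}\,e^{-\frac12\lambda(\coth\lambda)(|z|^2+|w|^2)}$ for $(z,w)\in\mathbb C^{2n}$, and $\mathcal F^\lambda(\mathbb C^{2n})$ is the Hilbert space of entire functions on $\mathbb C^{2n}$ that are square integrable with respect to $w_\lambda(z,w)\,dz\,dw$. Twisted Bargmann transform: for $t>0$, $p_t^\lambda(z,w)=(4\pi)^{-n}\left(\frac{\lambda}{\sinh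 t\lambda}\right)^ne^{-\frac14\lambda(\coth t\lambda)(z^2+w^2)}$; for $f\in L^2(\mathbb R^{2n})$, $f*_\lambda p_{1/2}^\lambda(z,w)=\int_{\mathbb R^{2n}}f(y,v)\,p_{1/2}^\lambda(z-y,w-v)\,e^{-i\frac\lambda2(w\cdot y-z\cdot v)}\,dy\,dv$, and $B_\lambda f(z,w)=c_{n,\lambda}\,p_1^\lambda(z,w)^{-1}f*_\lambda p_{1/2}^\lambda(z,w)$. It is known that $B_\lambda:L^2(\mathbb R^{2n})\to\mathcal F^\lambda(\mathbb C^{2n})$ is unitary; $B_\lambda^*$ is its adjoint (inverse). The map $T_\lambda$: let $\sigma_\lambda(z,w)=\left(\frac{\lambda}{\sinh\lambda}\right)^{1/2}\left(\cosh\tfrac\lambda2\,z-i\sinh\tfrac\lambda2\,w,\ \cosh\tfrac\lambda2\,w+i\sinh\tfrac\lambda2\,z\right)$ on $\mathbb C^{2n}$ and $a_{n,\lambda}=\pi^{n/2}\sqrt{c_{n,\lambda}}$. Then $T_\lambda F(\zeta)=a_{n,\lambda}F(\sigma_\lambda\zeta)$, a map from $\mathcal F(\mathbb C^{2n})$ to $\mathcal F^\lambda(\mathbb C^{2n})$. The functions $\Psi_\mu^\lambda$: with $\zeta_\mu(z,w)=\pi^{-n/2}(2^{|\mu|}\mu!)^{-1/2}(z,w)^\mu$, $\Psi_\mu^\lambda\in L^2(\mathbb R^{2n})$ is the unique function with $B_\lambda\Psi_\mu^\lambda=T_\lambda\zeta_\mu$. *)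

(* Defs.v *)
From HB Require Import structures.
From mathcomp Require Import all_boot all_order all_algebra.
From mathcomp Require Import all_classical all_reals all_analysis.
From mathcomp Require Import complex.

Set Implicit Arguments.
Unset Strict Implicit.
Unset Printing Implicit Defensive.

Import Order.TTheory GRing.Theory Num.Theory.
Import numFieldNormedType.Exports.

Local Open Scope classical_set_scope.
Local Open Scope ring_scope.

Definition rv_display : measure_display -> measure_display.
Proof. exact. Qed.

Definition rv_coord (R : realType) (m : nat) (j : 'I_m) (x : 'rV[R]_m) :
  measurableTypeR R := x 0 j.

Section measurable_rv.
Variables (R : realType) (m : nat).

Let rv_set0 : g_sigma_preimage (@rv_coord R m) set0.
Proof. exact: sigma_algebra0. Qed.

Let rv_setC A :
  g_sigma_preimage (@rv_coord R m) A -> g_sigma_preimage (@rv_coord R m) (~` A).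
Proof. exact: sigma_algebraC. Qed.

Let rv_bigcup (F : (set 'rV[R]_m)^nat) :
  (forall i, g_sigma_preimage (@rv_coord R m) (F i)) ->
  g_sigma_preimage (@rv_coord R m) (\bigcup_i (F i)).
Proof. exact: sigma_algebra_bigcup. Qed.

(* The sigma-algebra generated by the coordinates, i.e. the Borel sets. *)
HB.instance Definition _ := @isMeasurable.Build (rv_display default_measure_display)
  'rV[R]_m (g_sigma_preimage (@rv_coord R m)) rv_set0 rv_setC rv_bigcup.

End measurable_rv.

Lemma measurable_rv_coord (R : realType) (m : nat) (j : 'I_m) :
  measurable_fun [set: 'rV[R]_m] (@rv_coord R m j).
Proof.
move=> _ Y mY; rewrite setTI; apply: sub_sigma_algebra => /=.
rewrite -bigcup_seq/=; exists j => /=; first by rewrite mem_index_enum.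
by exists Y => //; rewrite setTI.
Qed.

Lemma measurable_fun_rv (R : realType) (m : nat) d (T : measurableType d)
    (f : T -> 'rV[R]_m) :
  (forall j, measurable_fun [set: T] (rv_coord j \o f)) ->
  measurable_fun [set: T] f.
Proof.
move=> mf _ A mA.
suff : g_sigma_preimage (fun j => @rv_coord R m j \o f) `<=` measurable.
  by apply; rewrite g_sigma_preimage_comp; exists A.
apply: smallest_sub; first exact: sigma_algebra_measurable.
rewrite -bigcup_seq/=; apply: bigcup_sub => j _ B [C mC <-].
exact: mf.
Qed.

Section lebesgue_rv.
Variable R : realType.

Definition rv_cons (m : nat) (p : measurableTypeR R * 'rV[R]_m) : 'rV[R]_m.+1 :=
  row_mx (const_mx p.1 : 'rV[R]_1) p.2.

Lemma measurable_rv_cons (m : nat) : measurable_fun setT (@rv_cons m).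
Proof.
apply: measurable_fun_rv => j.
rewrite -[j](@splitK 1 m); case: (@fintype.split 1 m j) => k.
  rewrite [X in measurable_fun _ X](_ : _ = fst) /=; first exact: measurable_fst.
  by apply/funext => p; exact: (etrans (row_mxEl _ _ _ k) (mxE _ _ _ _)).
rewrite [X in measurable_fun _ X](_ : _ = rv_coord k \o snd) /=.
  apply: (measurableT_comp (measurable_rv_coord k)); exact: measurable_snd.
by apply/funext => p; exact: (row_mxEr (const_mx p.1 : 'rV_1) p.2 0 k).
Qed.

Definition rv_uncons (m : nat) (x : 'rV[R]_m.+1) :
    measurableTypeR R * 'rV[R]_m :=
  (x 0 ord0, \row_j x 0 (lift ord0 j)).

Lemma rv_consK (m : nat) : cancel (@rv_cons m) (@rv_uncons m).
Proof.
move=> [t y]; congr pair.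
  have -> : ord0 = lshift m ord0 :> 'I_(1 + m) by apply/val_inj.
  exact: (etrans (row_mxEl _ _ _ ord0) (mxE _ _ _ _)).
apply/rowP => j; rewrite mxE.
have -> : lift ord0 j = rshift 1 j :> 'I_(1 + m) by apply/val_inj.
exact: (row_mxEr (const_mx t : 'rV_1) y 0 j).
Qed.

Lemma measurable_rv_uncons (m : nat) : measurable_fun setT (@rv_uncons m).
Proof.
apply: measurable_fun_pair => /=; first exact: (@measurable_rv_coord R m.+1 ord0).
apply: measurable_fun_rv => j.
rewrite (_ : _ \o _ = @rv_coord R m.+1 (lift ord0 j)).
  exact: measurable_rv_coord.
by apply/funext => x; rewrite /= /rv_coord mxE.
Qed.

Section step.
Variables (m : nat) (mu : {sigma_finite_measure set 'rV[R]_m -> \bar R}).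

Definition lebesgue_rvS : set 'rV[R]_m.+1 -> \bar R :=
  pushforward (@lebesgue_measure R \x mu)%E (@rv_cons m).

Let mcons := @measurable_rv_cons m.

Let nu0 : lebesgue_rvS set0 = 0%E.
Proof. exact: measure0. Qed.

Let nu_ge0 A : (0 <= lebesgue_rvS A)%E.
Proof. exact: measure_ge0. Qed.

Let nu_sigma_additive : semi_sigma_additive lebesgue_rvS.
Proof. exact: measure_semi_sigma_additive. Qed.

HB.instance Definition _ := isMeasure.Build _ _ _ lebesgue_rvS
  nu0 nu_ge0 nu_sigma_additive.

Let nu_sigma_finite : sigma_finite setT lebesgue_rvS.
Proof.
have /sigma_finiteP[F [TF ndF Foo]] := sigma_finiteT (@lebesgue_measure R).
have /sigma_finiteP[G [TG ndG Goo]] := sigma_finiteT mu.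
exists (fun k => @rv_uncons m @^-1` (F k `*` G k)).
  apply/esym; rewrite -subTset => x _; set p := rv_uncons x.
  have [i _ Fi] : (\bigcup_i F i) p.1 by rewrite -TF.
  have [k _ Gk] : (\bigcup_k G k) p.2 by rewrite -TG.
  exists (maxn i k) => //; split.
    by move: (p.1) Fi; exact/subsetPset/ndF/leq_maxl.
  by move: (p.2) Gk; exact/subsetPset/ndG/leq_maxr.
move=> k; have [mF Fk] := Foo k; have [mG Gk] := Goo k; split.
  rewrite -[X in measurable X]setTI; apply: measurable_rv_uncons => //.
  exact: measurableX.
rewrite /lebesgue_rvS /pushforward -comp_preimage.
rewrite (_ : _ \o _ = id); last by apply/funext => p; exact: rv_consK.
by rewrite preimage_id product_measure1E// lte_mul_pinfty// ge0_fin_numE.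
Qed.

HB.instance Definition _ := Measure_isSigmaFinite.Build _ _ _ lebesgue_rvS
  nu_sigma_finite.

End step.

Fixpoint lebesgue_rv (m : nat) : {sigma_finite_measure set 'rV[R]_m -> \bar R} :=
  match m with
  | 0 => dirac (0 : 'rV[R]_0)
  | m'.+1 => lebesgue_rvS (lebesgue_rv m')
  end.

End lebesgue_rv.

Section complex_analysis.
Variable R : realType.
Local Notation C := R[i].

Definition cexp (z : C) : C :=
  (expR (complex.Re z))%:C%C * (cos (complex.Im z) +i* sin (complex.Im z))%C.

Definition sqmod (z : C) : R := complex.Re z ^+ 2 + complex.Im z ^+ 2.

Definition cintegral d (T : measurableType d) (mu : {measure set T -> \bar R})
    (f : T -> C) : C :=
  ((\int[mu]_x complex.Re (f x)) +i* (\int[mu]_x complex.Im (f x)))%C.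

(* Elements of L^2(R^m) are represented by Borel functions; equality in
   L^2(R^m) is equality almost everywhere, [ae_eqf] below. *)
Definition in_L2 (m : nat) (f : 'rV[R]_m -> C) : Prop :=
  [/\ measurable_fun [set: 'rV[R]_m] (fun x => complex.Re (f x)),
      measurable_fun [set: 'rV[R]_m] (fun x => complex.Im (f x)) &
      (\int[lebesgue_rv R m]_x (sqmod (f x))%:E < +oo)%E].

Definition ae_eqf (m : nat) (f g : 'rV[R]_m -> C) : Prop :=
  {ae lebesgue_rv R m, forall x, f x = g x}.

Definition L2_inner (m : nat) (f g : 'rV[R]_m -> C) : C :=
  cintegral (lebesgue_rv R m) (fun x => f x * conjc (g x)).

Definition cdot (m : nat) (a b : 'rV[C]_m) : C := \sum_j a 0 j * b 0 j.

Definition cconj (m : nat) (a : 'rV[C]_m) : 'rV[C]_m := map_mx (@conjc R) a.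

Definition cnorm2 (m : nat) (a : 'rV[C]_m) : R := complex.Re (cdot a (cconj a)).

Definition rnorm2 (m : nat) (x : 'rV[R]_m) : R := \sum_j x 0 j ^+ 2.

Definition to_cvec (m : nat) (x : 'rV[R]_m) : 'rV[C]_m :=
  map_mx (fun t : R => (t%:C)%C) x.

(* Lebesgue measure on C^m is [lebesgue_rv R m \x lebesgue_rv R m], carried
   over by (x, y) |-> x + iy. *)
Definition cpoint (m : nat) (p : 'rV[R]_m * 'rV[R]_m) : 'rV[C]_m :=
  \row_j (p.1 0 j +i* p.2 0 j)%C.

(* Complex Frechet differentiability at every point. *)
Definition entire (m : nat) (F : 'rV[C]_m -> C) : Prop :=
  forall zeta, differentiable (F : _ -> C^o) zeta.

Definition mlen (m : nat) (mu : 'I_m -> nat) : nat := (\sum_j mu j)%N.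

Definition mfact (m : nat) (mu : 'I_m -> nat) : nat := (\prod_j (mu j)`!)%N.

Definition pderiv (m : nat) (j : 'I_m) (f : 'rV[R]_m -> R) : 'rV[R]_m -> R :=
  fun x => 'D_(delta_mx 0 j : 'rV[R]_m) f x.

Definition mderiv (m : nat) (mu : 'I_m -> nat) (f : 'rV[R]_m -> R) :
    'rV[R]_m -> R :=
  foldr (fun j g => iter (mu j) (pderiv j) g) f (enum 'I_m).

Variable n : nat.
Implicit Types (f g h : 'rV[R]_(n + n) -> C) (F G : 'rV[C]_(n + n) -> C).
Implicit Types (mu : 'I_(n + n) -> nat) (lam t : R).

Definition hermite mu : 'rV[R]_(n + n) -> C := fun xi =>
  (((-1) ^+ mlen mu
    * (Num.sqrt (pi ^+ n * (mfact mu)%:R * 2 ^+ mlen mu))^-1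
    * mderiv mu (fun x => expR (- rnorm2 x)) xi
    * expR (2^-1 * rnorm2 xi))%:C)%C.

Definition bargmann f : 'rV[C]_(n + n) -> C := fun zeta =>
  ((pi ^- n)%:C)%C * cexp (4^-1 * cdot zeta zeta)
  * cintegral (lebesgue_rv R (n + n)) (fun xi =>
      let d := to_cvec xi - zeta in f xi * cexp (- (2^-1 * cdot d d))).

Definition sinh (x : R) : R := (expR x - expR (- x)) / 2.
Definition cosh (x : R) : R := (expR x + expR (- x)) / 2.
Definition coth (x : R) : R := cosh x / sinh x.

Definition cnlam lam : R := (4 * pi) ^- n * (lam / sinh lam) ^+ n.

Definition wlam lam (zeta : 'rV[C]_(n + n)) : R :=
  let z := lsubmx zeta in let w := rsubmx zeta in
  4 ^+ n * cnlam lam * expR (lam * complex.Im (cdot z (cconj w)))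
  * expR (- (2^-1 * lam * coth lam * (cnorm2 z + cnorm2 w))).

Definition in_twisted_fock lam F : Prop :=
  entire F /\
  (\int[lebesgue_rv R (n + n) \x lebesgue_rv R (n + n)]_p
     (sqmod (F (cpoint p)) * wlam lam (cpoint p))%:E < +oo)%E.

Definition twisted_fock_inner lam F G : C :=
  cintegral (lebesgue_rv R (n + n) \x lebesgue_rv R (n + n))%E (fun p =>
    F (cpoint p) * conjc (G (cpoint p)) * ((wlam lam (cpoint p))%:C)%C).

Definition heat lam t (z w : 'rV[C]_n) : C :=
  (((4 * pi) ^- n * (lam / sinh (t * lam)) ^+ n)%:C)%C
  * cexp (- (((4^-1 * lam * coth (t * lam))%:C)%C * (cdot z z + cdot w w))).

Definition twisted_conv_heat lam f t (z w : 'rV[C]_n) : C :=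
  cintegral (lebesgue_rv R (n + n)) (fun xi =>
    let y := to_cvec (lsubmx xi) in let v := to_cvec (rsubmx xi) in
    f xi * heat lam t (z - y) (w - v)
    * cexp (- ('i%C * ((lam / 2)%:C)%C * (cdot w y - cdot z v)))).

Definition twisted_bargmann lam f : 'rV[C]_(n + n) -> C := fun zeta =>
  let z := lsubmx zeta in let w := rsubmx zeta in
  ((cnlam lam)%:C)%C * (heat lam 1 z w)^-1 * twisted_conv_heat lam f 2^-1 z w.

(* The Hilbert space adjoint of [twisted_bargmann lam], sending G in F^lambda
   to the g in L^2 with <B_lambda h, G> = <h, g> for all h in L^2. Such a g is
   unique up to a.e. equality; [xget] picks one representative. *)
Definition twisted_bargmann_adj lam G : 'rV[R]_(n + n) -> C :=
  xget (fun=> 0) [set g | [/\ in_twisted_fock lam G, in_L2 g &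
    forall h, in_L2 h ->
      twisted_fock_inner lam (twisted_bargmann lam h) G = L2_inner h g]].

Definition sigma_lam lam (zeta : 'rV[C]_(n + n)) : 'rV[C]_(n + n) :=
  let z := lsubmx zeta in let w := rsubmx zeta in
  let ch := ((cosh (lam / 2))%:C)%C in let sh := ((sinh (lam / 2))%:C)%C in
  ((Num.sqrt (lam / sinh lam))%:C)%C *:
    row_mx (ch *: z - ('i%C * sh) *: w) (ch *: w + ('i%C * sh) *: z).

Definition anlam lam : R := Num.sqrt (pi ^+ n) * Num.sqrt (cnlam lam).

Definition Tlam lam F : 'rV[C]_(n + n) -> C := fun zeta =>
  ((anlam lam)%:C)%C * F (sigma_lam lam zeta).

Definition fock_monomial mu : 'rV[C]_(n + n) -> C := fun zeta =>
  (((Num.sqrt (pi ^+ n))^-1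
    * (Num.sqrt (2 ^+ mlen mu * (mfact mu)%:R))^-1)%:C)%C
  * \prod_j zeta 0 j ^+ mu j.

(* The element of L^2 (unique up to a.e. equality) that [twisted_bargmann lam]
   maps to T_lambda zeta_mu; [xget] picks one representative. *)
Definition Psi lam mu : 'rV[R]_(n + n) -> C :=
  xget (fun=> 0) [set psi | in_L2 psi /\
    twisted_bargmann lam psi = Tlam lam (fock_monomial mu)].

Definition kappa lam : R := cosh (lam / 2) * Num.sqrt (lam / sinh lam).

Definition dilation lam f : 'rV[R]_(n + n) -> C := fun xi =>
  ((kappa lam ^+ n)%:C)%C * f (kappa lam *: xi).

Definition C2 (m : nat) (f : 'rV[R]_m -> R) : Prop :=
  forall j,
  [/\ forall x, derivable f x (delta_mx 0 j : 'rV[R]_m),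
      continuous (pderiv j f) &
      forall k, (forall x, derivable (pderiv j f) x (delta_mx 0 k : 'rV[R]_m))
        /\ continuous (pderiv k (pderiv j f))].

Definition laplacian (m : nat) (f : 'rV[R]_m -> R) : 'rV[R]_m -> R :=
  fun x => \sum_j pderiv j (pderiv j f) x.

Definition claplacian (m : nat) (f : 'rV[R]_m -> C) : 'rV[R]_m -> C :=
  fun x => (laplacian (fun y => complex.Re (f y)) x
            +i* laplacian (fun y => complex.Im (f y)) x)%C.

Definition Hlam lam f : 'rV[R]_(n + n) -> C := fun xi =>
  - claplacian f xi
  + (((lam / 2 * coth (lam / 2)) ^+ 2 * rnorm2 xi)%:C)%C * f xi.

(* A nonzero element of L^2 is an eigenfunction of [Hlam lam] when it has a C^2
   representative that satisfies the differential equation pointwise. *)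
Definition Hlam_eigenfunction lam (E : R) f : Prop :=
  [/\ in_L2 f, ~ ae_eqf f (fun=> 0) &
    exists g, [/\ ae_eqf f g, C2 (fun x => complex.Re (g x)),
      C2 (fun x => complex.Im (g x)) &
      forall xi, Hlam lam g xi = (E%:C)%C * g xi]].

End complex_analysis.

(* Main.v *)
(* Every identity is reduced to the Gaussian transform
   [gint h z = int h(x) exp(-|x|^2/2 + z.x) dx]: completing squares gives
   [B f(zeta) = pi^-n exp(-zeta^2/4) gint f zeta], and the substitution
   [xi -> kappa xi] in the twisted convolution, with [kappa s sinh(lam/2) = lam/2]
   for [s^2 = lam / sinh lam], gives [B_lam (D_lam f) = T_lam (B f)] pointwise.

   The unitarity of [B_lam] is proved as follows. For fixed [x], [y |-> gint h (x + iy)]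
   is the Fourier transform of [h(xi) exp(-|xi|^2/2 + x.xi)], so Plancherel makes
   [gint], hence [B], isometric into the Fock space. Plancherel itself comes from
   damping by [exp(-s^2 |y|^2/4)], Fubini, and the continuity of translations in L^2.
   On C^(2n) = R^(2n) x R^(2n), [sigma_lam] is
   [(x, y) |-> (s ch x + s sh Jy, s ch y - s sh Jx)] with [J^2 = -1]; two affine
   substitutions give its Jacobian, and [w_lam] is the pull-back of the Gaussian weight,
   so [T_lam] is isometric. Polarization then gives [<B_lam h, B_lam g> = <h, g>], and
   the adjoint and [Psi] are determined a.e. by the isometry.

   Functions [K prod_j q_j(x_j) exp(-c x_j^2)] with polynomial [q_j] are stable under
   partial derivatives, [q] becoming [q' - 2 c X q]. Hermite functions have this form;
   integration by parts computes their Gaussian transform, and the Hermite equation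
   [q'' - 2 X q' + 2 k q = 0] is the eigenvalue equation. *)
Require Import Defs.
From HB Require Import structures.
From mathcomp Require Import all_boot all_order all_algebra.
From mathcomp Require Import all_classical all_reals all_analysis.
From mathcomp Require Import measurable_realfun complex ring lra.

Import Order.TTheory GRing.Theory Num.Theory.
Import numFieldNormedType.Exports.
Import complex.ComplexField.Normc.

Local Open Scope classical_set_scope.
Local Open Scope ring_scope.

Set Implicit Arguments.
Unset Strict Implicit.
Unset Printing Implicit Defensive.

(* The library has another [cpoint], the centre of a ball. *)
Local Notation cpoint := Defs.cpoint.
Local Notation Re := complex.Re.
Local Notation Im := complex.Im.
Local Notation "x %:C" := (x%:C)%C : ring_scope.

(** * Complex numbers and complex-valued integrals *)

Section complex_basics.
Variable R : realType.
Local Notation C := R[i].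
Implicit Types (z w : C) (a : R).

(** The kernel of [twisted_bargmann] contains [exp(-(lam/4) coth(lam/2) |xi|^2)], and
    [(lam/4) coth(lam/2) = kappa^2/2]: the dilation by [kappa] is what turns this Gaussian into the
    [exp(-|xi|^2/2)] of the Bargmann kernel. The linear term of the exponent becomes
    [sigma_lam zeta . (kappa xi)], and the remaining quadratic term in [zeta] is
    [-(sigma_lam zeta)^2/4], because the complex matrix of [sigma_lam] is orthogonal up to the
    factor [s]. Since [twisted_bargmann_adj] and [Psi] are chosen by [xget], each is handled in two
    halves: the explicit dilated function has the defining property, so the default value is never
    returned, and the isometry makes any two candidates agree almost everywhere. Integrability is
    the recurring obstacle, since elements of L^2 need not be integrable. The integrand of [gint h]
    is the product of [h] with a Gaussian that lies in L^2, so for fixed [x] it belongs to L^1 and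
    to L^2; this is the class for which Plancherel's identity is proved. *)

Lemma complex_eq z w : Re z = Re w -> Im z = Im w -> z = w.
Proof. by case: z w => ? ? [? ?] /= -> ->. Qed.

Lemma ReD z w : Re (z + w) = Re z + Re w. Proof. by case: z w => ? ? []. Qed.
Lemma ImD z w : Im (z + w) = Im z + Im w. Proof. by case: z w => ? ? []. Qed.
Lemma ReN z : Re (- z) = - Re z. Proof. by case: z. Qed.
Lemma ImN z : Im (- z) = - Im z. Proof. by case: z. Qed.
Lemma ReM z w : Re (z * w) = Re z * Re w - Im z * Im w.
Proof. by case: z w => ? ? []. Qed.
Lemma ImM z w : Im (z * w) = Re z * Im w + Im z * Re w.
Proof. by case: z w => ? ? []. Qed.
Lemma ReJ z : Re (conjc z) = Re z. Proof. by case: z. Qed.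
Lemma ImJ z : Im (conjc z) = - Im z. Proof. by case: z. Qed.

Definition ReImE := (ReD, ImD, ReN, ImN, ReM, ImM, ReJ, ImJ).

Lemma realcM a b : (a * b)%:C = a%:C * b%:C :> C. Proof. exact: rmorphM. Qed.
Lemma realcD a b : (a + b)%:C = a%:C + b%:C :> C. Proof. exact: rmorphD. Qed.
Lemma realcN a : (- a)%:C = - a%:C :> C. Proof. exact: rmorphN. Qed.
Lemma realcV a : (a^-1)%:C = (a%:C)^-1 :> C. Proof. exact: fmorphV. Qed.
Lemma realcX a n : (a ^+ n)%:C = a%:C ^+ n :> C. Proof. exact: rmorphXn. Qed.

Lemma Re_sum (I : Type) (s : seq I) (F : I -> C) :
  Re (\sum_(i <- s) F i) = \sum_(i <- s) Re (F i).
Proof. by elim/big_rec2: _ => // i x y _ <-; rewrite ReD. Qed.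

Lemma Im_sum (I : Type) (s : seq I) (F : I -> C) :
  Im (\sum_(i <- s) F i) = \sum_(i <- s) Im (F i).
Proof. by elim/big_rec2: _ => // i x y _ <-; rewrite ImD. Qed.

Lemma normc_ge0 z : 0 <= normc z.
Proof. by case: z => a b /=; exact: sqrtr_ge0. Qed.

Lemma normcE z : `|z| = (normc z)%:C :> C.
Proof. by case: z. Qed.

Lemma sqmod_normc z : sqmod z = normc z ^+ 2.
Proof. by case: z => a b; rewrite /sqmod /= sqr_sqrtr ?addr_ge0 ?sqr_ge0. Qed.

Lemma sqmod_ge0 z : 0 <= sqmod z.
Proof. by rewrite sqmod_normc sqr_ge0. Qed.

Lemma sqmodM z w : sqmod (z * w) = sqmod z * sqmod w.
Proof. by rewrite !sqmod_normc normcM exprMn. Qed.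

Lemma sqmod_realc a : sqmod a%:C = a ^+ 2 :> R.
Proof. by rewrite /sqmod /= expr0n addr0. Qed.

Lemma sqmodJ z : sqmod (conjc z) = sqmod z.
Proof. by rewrite /sqmod !ReImE sqrrN. Qed.

Lemma sqmod_eq0 z : sqmod z = 0 -> z = 0.
Proof. by rewrite sqmod_normc => /eqP; rewrite sqrf_eq0 => /eqP /eq0_normc. Qed.

Lemma mulc_conj z : z * conjc z = (sqmod z)%:C.
Proof. by case: z => a b; apply: complex_eq; rewrite !ReImE /sqmod /=; ring. Qed.

Lemma normc_realc a : normc a%:C = `|a| :> R.
Proof. by rewrite /normc /= expr0n addr0 sqrtr_sqr. Qed.

Lemma normcJ z : normc (conjc z) = normc z.
Proof. by case: z => a b /=; rewrite sqrrN. Qed.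

Lemma normc_sum (I : Type) (s : seq I) (F : I -> C) :
  normc (\sum_(i <- s) F i) <= \sum_(i <- s) normc (F i).
Proof.
elim/big_rec2: _ => [|i x y _ h]; first by rewrite normc0.
by apply: (le_trans (le_normcD _ _)); rewrite lerD2l.
Qed.

Lemma le_Re_normc z : `|Re z| <= normc z.
Proof. by rewrite -lecR; have := normc_ge_Re z; rewrite normcE. Qed.

Lemma le_Im_normc z : `|Im z| <= normc z.
Proof.
case: z => a b /=; rewrite -(sqrtr_sqr b) ler_wsqrtr//.
by rewrite lerDr sqr_ge0.
Qed.

Lemma le_normc_ReIm z : normc z <= `|Re z| + `|Im z|.
Proof.
rewrite -(@ler_pXn2r _ 2)// ?nnegrE ?normc_ge0 ?addr_ge0//.
rewrite -sqmod_normc /sqmod sqrrD !real_normK ?num_real//.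
by rewrite [leRHS]addrAC lerDl mulrn_wge0// mulr_ge0.
Qed.

(** Real polarisation; it carries the isometries over to inner products. *)
Lemma ReJ_mul z w :
  Re (z * conjc w) = 4^-1 * (sqmod (z + w) - sqmod (z - w)).
Proof. by rewrite /sqmod !ReImE; field. Qed.

Lemma sqmodD_le z w : sqmod (z + w) <= 2 * sqmod z + 2 * sqmod w.
Proof.
rewrite /sqmod !ReImE -subr_ge0.
have -> : 2 * (Re z ^+ 2 + Im z ^+ 2) + 2 * (Re w ^+ 2 + Im w ^+ 2) -
  ((Re z + Re w) ^+ 2 + (Im z + Im w) ^+ 2) =
  (Re z - Re w) ^+ 2 + (Im z - Im w) ^+ 2 by ring.
by rewrite addr_ge0// sqr_ge0.
Qed.

Lemma cexpD z w : cexp (z + w) = cexp z * cexp w.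
Proof.
apply: complex_eq; rewrite /cexp !ReImE /= expRD ?cosD ?sinD; ring.
Qed.

Lemma cexp_realc a : cexp a%:C = (expR a)%:C :> C.
Proof.
by apply: complex_eq; rewrite /cexp !ReImE /= ?cos0 ?sin0; ring.
Qed.

Lemma cexp0 : cexp 0 = 1 :> C.
Proof. by have := cexp_realc 0; rewrite expR0. Qed.

Lemma cexpN z : cexp (- z) = (cexp z)^-1.
Proof.
have h : cexp z * cexp (- z) = 1 by rewrite -cexpD subrr cexp0.
have z0 : cexp z != 0.
  by apply/eqP => z0; move/eqP: h; rewrite z0 mul0r eq_sym oner_eq0.
by apply: (mulfI z0); rewrite h divff.
Qed.

Lemma cexp_sum (I : Type) (s : seq I) (F : I -> C) :
  cexp (\sum_(i <- s) F i) = \prod_(i <- s) cexp (F i).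
Proof. by elim/big_rec2: _ => [|i x y _ <-]; rewrite ?cexp0 ?cexpD. Qed.

Lemma sqmod_cexp z : sqmod (cexp z) = expR (2 * Re z).
Proof.
rewrite /cexp sqmodM sqmod_realc /sqmod /= cos2Dsin2 mulr1.
by rewrite -expRM_natl mulr_natl.
Qed.

Lemma normc_cexp z : normc (cexp z) = expR (Re z).
Proof.
rewrite /cexp normcM normc_realc ger0_norm ?expR_ge0//.
by rewrite /normc /= cos2Dsin2 sqrtr1 mulr1.
Qed.

Lemma cexpJ z : conjc (cexp z) = cexp (conjc z).
Proof.
by apply: complex_eq; rewrite /cexp !ReImE /= ?cosN ?sinN; ring.
Qed.

Lemma cexp_neq0 z : cexp z != 0.
Proof.
apply/eqP => z0; have := normc_cexp z; rewrite z0 normc0 => /esym/eqP.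
by rewrite gt_eqF// expR_gt0.
Qed.

End complex_basics.

Section complex_measurable.
Variable R : realType.
Local Notation C := R[i].
Context d (T : measurableType d).
Implicit Types f g : T -> C.

Definition cmeas f :=
  measurable_fun setT (fun x => Re (f x)) /\
  measurable_fun setT (fun x => Im (f x)).

Lemma cmeas_cst (c : C) : cmeas (fun=> c).
Proof. by split; exact: measurable_cst. Qed.

Lemma cmeas_real (f : T -> R) :
  measurable_fun setT f -> cmeas (fun x => (f x)%:C).
Proof. by split => //=; exact: measurable_cst. Qed.

Lemma cmeasD f g : cmeas f -> cmeas g -> cmeas (fun x => f x + g x).
Proof.
move=> [rf mf] [rg mg]; split.
- by under eq_fun do rewrite ReD; exact: measurable_funD.
- by under eq_fun do rewrite ImD; exact: measurable_funD.
Qed.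

Lemma cmeasN f : cmeas f -> cmeas (fun x => - f x).
Proof.
move=> [rf mf]; split.
- by under eq_fun do rewrite ReN; exact: measurableT_comp.
- by under eq_fun do rewrite ImN; exact: measurableT_comp.
Qed.

Lemma cmeasB f g : cmeas f -> cmeas g -> cmeas (fun x => f x - g x).
Proof. by move=> mf mg; apply: cmeasD => //; exact: cmeasN. Qed.

Lemma cmeasJ f : cmeas f -> cmeas (fun x => conjc (f x)).
Proof.
move=> [rf mf]; split.
- by under eq_fun do rewrite ReJ.
- by under eq_fun do rewrite ImJ; exact: measurableT_comp.
Qed.

Lemma cmeasM f g : cmeas f -> cmeas g -> cmeas (fun x => f x * g x).
Proof.
move=> [rf mf] [rg mg]; split.
- under eq_fun do rewrite ReM.
  by apply: measurable_funB; exact: measurable_funM.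
- under eq_fun do rewrite ImM.
  by apply: measurable_funD; exact: measurable_funM.
Qed.

Lemma cmeas_cexp f : cmeas f -> cmeas (fun x => cexp (f x)).
Proof.
move=> [rf mf]; apply: cmeasM.
  apply: cmeas_real; exact: (measurableT_comp (@measurable_expR R)).
split=> /=.
- apply: (measurableT_comp _ mf).
  exact: continuous_measurable_fun (@continuous_cos R).
- apply: (measurableT_comp _ mf).
  exact: continuous_measurable_fun (@continuous_sin R).
Qed.

Lemma cmeas_sum (I : Type) (s : seq I) (F : I -> T -> C) :
  (forall i, cmeas (F i)) -> cmeas (fun x => \sum_(i <- s) F i x).
Proof.
move=> mF; split.
- under eq_fun do rewrite Re_sum.
  by apply: measurable_sum => i; case: (mF i).
- under eq_fun do rewrite Im_sum.
  by apply: measurable_sum => i; case: (mF i).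
Qed.

Lemma cmeas_prod (I : Type) (s : seq I) (F : I -> T -> C) :
  (forall i, cmeas (F i)) -> cmeas (fun x => \prod_(i <- s) F i x).
Proof.
move=> mF; elim: s => [|i s IH].
  by under eq_fun do rewrite big_nil; exact: cmeas_cst.
by under eq_fun do rewrite big_cons; exact: cmeasM.
Qed.

Lemma measurable_sqmod f : cmeas f -> measurable_fun setT (fun x => sqmod (f x)).
Proof.
by move=> [rf mf]; apply: measurable_funD; exact: measurable_funX.
Qed.

Lemma measurable_normc f : cmeas f -> measurable_fun setT (fun x => normc (f x)).
Proof.
move=> mf; have -> : (fun x => normc (f x)) = Num.sqrt \o (fun x => sqmod (f x)).
  by apply/funext => x /=; rewrite sqmod_normc sqrtr_sqr ger0_norm ?normc_ge0.
apply: (measurableT_comp _ (measurable_sqmod mf)).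
exact: continuous_measurable_fun (@sqrt_continuous R).
Qed.

End complex_measurable.

Lemma cmeas_comp (R : realType) d d' (T : measurableType d) (U : measurableType d')
    (phi : U -> T) (f : T -> R[i]) :
  measurable_fun setT phi -> cmeas f -> cmeas (f \o phi).
Proof.
move=> mphi [rf mf]; split.
- exact: (measurableT_comp rf mphi).
- exact: (measurableT_comp mf mphi).
Qed.

Section integral_pushforward.
Context d1 d2 (X : measurableType d1) (Y : measurableType d2) (R : realType).
Variables (phi : X -> Y) (mu : {measure set X -> \bar R}).
Hypothesis mphi : measurable_fun setT phi.

(** Working with positive and negative parts makes the formula hold for every measurable [f],
    integrable or not, so that a change of variables calls for no prior bound. *)
Lemma integral_pushforwardT (f : Y -> \bar R) : measurable_fun setT f ->
  (\int[pushforward mu phi]_y f y = \int[mu]_x f (phi x))%E.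
Proof.
move=> mf; rewrite [LHS]integralE [RHS]integralE.
rewrite (ge0_integral_pushforward mphi _ measurableT (measurable_funepos mf))//.
rewrite (ge0_integral_pushforward mphi _ measurableT (measurable_funeneg mf))//.
rewrite preimage_setT; congr (_ - _)%E; apply: eq_integral => x _ /=;
  by rewrite ?(funeposE, funenegE).
Qed.

End integral_pushforward.

Section complex_integral.
Variable R : realType.
Local Notation C := R[i].

Section one_measure.
Context d (T : measurableType d) (mu : {measure set T -> \bar R}).
Implicit Types f g : T -> C.

Definition cintegrable f :=
  mu.-integrable setT (fun x => (Re (f x))%:E) /\
  mu.-integrable setT (fun x => (Im (f x))%:E).

Lemma cintegrable_cmeas f : cintegrable f -> cmeas f.
Proof.
by move=> [/measurable_int rf /measurable_int mf]; split; exact/measurable_EFinP.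
Qed.

Lemma cintegrable_le f (g : T -> R) : cmeas f ->
  mu.-integrable setT (fun x => (g x)%:E) ->
  (forall x, normc (f x) <= g x) -> cintegrable f.
Proof.
move=> [rf mf] ig fg; split.
- apply: (le_integrable _ _ _ ig) => //; first exact/measurable_EFinP.
  move=> x _; rewrite lee_fin; apply: (le_trans (le_Re_normc _)).
  by apply: (le_trans (fg x)); exact: ler_norm.
- apply: (le_integrable _ _ _ ig) => //; first exact/measurable_EFinP.
  move=> x _; rewrite lee_fin; apply: (le_trans (le_Im_normc _)).
  by apply: (le_trans (fg x)); exact: ler_norm.
Qed.

Lemma integrable_normc f : cintegrable f ->
  mu.-integrable setT (fun x => (normc (f x))%:E).
Proof.
move=> cf; have [rf mf] := cf.
have h : mu.-integrable setT
    ((fun x => `|(Re (f x))%:E|) \+ (fun x => `|(Im (f x))%:E|))%E.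
  by apply: integrableD => //; exact: integrable_abse.
apply: (le_integrable _ _ _ h) => //.
  exact/measurable_EFinP/measurable_normc/cintegrable_cmeas.
move=> x _ /=; rewrite lee_fin ger0_norm ?normc_ge0// ger0_norm ?addr_ge0//.
exact: le_normc_ReIm.
Qed.

Lemma cintegrable_normcP f : cmeas f ->
  (\int[mu]_x (normc (f x))%:E < +oo)%E -> cintegrable f.
Proof.
move=> mf foo; apply: (cintegrable_le mf _ (fun x => lexx (normc (f x)))).
apply/integrableP; split; first exact/measurable_EFinP/measurable_normc.
by under eq_integral => x _ do rewrite /= ger0_norm ?normc_ge0//.
Qed.

Lemma cintegrableD f g : cintegrable f -> cintegrable g ->
  cintegrable (fun x => f x + g x).
Proof.
move=> [rf mf] [rg mg]; split.
- by under eq_fun do rewrite ReD EFinD; exact: integrableD.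
- by under eq_fun do rewrite ImD EFinD; exact: integrableD.
Qed.

Lemma cintegrableN f : cintegrable f -> cintegrable (fun x => - f x).
Proof.
move=> [rf mf]; split.
- by under eq_fun do rewrite ReN EFinN; exact: integrableN.
- by under eq_fun do rewrite ImN EFinN; exact: integrableN.
Qed.

Lemma cintegrableZl (c : C) f : cintegrable f -> cintegrable (fun x => c * f x).
Proof.
move=> [rf mf]; split.
- under eq_fun do rewrite ReM EFinB !EFinM.
  by apply: integrableB => //; exact: integrableZl.
- under eq_fun do rewrite ImM EFinD !EFinM.
  by apply: integrableD => //; exact: integrableZl.
Qed.

Lemma eq_cintegral f g : f =1 g -> cintegral mu f = cintegral mu g.
Proof. by move=> fg; congr (cintegral mu _); exact/funext. Qed.

Lemma cintegralD f g : cintegrable f -> cintegrable g ->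
  cintegral mu (fun x => f x + g x) = cintegral mu f + cintegral mu g.
Proof.
move=> [rf mf] [rg mg]; apply: complex_eq; rewrite /cintegral /=.
- by under eq_Rintegral do rewrite ReD; exact: RintegralD.
- by under eq_Rintegral do rewrite ImD; exact: RintegralD.
Qed.

Lemma cintegralZl (c : C) f : cintegrable f ->
  cintegral mu (fun x => c * f x) = c * cintegral mu f.
Proof.
move=> [rf mf]; apply: complex_eq; rewrite !ReImE /cintegral /=.
- under eq_Rintegral do rewrite ReM.
  by rewrite RintegralB ?RintegralZl//; 
  [exact: (integrableZl measurableT _ rf)|exact: (integrableZl measurableT _ mf)].
- under eq_Rintegral do rewrite ImM.
  by rewrite RintegralD ?RintegralZl//; 
  [exact: (integrableZl measurableT _ mf)|exact: (integrableZl measurableT _ rf)].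
Qed.

Lemma cintegralN f : cintegrable f ->
  cintegral mu (fun x => - f x) = - cintegral mu f.
Proof.
move=> cf; rewrite -mulN1r -cintegralZl//.
by apply: eq_cintegral => x; rewrite mulN1r.
Qed.

Lemma cintegralB f g : cintegrable f -> cintegrable g ->
  cintegral mu (fun x => f x - g x) = cintegral mu f - cintegral mu g.
Proof.
by move=> cf cg; rewrite cintegralD ?cintegralN//; exact: cintegrableN.
Qed.

Lemma cintegralJ f : cintegrable f ->
  cintegral mu (fun x => conjc (f x)) = conjc (cintegral mu f).
Proof.
move=> [rf mf]; apply: complex_eq; rewrite /cintegral /=.
- by under eq_Rintegral do rewrite ReJ.
- under eq_Rintegral do rewrite ImJ -mulN1r.
  by rewrite RintegralZl// mulN1r.
Qed.

Lemma cintegrableJ f : cintegrable f -> cintegrable (fun x => conjc (f x)).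
Proof.
move=> [rf mf]; split.
- by under eq_fun do rewrite ReJ.
- by under eq_fun do rewrite ImJ EFinN; exact: integrableN.
Qed.

(** The factor 2 comes from bounding the real and imaginary parts separately; the estimates that
    rely on it only need some finite constant. *)
Lemma le_normc_cintegral f (g : T -> R) : cmeas f ->
  mu.-integrable setT (fun x => (g x)%:E) ->
  (forall x, normc (f x) <= g x) ->
  normc (cintegral mu f) <= 2 * \int[mu]_x g x.
Proof.
move=> mf ig fg; have [rf sf] := cintegrable_le mf ig fg.
apply: (le_trans (le_normc_ReIm _)); rewrite /cintegral /=.
have -> : 2 * \int[mu]_x g x = \int[mu]_x g x + \int[mu]_x g x by ring.
apply: lerD.
- apply: (le_trans (le_normr_Rintegral _ _)) => //.
  apply: le_Rintegral => //; first exact: integrable_abse rf.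
  by move=> x _; exact: le_trans (le_Re_normc _) (fg x).
- apply: (le_trans (le_normr_Rintegral _ _)) => //.
  apply: le_Rintegral => //; first exact: integrable_abse sf.
  by move=> x _; exact: le_trans (le_Im_normc _) (fg x).
Qed.

Lemma ae_eq_cintegral f g : cmeas f -> cmeas g ->
  {ae mu, forall x, f x = g x} -> cintegral mu f = cintegral mu g.
Proof.
move=> [rf mf] [rg mg] fg; apply: complex_eq; rewrite /cintegral /= /Rintegral.
- congr fine; apply: ae_eq_integral => //; try exact/measurable_EFinP.
  by apply: filterS fg => x ->.
- congr fine; apply: ae_eq_integral => //; try exact/measurable_EFinP.
  by apply: filterS fg => x ->.
Qed.

Lemma cintegral_real (f : T -> R) :
  cintegral mu (fun x => (f x)%:C) = (\int[mu]_x f x)%:C.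
Proof.
apply: complex_eq => //; rewrite /cintegral /=.
by rewrite Rintegral_cst// mul0r.
Qed.

End one_measure.

Lemma cintegral_pushforward d1 d2 (X : measurableType d1) (Y : measurableType d2)
    (phi : X -> Y) (mu : {measure set X -> \bar R})
    (nu : {measure set Y -> \bar R}) (f : Y -> C) :
  measurable_fun setT phi -> (forall A, measurable A -> nu A = pushforward mu phi A) ->
  cmeas f -> cintegral nu f = cintegral mu (f \o phi).
Proof.
move=> mphi nuE [rf mf].
rewrite /cintegral /Rintegral.
rewrite !(@eq_measure_integral _ _ _ _ (pushforward mu phi) nu); last first.
- by move=> A mA _; exact: nuE.
- by move=> A mA _; exact: nuE.
by congr Complex; congr fine; apply: (integral_pushforwardT _ mphi);
  exact/measurable_EFinP.
Qed.

Section product.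
Context d1 d2 (T1 : measurableType d1) (T2 : measurableType d2).
Variables (m1 : {sigma_finite_measure set T1 -> \bar R}).
Variables (m2 : {sigma_finite_measure set T2 -> \bar R}).
Local Open Scope ereal_scope.

(** An inner integral may be infinite, and [fine] then returns 0. This happens only on a null set of
    [x], because almost every section is integrable. *)
Lemma Rintegral12 (f : T1 * T2 -> R) :
  (m1 \x m2).-integrable setT (fun p => (f p)%:E) ->
  (\int[m1]_x \int[m2]_y f (x, y) = \int[m1 \x m2]_p f p)%R.
Proof.
move=> fi; rewrite /Rintegral -integral12_prod_meas1//; congr fine.
apply: ae_eq_integral => //.
- apply/measurable_EFinP; apply: measurableT_comp; first exact: fine_measurable.
  exact: measurable_fubini_F fi.
- exact: measurable_fubini_F fi.
apply: filterS (ae_integrable1 fi) => x h _; rewrite fineK//.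
exact: integrable_fin_num.
Qed.

Lemma Rintegral21 (f : T1 * T2 -> R) :
  (m1 \x m2).-integrable setT (fun p => (f p)%:E) ->
  (\int[m2]_y \int[m1]_x f (x, y) = \int[m1 \x m2]_p f p)%R.
Proof.
move=> fi; rewrite /Rintegral -integral21_prod_meas1//; congr fine.
apply: ae_eq_integral => //.
- apply/measurable_EFinP; apply: measurableT_comp; first exact: fine_measurable.
  exact: measurable_fubini_G fi.
- exact: measurable_fubini_G fi.
apply: filterS (ae_integrable2 fi) => x h _; rewrite fineK//.
exact: integrable_fin_num.
Qed.

Lemma cintegral12 (f : T1 * T2 -> C) : cintegrable (m1 \x m2) f ->
  cintegral m1 (fun x => cintegral m2 (fun y => f (x, y))) =
  cintegral (m1 \x m2) f.
Proof.
move=> [rf mf]; apply: complex_eq; rewrite /cintegral /=.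
- exact: Rintegral12 rf.
- exact: Rintegral12 mf.
Qed.

Lemma cintegral21 (f : T1 * T2 -> C) : cintegrable (m1 \x m2) f ->
  cintegral m2 (fun y => cintegral m1 (fun x => f (x, y))) =
  cintegral (m1 \x m2) f.
Proof.
move=> [rf mf]; apply: complex_eq; rewrite /cintegral /=.
- exact: Rintegral21 rf.
- exact: Rintegral21 mf.
Qed.

Lemma le_abs_fine (x : \bar R) : `|(fine x)%:E| <= `|x|.
Proof. by case: x => [r| |] //=; rewrite ?normr0 ?leey. Qed.

Lemma cintegrable_fubini1 (f : T1 * T2 -> C) : cintegrable (m1 \x m2) f ->
  cintegrable m1 (fun x => cintegral m2 (fun y => f (x, y))).
Proof.
have h (g : T1 * T2 -> R) : (m1 \x m2).-integrable setT (fun p => (g p)%:E) ->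
    m1.-integrable setT (fun x => (\int[m2]_y g (x, y))%:E).
  move=> ig; apply: (le_integrable _ _ _ (integrable_fubini_F ig)) => //.
    apply/measurable_EFinP; apply: measurableT_comp; first exact: fine_measurable.
    exact: measurable_fubini_F ig.
  by move=> x _; exact: le_abs_fine.
by move=> [rf mf]; split; [exact: (h _ rf)|exact: (h _ mf)].
Qed.

Lemma cintegrable_fubini2 (f : T1 * T2 -> C) : cintegrable (m1 \x m2) f ->
  cintegrable m2 (fun y => cintegral m1 (fun x => f (x, y))).
Proof.
have h (g : T1 * T2 -> R) : (m1 \x m2).-integrable setT (fun p => (g p)%:E) ->
    m2.-integrable setT (fun y => (\int[m1]_x g (x, y))%:E).
  (* The partial integral of [|g|] is a majorant, and its integral is finite by Tonelli. *)
  move=> ig; have ig2 : m2.-integrable setT (fubini_G m1 (fun p => (g p)%:E)).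
    apply/integrableP; split; first exact: measurable_fubini_G ig.
    apply: le_lt_trans ((integrable21ltyP _ _ (measurable_int _ ig)).1 ig).
    apply: ge0_le_integral => //.
    - apply: measurableT_comp => //; exact: measurable_fubini_G ig.
    - apply: (measurable_fun_fubini_tonelli_G (abse \o (fun p => (g p)%:E))) => //=.
      by apply: measurableT_comp => //; exact: measurable_int ig.
    - move=> y _; apply: le_abse_integral => //.
      exact: (measurableT_comp (measurable_int _ ig) (measurable_pair2 y)).
  apply: (le_integrable _ _ _ ig2) => //.
    apply/measurable_EFinP; apply: measurableT_comp; first exact: fine_measurable.
    exact: measurable_fubini_G ig.
  by move=> x _; exact: le_abs_fine.
by move=> [rf mf]; split; [exact: (h _ rf)|exact: (h _ mf)].
Qed.

Lemma integrable_tensor (u : T1 -> R) (v : T2 -> R) :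
  m1.-integrable setT (fun x => (u x)%:E) ->
  m2.-integrable setT (fun x => (v x)%:E) ->
  (m1 \x m2).-integrable setT (fun p => (u p.1 * v p.2)%:E).
Proof.
move=> iu iv.
have mu' : measurable_fun setT u by apply/measurable_EFinP/measurable_int/iu.
have mv : measurable_fun setT v by apply/measurable_EFinP/measurable_int/iv.
have mf : measurable_fun setT (fun p : T1 * T2 => (u p.1 * v p.2)%:E).
  apply/measurable_EFinP; apply: measurable_funM.
  - exact: measurableT_comp mu' measurable_fst.
  - exact: measurableT_comp mv measurable_snd.
apply/integrable12ltyP => //=.
under eq_integral => x _.
  under eq_integral => y _ do rewrite normrM EFinM.
  rewrite ge0_integralZl//; last first.
    by apply/measurable_EFinP; exact: measurableT_comp.
  over.
have [_ iuoo] := integrableP _ _ _ iu; have [_ ivoo] := integrableP _ _ _ iv.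
rewrite ge0_integralZr//.
- by rewrite lte_mul_pinfty// ?integral_ge0// ge0_fin_numE// integral_ge0.
- by apply/measurable_EFinP; exact: measurableT_comp.
- by apply: integral_ge0 => y _.
Qed.

Lemma cmeas_tensor (u : T1 -> C) (v : T2 -> C) : cmeas u -> cmeas v ->
  cmeas (fun p : T1 * T2 => (u p.1 * v p.2)%R).
Proof.
move=> mu' mv; apply: cmeasM.
- exact: cmeas_comp measurable_fst mu'.
- exact: cmeas_comp measurable_snd mv.
Qed.

Lemma cintegrable_tensor (u : T1 -> C) (v : T2 -> C) :
  cintegrable m1 u -> cintegrable m2 v ->
  cintegrable (m1 \x m2) (fun p => (u p.1 * v p.2)%R).
Proof.
move=> iu iv.
apply: (cintegrable_le _
  (integrable_tensor (integrable_normc iu) (integrable_normc iv))).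
- by apply: cmeas_tensor; [exact: cintegrable_cmeas iu|exact: cintegrable_cmeas iv].
- by move=> p; rewrite normcM.
Qed.

Lemma cintegral_tensor (u : T1 -> C) (v : T2 -> C) :
  cintegrable m1 u -> cintegrable m2 v ->
  (cintegral (m1 \x m2) (fun p => u p.1 * v p.2) =
   cintegral m1 u * cintegral m2 v)%R.
Proof.
move=> iu iv; rewrite -cintegral12; last exact: cintegrable_tensor.
rewrite mulrC -cintegralZl//; apply: eq_cintegral => x /=.
by rewrite cintegralZl// mulrC.
Qed.

(** Tonelli's measurability applies to the positive and negative parts separately, so the conclusion
    covers sections that are not integrable. *)
Lemma cmeas_cintegral (f : T1 * T2 -> C) : cmeas f ->
  cmeas (fun x => cintegral m2 (fun y => f (x, y))).
Proof.
have h (g : T1 * T2 -> R) : measurable_fun setT g ->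
    measurable_fun setT (fun x => (\int[m2]_y g (x, y))%R).
  move=> mg; rewrite /Rintegral.
  apply: measurableT_comp; first exact: fine_measurable.
  under eq_fun do rewrite integralE.
  have mg' : measurable_fun setT (fun p => (g p)%:E) by exact/measurable_EFinP.
  apply: emeasurable_funB.
  - have /= := measurable_fun_fubini_tonelli_F (m2 := m2) (fun p => (g p)%:E)^\+%E
      (measurable_funepos mg') (fun p => funepos_ge0 _ p).
    rewrite /fubini_F; congr (measurable_fun _ _); apply/funext => x.
    by apply: eq_integral => y _; rewrite !funeposE.
  - have /= := measurable_fun_fubini_tonelli_F (m2 := m2) (fun p => (g p)%:E)^\-%E
      (measurable_funeneg mg') (fun p => funeneg_ge0 _ p).
    rewrite /fubini_F; congr (measurable_fun _ _); apply/funext => x.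
    by apply: eq_integral => y _; rewrite !funenegE.
by move=> [rf mf]; split; [exact: (h _ rf)|exact: (h _ mf)].
Qed.

End product.
End complex_integral.

(** * Affine substitutions in Lebesgue integrals *)

Section lebesgue_affine.
Variable R : realType.
Local Notation leb := (@lebesgue_measure R).

Lemma measurable_affine (c a : R) :
  measurable_fun setT (fun t : measurableTypeR R => c * t + a : measurableTypeR R).
Proof.
apply: measurable_funD; last exact: measurable_cst.
by apply: measurable_funM; [exact: measurable_cst|exact: measurable_id].
Qed.

(** The push-forward under [t |-> c t + a], multiplied by [c], gives every half-open interval its
    length, and Lebesgue measure is the only measure that does. *)
Lemma lebesgue_measure_affine (c a : R) (A : set R) : 0 < c -> measurable A ->
  (c%:E * leb ((fun t => c * t + a)%R @^-1` A) = leb A)%E.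
Proof.
move=> c0 mA; have c0' := ltW c0.
pose phi := fun t : measurableTypeR R => c * t + a : measurableTypeR R.
have mphi : measurable_fun setT phi := measurable_affine c a.
pose nu := measure_function_pushforward__canonical__measure_function_Measure leb mphi.
apply/esym; apply: (@lebesgue_measure_unique _ (mscale (NngNum c0') nu)) => //= _ [[x y] _ <-] /=.
rewrite /mscale/= /pushforward.
have -> : phi @^-1` `]x, y]%classic = `](x - a) / c, (y - a) / c]%classic.
  apply/seteqP; split=> t; rewrite /phi /= !in_itv /= => /andP[h1 h2].
    by rewrite ltr_pdivrMr// ler_pdivlMr// ltrBlDr lerBrDr mulrC h1 h2.
  move: h1 h2; rewrite ltr_pdivrMr// ler_pdivlMr// ltrBlDr lerBrDr mulrC.
  by move=> -> ->.
rewrite !lebesgue_measure_itv /= !lte_fin ltr_pM2r ?invr_gt0// ltrBlDr subrK.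
case: ifPn => _; last by rewrite mule0.
by rewrite -!EFinD -EFinM; congr EFin; field; rewrite gt_eqF.
Qed.

Lemma integral_affine (c a : R) (f : measurableTypeR R -> \bar R) : 0 < c ->
  measurable_fun setT f -> (forall x, 0 <= f x)%E ->
  (\int[leb]_t f (c * t + a)%R = (c^-1)%:E * \int[leb]_t f t)%E.
Proof.
move=> c0 mf f0; have c0' := ltW c0.
pose phi := fun t : measurableTypeR R => c * t + a : measurableTypeR R.
have mphi : measurable_fun setT phi := measurable_affine c a.
pose nu := measure_function_pushforward__canonical__measure_function_Measure leb mphi.
have -> : (\int[leb]_t f t = \int[mscale (NngNum c0') nu]_t f t)%E.
  apply: eq_measure_integral => //= A mA _.
  by rewrite -(lebesgue_measure_affine a c0 mA).
rewrite ge0_integral_mscale//= muleA -EFinM mulVf ?gt_eqF// mul1e.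
by rewrite (integral_pushforwardT _ mphi).
Qed.

End lebesgue_affine.

Section lebesgue_rv_theory.
Variable R : realType.
Local Notation leb := (@lebesgue_measure R).

Lemma rv_cons0 m (t : R) (y : 'rV[R]_m) : rv_cons (t, y) 0 ord0 = t.
Proof. by have := congr1 fst (rv_consK (t, y)). Qed.

Lemma rv_consS m (t : R) (y : 'rV[R]_m) j : rv_cons (t, y) 0 (lift ord0 j) = y 0 j.
Proof. by have := congr1 snd (rv_consK (t, y)) => /rowP /(_ j); rewrite /= mxE. Qed.

Lemma integral_rv0 (f : 'rV[R]_0 -> \bar R) : measurable_fun setT f ->
  (\int[lebesgue_rv R 0]_x f x = f 0%R)%E.
Proof. by move=> mf; rewrite integral_dirac// diracE in_setT mul1e. Qed.

Lemma integral_rvS m (f : 'rV[R]_m.+1 -> \bar R) : measurable_fun setT f ->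
  (\int[lebesgue_rv R m.+1]_x f x =
   \int[leb \x lebesgue_rv R m]_p f (rv_cons p))%E.
Proof. by move=> mf; exact: (integral_pushforwardT _ (@measurable_rv_cons R m)). Qed.

Lemma measurable_rvZ m (c : R) : measurable_fun setT (fun x : 'rV[R]_m => c *: x).
Proof.
apply: measurable_fun_rv => j.
rewrite (_ : _ \o _ = fun x => c * rv_coord j x).
  by apply: measurable_funM => //; exact: measurable_rv_coord.
by apply/funext => x; rewrite /rv_coord /= mxE.
Qed.

Lemma measurable_rvD m d (T : measurableType d) (f g : T -> 'rV[R]_m) :
  measurable_fun setT f -> measurable_fun setT g ->
  measurable_fun setT (fun x => f x + g x).
Proof.
move=> mf mg; apply: measurable_fun_rv => j.
rewrite (_ : _ \o _ = fun x => rv_coord j (f x) + rv_coord j (g x)).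
  by apply: measurable_funD; exact: (measurableT_comp (measurable_rv_coord j)).
by apply/funext => x; rewrite /rv_coord /= mxE.
Qed.

(** Induction on [m]: Tonelli splits off the first coordinate, and each coordinate contributes one
    factor [c^-1]. *)
Lemma integral_rv_affine m (c : R) (a : 'rV[R]_m) (f : 'rV[R]_m -> \bar R) :
  0 < c -> measurable_fun setT f -> (forall x, 0 <= f x)%E ->
  (\int[lebesgue_rv R m]_x f (c *: x + a)%R =
   (c^-1 ^+ m)%:E * \int[lebesgue_rv R m]_x f x)%E.
Proof.
move=> c0; have maff k (b : 'rV[R]_k) : measurable_fun setT (fun x : 'rV[R]_k => c *: x + b).
  by apply: measurable_rvD; [exact: measurable_rvZ|exact: measurable_cst].
elim: m a f => [|m IH] a f mf f0.
  rewrite !integral_rv0 ?mul1e//; last exact: measurableT_comp mf (maff _ _).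
  by congr f; apply/rowP; case.
have mcons := @measurable_rv_cons R m.
have mfc : measurable_fun setT (fun p => f (rv_cons p)).
  exact: measurableT_comp mf mcons.
rewrite !integral_rvS//; last exact: measurableT_comp mf (maff _ _).
have step (p : measurableTypeR R * 'rV[R]_m) : c *: rv_cons p + a =
    rv_cons (c * p.1 + a 0 ord0, c *: p.2 + \row_j a 0 (lift ord0 j)).
  case: p => t y; apply/rowP => i; case: (unliftP ord0 i) => [j ->|->] /=.
    rewrite [LHS]mxE [X in X + _]mxE !rv_consS [RHS]mxE.
    by rewrite [X in _ = X + _]mxE [X in _ = _ + X]mxE.
  by rewrite [LHS]mxE [X in X + _]mxE !rv_cons0.
under eq_integral => p _ do rewrite step.
pose b := \row_j a 0 (lift ord0 j).
have mF : measurable_fun setT (fun p : measurableTypeR R * 'rV[R]_m =>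
    f (rv_cons (c * p.1 + a 0 ord0, c *: p.2 + b))).
  apply: (measurableT_comp mfc); apply: measurable_fun_pair => /=.
  - exact: (measurableT_comp (measurable_affine c _) measurable_fst).
  - exact: (measurableT_comp (maff _ _) measurable_snd).
rewrite (fubini_tonelli1 _ mF)// (fubini_tonelli1 _ mfc)// /fubini_F /=.
under eq_integral => t _.
  rewrite (IH b (fun y => f (rv_cons (c * t + a 0 ord0, y))%R))//; last first.
    exact: measurableT_comp mfc (measurable_pair1 _).
  over.
have mI : measurable_fun setT
    (fun t : measurableTypeR R => \int[lebesgue_rv R m]_y f (rv_cons (t, y)))%E.
  exact: (measurable_fun_fubini_tonelli_F _ mfc).
have cm0 : (0 <= (c^-1 ^+ m)%:E)%E by rewrite lee_fin exprn_ge0// invr_ge0 ltW.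
rewrite (ge0_integralZl _ measurableT (measurableT_comp mI (measurable_affine c _)) _ cm0);
  last by move=> t _; apply: integral_ge0.
rewrite (integral_affine (a 0 ord0) c0 mI); last by move=> t; apply: integral_ge0.
by rewrite muleA -EFinM exprSr.
Qed.

Lemma integral_rvD m (a : 'rV[R]_m) (f : 'rV[R]_m -> \bar R) :
  measurable_fun setT f -> (forall x, 0 <= f x)%E ->
  (\int[lebesgue_rv R m]_x f (x + a)%R = \int[lebesgue_rv R m]_x f x)%E.
Proof.
move=> mf f0; have := integral_rv_affine a (@ltr01 R) mf f0; rewrite invr1 expr1n mul1e => <-.
by apply: eq_integral => x _; rewrite scale1r.
Qed.

Lemma Rintegral_rv_affine m (c : R) (a : 'rV[R]_m) (f : 'rV[R]_m -> R) :
  0 < c -> measurable_fun setT f ->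
  \int[lebesgue_rv R m]_x f (c *: x + a) =
  c^-1 ^+ m * \int[lebesgue_rv R m]_x f x.
Proof.
move=> c0 mf; rewrite /Rintegral integralE [in RHS]integralE.
have mf' : measurable_fun setT (fun x => (f x)%:E) by exact/measurable_EFinP.
have hp := integral_rv_affine a c0 (measurable_funepos mf') (fun x => funepos_ge0 _ x).
have hn := integral_rv_affine a c0 (measurable_funeneg mf') (fun x => funeneg_ge0 _ x).
transitivity (fine (
  \int[lebesgue_rv R m]_x (fun x : 'rV[R]_m => (f x)%:E)^\+ (c *: x + a)%R -
  \int[lebesgue_rv R m]_x (fun x : 'rV[R]_m => (f x)%:E)^\- (c *: x + a)%R)%E).
  by congr (fine (_ - _)%E); apply: eq_integral => x _; rewrite ?funeposE ?funenegE.
have cm : 0 < c^-1 ^+ m by rewrite exprn_gt0// invr_gt0.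
rewrite hp hn; move: (c^-1 ^+ m) cm => k k0.
(* Either part may be infinite. The positive factor [k] keeps infinities, so [fine] is then 0 on
   both sides. *)
case: (\int[_]_x _)%E => [u| |]; case: (\int[_]_x _)%E => [v| |];
  rewrite /= ?gt0_muley ?gt0_muleNy ?lte_fin//= ?mulr0//.
by rewrite mulrBr.
Qed.

Lemma cintegral_rv_affine m (c : R) (a : 'rV[R]_m) (f : 'rV[R]_m -> R[i]) :
  0 < c -> cmeas f ->
  cintegral (lebesgue_rv R m) (fun x => f (c *: x + a)) =
  (c^-1 ^+ m)%:C * cintegral (lebesgue_rv R m) f.
Proof.
move=> c0 [rf mf]; apply: complex_eq; rewrite !ReImE /cintegral /= mul0r.
- by rewrite subr0 (Rintegral_rv_affine a c0 rf).
- by rewrite addr0 (Rintegral_rv_affine a c0 mf).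
Qed.

End lebesgue_rv_theory.

(** * Integrals of products of one-variable functions *)

Section tensor_products.
Variable R : realType.
Local Notation C := R[i].
Local Notation leb := (@lebesgue_measure R).

Lemma cmeas_rv_coord m (phi : measurableTypeR R -> C) (j : 'I_m) :
  cmeas phi -> cmeas (fun x : 'rV[R]_m => phi (x 0 j)).
Proof. by move=> mphi; exact: cmeas_comp (measurable_rv_coord j) mphi. Qed.

Lemma cmeas_rv_prod m (phi : 'I_m -> measurableTypeR R -> C) :
  (forall j, cmeas (phi j)) ->
  cmeas (fun x : 'rV[R]_m => \prod_j phi j (x 0 j)).
Proof.
by move=> mphi; apply: cmeas_prod => j; exact: cmeas_rv_coord.
Qed.

Lemma cintegrable_rvS m (F : 'rV[R]_m.+1 -> C) : cmeas F ->
  cintegrable (leb \x lebesgue_rv R m)%E (F \o @rv_cons R m) ->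
  cintegrable (lebesgue_rv R m.+1) F.
Proof.
move=> mF iF; apply: cintegrable_normcP => //.
rewrite integral_rvS; last exact/measurable_EFinP/measurable_normc.
have /integrableP[_] := integrable_normc iF.
apply: le_lt_trans; rewrite le_eqVlt; apply/orP; left; apply/eqP.
by apply: eq_integral => p _; rewrite /= ger0_norm ?normc_ge0.
Qed.

Lemma cintegral_rvS m (F : 'rV[R]_m.+1 -> C) : cmeas F ->
  cintegral (lebesgue_rv R m.+1) F =
  cintegral (leb \x lebesgue_rv R m)%E (F \o @rv_cons R m).
Proof. by move=> mF; exact: (cintegral_pushforward (@measurable_rv_cons R m)). Qed.

Lemma rv_cons_prod m (phi : 'I_m.+1 -> measurableTypeR R -> C)
    (p : measurableTypeR R * 'rV[R]_m) :
  \prod_j phi j (rv_cons p 0 j) =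
  phi ord0 p.1 * \prod_j phi (lift ord0 j) (p.2 0 j).
Proof.
case: p => t y; rewrite big_ord_recl rv_cons0; congr (_ * _).
by apply: eq_bigr => j _; rewrite rv_consS.
Qed.

Lemma cintegrable_rv_prod m (phi : 'I_m -> measurableTypeR R -> C) :
  (forall j, cintegrable leb (phi j)) ->
  cintegrable (lebesgue_rv R m) (fun x => \prod_j phi j (x 0 j)).
Proof.
elim: m phi => [|m IH] phi iphi.
  apply: (cintegrable_le (g := fun=> 1)).
  - by apply: cmeas_rv_prod => -[].
  - apply/integrableP; split; first exact/measurable_EFinP.
    rewrite integral_rv0 ?normr1 ?ltry//.
  - by move=> x; rewrite big_ord0 normc1.
apply: cintegrable_rvS.
  by apply: cmeas_rv_prod => j; exact: cintegrable_cmeas (iphi j).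
have -> : (fun x : 'rV[R]_m.+1 => \prod_j phi j (x 0 j)) \o @rv_cons R m =
    fun p => phi ord0 p.1 * \prod_j phi (lift ord0 j) (p.2 0 j).
  by apply/funext => p /=; exact: rv_cons_prod.
by apply: (cintegrable_tensor (v := fun y : 'rV[R]_m => \prod_j phi (lift ord0 j) (y 0 j))
  (iphi ord0)); exact: (IH (fun j => phi (lift ord0 j)) (fun j => iphi _)).
Qed.

Lemma cintegral_rv_prod m (phi : 'I_m -> measurableTypeR R -> C) :
  (forall j, cintegrable leb (phi j)) ->
  cintegral (lebesgue_rv R m) (fun x => \prod_j phi j (x 0 j)) =
  \prod_j cintegral leb (phi j).
Proof.
elim: m phi => [|m IH] phi iphi.
  rewrite big_ord0 (eq_cintegral _ (fun x => big_ord0 _ _ _ _)).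
  rewrite (cintegral_real _ (fun=> 1)) /Rintegral.
  by rewrite integral_rv0//; exact/measurable_EFinP.
rewrite cintegral_rvS; last first.
  by apply: cmeas_rv_prod => j; exact: cintegrable_cmeas (iphi j).
rewrite big_ord_recl -(IH (fun j => phi (lift ord0 j)) (fun j => iphi _)).
rewrite -(cintegral_tensor (v := fun y : 'rV[R]_m => \prod_j phi (lift ord0 j) (y 0 j)))//.
  by apply: eq_cintegral => p /=; exact: rv_cons_prod.
exact: (cintegrable_rv_prod (fun j => iphi (lift ord0 j))).
Qed.

End tensor_products.

(** * Gaussian integrals *)

Section curve_derivative.
Variable R : realType.
Local Notation C := R[i].
Implicit Types (f g : R -> C) (t : R) (v w : C).

Definition cder f t v :=
  is_derive t (1 : R) (fun s => Re (f s)) (Re v) /\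
  is_derive t (1 : R) (fun s => Im (f s)) (Im v).

Lemma cder_eq f t v w : cder f t v -> v = w -> cder f t w.
Proof. by move=> ? <-. Qed.

Lemma cder_cst v t : cder (fun=> v) t 0.
Proof. by split => /=; exact: is_derive_cst. Qed.

Lemma cder_real (f : R -> R) t (v : R) :
  is_derive t (1 : R) f v -> cder (fun s => (f s)%:C) t v%:C.
Proof. by move=> h; split => //=; exact: is_derive_cst. Qed.

Lemma cderD f g t v w : cder f t v -> cder g t w -> cder (fun s => f s + g s) t (v + w).
Proof.
move=> [f1 f2] [g1 g2]; split; rewrite ReImE.
- by under eq_fun do rewrite ReD; exact: is_deriveD.
- by under eq_fun do rewrite ImD; exact: is_deriveD.
Qed.

Lemma cderM f g t v w : cder f t v -> cder g t w ->
  cder (fun s => f s * g s) t (v * g t + f t * w).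
Proof.
move=> [f1 f2] [g1 g2]; split.
- under eq_fun do rewrite ReM.
  apply: is_derive_eq.
  by rewrite !ReImE /GRing.scale /=; ring.
- under eq_fun do rewrite ImM.
  apply: is_derive_eq.
  by rewrite !ReImE /GRing.scale /=; ring.
Qed.

Lemma cder_cexp f t v : cder f t v -> cder (fun s => cexp (f s)) t (v * cexp (f t)).
Proof.
move=> [f1 f2].
have e1 : is_derive t (1 : R) (fun s => expR (Re (f s))) (Re v * expR (Re (f t))).
  by apply: is_derive_eq; ring.
have e2 : is_derive t (1 : R) (fun s => cos (Im (f s))) (- (Im v * sin (Im (f t)))).
  by apply: is_derive_eq; ring.
have e3 : is_derive t (1 : R) (fun s => sin (Im (f s))) (Im v * cos (Im (f t))).
  by apply: is_derive_eq; ring.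
have e4 : cder (fun s => cos (Im (f s)) +i* sin (Im (f s)))%C t
  (- (Im v * sin (Im (f t))) +i* (Im v * cos (Im (f t))))%C by split.
apply: (cder_eq (cderM (cder_real e1) e4)).
by apply: complex_eq; rewrite /cexp !ReImE /=; ring.
Qed.

Lemma cder0_cst f a b : (forall t, cder f t 0) -> f a = f b.
Proof.
move=> h; apply: complex_eq.
- by apply: (@is_derive_0_is_cst _ (fun s => Re (f s))) => t; case: (h t).
- by apply: (@is_derive_0_is_cst _ (fun s => Im (f s))) => t; case: (h t).
Qed.

Lemma cder_continuous f (df : R -> C) : (forall t, cder f t (df t)) ->
  continuous (fun s => Re (f s)) /\ continuous (fun s => Im (f s)).
Proof.
move=> h; split=> t; apply/differentiable_continuous/derivable1_diffP.
- by case: (h t) => -[].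
- by case: (h t) => _ -[].
Qed.

End curve_derivative.

Section gaussian_domination.
Variable R : realType.
Local Notation C := R[i].
Local Notation leb := (@lebesgue_measure R).
Implicit Types (c a r K : R).

Lemma integral_gauss c a : 0 < c ->
  (\int[leb]_t (expR (- (c * t ^+ 2) + a * t))%:E =
   (Num.sqrt (pi / c) * expR (a ^+ 2 / (4 * c)))%:E)%E.
Proof.
move=> c0; have sc : 0 < Num.sqrt c by rewrite sqrtr_gt0.
have sc2 : Num.sqrt c ^+ 2 = c by rewrite sqr_sqrtr// ltW.
have c_neq0 : c != 0 by rewrite gt_eqF.
have sc_neq0 : Num.sqrt c != 0 by rewrite gt_eqF.
pose b := - (a / (2 * Num.sqrt c)).
have key t : - (c * t ^+ 2) + a * t =
    - (Num.sqrt c * t + b) ^+ 2 + a ^+ 2 / (4 * c).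
  rewrite /b; move: (Num.sqrt c) sc_neq0 sc2 => s s0 <-.
  by field.
under eq_integral => t _.
  rewrite key expRD EFinM -/(gauss_fun (Num.sqrt c * t + b)); over.
have mg : measurable_fun setT
    (fun t : measurableTypeR R => (gauss_fun (Num.sqrt c * t + b))%:E).
  apply/measurable_EFinP.
  exact: (measurableT_comp (@measurable_gauss_fun R) (measurable_affine _ _)).
rewrite ge0_integralZr//; last by move=> t _; rewrite lee_fin gauss_fun_ge0.
rewrite (integral_affine b sc (f := fun t => (gauss_fun t)%:E)); last 2 first.
- by apply/measurable_EFinP; exact: measurable_gauss_fun.
- by move=> t; exact: gauss_fun_ge0.
rewrite integralT_gauss -!EFinM; congr EFin; congr (_ * _).
by rewrite mulrC sqrtrM ?pi_ge0// sqrtrV // ltW.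
Qed.

Lemma measurable_quad c r : measurable_fun setT
  (fun t : measurableTypeR R => expR (- (c * t ^+ 2) + r * `|t|)).
Proof.
apply: (measurableT_comp (@measurable_expR R)); apply: measurable_funD.
- apply: measurableT_comp => //; exact: measurable_funM.
- by apply: measurable_funM => //; exact: measurableT_comp.
Qed.

(** [exp(r |t|)] is at most [exp(r t) + exp(-r t)], which leaves two Gaussians with a linear
    term. *)
Lemma integrable_gauss c r : 0 < c ->
  leb.-integrable setT (fun t => (expR (- (c * t ^+ 2) + r * `|t|))%:E).
Proof.
move=> c0.
have h a : leb.-integrable setT (fun t => (expR (- (c * t ^+ 2) + a * t))%:E).
  apply/integrableP; split.
    apply/measurable_EFinP; apply: (measurableT_comp (@measurable_expR R)).
    apply: measurable_funD; last by apply: measurable_funM => //; exact: measurable_id.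
    apply: measurableT_comp => //; exact: measurable_funM.
  under eq_integral do rewrite /= ger0_norm ?expR_ge0//.
  by rewrite integral_gauss// ltry.
apply: (le_integrable _ _ _ (integrableD measurableT (h r) (h (- r)))) => //.
  by apply/measurable_EFinP; exact: measurable_quad.
move=> t _ /=; rewrite lee_fin [leLHS]ger0_norm ?expR_ge0// [leRHS]ger0_norm ?addr_ge0 ?expR_ge0//.
have [t0|t0] := ger0P t; first by rewrite lerDl expR_ge0.
by rewrite mulrN mulNr lerDr expR_ge0.
Qed.

(** The factor [exp(r |t|)] makes the class stable under multiplication by polynomials at an
    unchanged rate [c]: one more power of [t] only raises [r] by 1. *)
Definition gdom c (f : R -> C) := exists K r, [/\ 0 <= K, 0 <= r &
  forall t, normc (f t) <= K * expR (- (c * t ^+ 2) + r * `|t|)].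

Lemma gdomD c f g : gdom c f -> gdom c g -> gdom c (fun t => f t + g t).
Proof.
move=> [K [r [K0 r0 hf]]] [L [s [L0 s0 hg]]]; exists (K + L), (r + s); split.
- exact: addr_ge0.
- exact: addr_ge0.
move=> t; apply: (le_trans (le_normcD _ _)); rewrite mulrDl; apply: lerD.
- apply: (le_trans (hf t)); rewrite ler_wpM2l// ler_expR lerD2l.
  by rewrite ler_wpM2r// lerDl.
- apply: (le_trans (hg t)); rewrite ler_wpM2l// ler_expR lerD2l.
  by rewrite ler_wpM2r// lerDr.
Qed.

Lemma le_normr_expR (t : R) : `|t| <= expR `|t|.
Proof. by apply: le_trans (expR_ge1Dx _); rewrite lerDr. Qed.

Lemma gdomX c f : gdom c f -> gdom c (fun t => t%:C * f t).
Proof.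
move=> [K [r [K0 r0 hf]]]; exists K, (1 + r); split=> //; first exact: addr_ge0.
move=> t; rewrite normcM normc_realc mulrDl mul1r addrCA expRD mulrCA.
by apply: ler_pM => //; [exact: normc_ge0|exact: le_normr_expR].
Qed.

Lemma gdomZ c (k : C) f : gdom c f -> gdom c (fun t => k * f t).
Proof.
move=> [K [r [K0 r0 hf]]]; exists (normc k * K), r; split=> //.
  by rewrite mulr_ge0// normc_ge0.
by move=> t; rewrite normcM -mulrA ler_wpM2l// normc_ge0.
Qed.

Lemma gdom_poly c (q : {poly R}) f : gdom c f -> gdom c (fun t => (q.[t])%:C * f t).
Proof.
move=> gf; elim/poly_ind: q => [|q a IH].
  exists 0, 0; split=> // t.
  by rewrite horner0 normcM normc0 !mul0r.
have -> : (fun t => ((q * 'X + a%:P).[t])%:C * f t) =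
    (fun t => t%:C * ((q.[t])%:C * f t) + a%:C * f t).
  by apply/funext => t; rewrite hornerD hornerM hornerX hornerC realcD realcM; ring.
by apply: gdomD; [exact: gdomX|exact: gdomZ].
Qed.

Lemma gdom_cintegrable c f : 0 < c -> cmeas (f : measurableTypeR R -> C) ->
  gdom c f -> cintegrable leb f.
Proof.
move=> c0 mf [K [r [K0 r0 hf]]].
apply: (cintegrable_le mf _ hf).
exact: (integrableZl measurableT K (integrable_gauss r c0)).
Qed.

(** The sign [(-1) ^+ s] treats both ends of the line at once. *)
Lemma gdom_cvg c (f : R -> R) (s : bool) : 0 < c -> gdom c (fun t => (f t)%:C) ->
  f ((-1) ^+ s * n%:R) @[n --> \oo] --> (0 : R).
Proof.
move=> c0 [K [r [K0 r0 hf]]].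
(* The maximum of [- c t^2 + (r + 1) t]; one unit of the linear term is kept aside to produce the
   factor [exp(-n)]. *)
pose M := (r + 1) ^+ 2 / (4 * c).
apply: norm_cvg0.
apply: (@squeeze_cvgr _ _ _ _ (fun=> 0) (fun n => K * expR M * expR (- n%:R))).
- apply: nearW => n; rewrite normr_ge0 /=.
  have := hf ((-1) ^+ s * n%:R); rewrite normc_realc => /le_trans; apply.
  rewrite -mulrA ler_wpM2l// -expRD ler_expR exprMn sqrr_sign mul1r.
  rewrite normrM normr_sign mul1r ger0_norm// -subr_ge0 /M.
  have -> : (r + 1) ^+ 2 / (4 * c) + - n%:R - (- (c * n%:R ^+ 2) + r * n%:R) =
    c * (n%:R - (r + 1) / (2 * c)) ^+ 2 by field; rewrite gt_eqF.
  by rewrite mulr_ge0 ?sqr_ge0// ltW.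
- exact: cvg_cst.
- rewrite -[X in _ --> X](mulr0 (K * expR M)); apply: cvgMr.
  exact: cvgn_expR.
Qed.

(** The fundamental theorem applies on [[-n, n]]; the boundary terms tend to 0 by Gaussian
    domination, and dominated convergence with majorant [|g|] reaches the whole line. *)
Lemma integral_derive0 c (f g : R -> R) : 0 < c ->
  (forall t : R, is_derive t (1 : R) f (g t)) -> continuous g ->
  gdom c (fun t => (f t)%:C) -> gdom c (fun t => (g t)%:C) ->
  \int[leb]_t g t = 0.
Proof.
move=> c0 fg cg gf gg.
have ig : leb.-integrable setT (fun t => (g t)%:E).
  have [] // := gdom_cintegrable c0 _ gg.
  by apply: cmeas_real; exact: continuous_measurable_fun.
pose I n := `[- (n%:R : R), n%:R]%classic.
have mI n : measurable (I n : set (measurableTypeR R)) by exact: measurable_itv.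
pose h n t := ((g \_ (I n)) t)%:E.
have mg : measurable_fun setT (fun t : measurableTypeR R => (g t)%:E).
  exact: measurable_int ig.
have [||||_ _ hcvg] := @dominated_convergence _ _ _ leb setT measurableT h
  (fun t => (g t)%:E) (fun t => (`|g t|)%:E) _ mg.
- move=> n; rewrite /h; apply/measurable_EFinP.
  apply/(measurable_restrictT _ (mI n)).
  by apply: measurable_funTS; exact/measurable_EFinP.
- apply: aeW => t _; apply: cvg_near_cst.
  exists (Num.truncn `|t|).+1 => // n /= tn; rewrite /h patchE mem_set//.
  rewrite /I /= in_itv /= -ler_norml ltW// (lt_le_trans (truncnS_gt _))//.
  by rewrite ler_nat.
- exact: integrable_norm ig.
- apply: aeW => t n _; rewrite /h patchE lee_fin.
  by case: ifPn => // _; rewrite normr0.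
(* The interval has to be nondegenerate; the index 0 does not affect the limit. *)
have E n : (0 < n)%N -> (\int[leb]_t h n t = (f n%:R - f (- n%:R))%:E)%E.
  move=> n0; transitivity (\int[leb]_(t in I n) (g t)%:E)%E.
    by rewrite [RHS]integral_mkcond; apply: eq_integral => t _; rewrite /h !patchE; case: ifP.
  rewrite EFinB; apply: continuous_FTC2.
  - by rewrite gtrN// ltr0n.
  - exact: continuous_subspaceT.
  - have cf : continuous f.
      move=> t; apply/differentiable_continuous/derivable1_diffP.
      by case: (fg t).
    split; [by move=> t _; case: (fg t)|exact/cvg_at_right_filter/cf|].
    exact/cvg_at_left_filter/cf.
  - by move=> t _; rewrite derive1E; case: (fg t).
have lim0 : (\int[leb]_t h n t)%E @[n --> \oo] --> 0%E.
  have : (f n%:R - f (- n%:R))%:E @[n --> \oo] --> 0%:E.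
    apply: cvg_EFin; first exact: nearW.
    rewrite /comp /= -[X in _ --> X](subrr 0); apply: cvgB.
      by have := gdom_cvg false c0 gf; under eq_fun do rewrite mul1r.
    by have := gdom_cvg true c0 gf; under eq_fun do rewrite mulN1r.
  apply: cvg_trans; apply: near_eq_cvg.
  by exists 1%N => // n /= n0; rewrite E.
by rewrite /Rintegral (cvg_unique _ hcvg lim0).
Qed.

End gaussian_domination.

Section complex_gaussian.
Variable R : realType.
Local Notation C := R[i].
Local Notation leb := (@lebesgue_measure R).
Implicit Types (c a b t : R) (z : C) (q : {poly R}).

Definition cgauss c z t : C := cexp (- (c * t ^+ 2)%:C + z * t%:C).

Lemma cgauss_arg_cder c z t :
  cder (fun s => - (c * s ^+ 2)%:C + z * s%:C) t (- (2 * c * t)%:C + z).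
Proof.
have h : is_derive t (1 : R) (fun s => - (c * s ^+ 2)) (- (2 * c * t)).
  by apply: is_derive_eq; rewrite /GRing.scale /=; ring.
have h1 : cder (fun s => - (c * s ^+ 2)%:C) t (- (2 * c * t)%:C).
  by rewrite -realcN; under eq_fun do rewrite -realcN; exact: cder_real.
have h2 := cderM (cder_cst z t) (cder_real (is_derive_id t (1 : R))).
by apply: (cder_eq (cderD h1 h2)); congr (_ + _); rewrite mul0r add0r mulr1.
Qed.

Lemma cder_cgauss c z t :
  cder (cgauss c z) t ((- (2 * c * t)%:C + z) * cgauss c z t).
Proof. exact: cder_cexp (cgauss_arg_cder c z t). Qed.

Lemma normc_cgauss c z t : normc (cgauss c z t) = expR (- (c * t ^+ 2) + Re z * t).
Proof. by rewrite normc_cexp !ReImE /= mulr0 subr0. Qed.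

Lemma gdom_cgauss c z : gdom c (cgauss c z).
Proof.
exists 1, `|Re z|; split=> // t; rewrite normc_cgauss mul1r ler_expR lerD2l.
by rewrite (le_trans (ler_norm _))// normrM.
Qed.

Definition pgauss q c z t : C := (q.[t])%:C * cgauss c z t.

Lemma gdom_pgauss q c z : gdom c (pgauss q c z).
Proof. exact: gdom_poly (gdom_cgauss c z). Qed.

Lemma cder_poly q t : cder (fun s => (q.[s])%:C) t (q^`().[t])%:C.
Proof.
exact: cder_real.
Qed.

Lemma cder_pgauss q c z t :
  cder (pgauss q c z) t
    (pgauss (q^`() - (2 * c)%:P * 'X * q) c z t + z * pgauss q c z t).
Proof.
apply: (cder_eq (cderM (cder_poly q t) (cder_cgauss c z t))).
rewrite /pgauss !hornerE /= !realcD !realcN !realcM.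
by ring.
Qed.

Lemma continuous_cmeas (f : R -> C) :
  continuous (fun s => Re (f s)) -> continuous (fun s => Im (f s)) ->
  cmeas (f : measurableTypeR R -> C).
Proof. by move=> cr ci; split; exact: continuous_measurable_fun. Qed.

Lemma cmeas_pgauss q c z : cmeas (pgauss q c z : measurableTypeR R -> C).
Proof.
have [cr ci] := cder_continuous (cder_pgauss q c z).
exact: continuous_cmeas.
Qed.

Lemma cintegrable_pgauss q c z : 0 < c -> cintegrable leb (pgauss q c z).
Proof.
by move=> c0; exact: (gdom_cintegrable c0 (cmeas_pgauss q c z) (gdom_pgauss q c z)).
Qed.

Lemma cgauss_pgauss c z : cgauss c z = pgauss 1 c z.
Proof. by apply/funext => t; rewrite /pgauss hornerC mul1r. Qed.

Lemma cintegrable_cgauss c z : 0 < c -> cintegrable leb (cgauss c z).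
Proof. by move=> c0; rewrite cgauss_pgauss; exact: cintegrable_pgauss. Qed.

Lemma gdom_Re c (f : R -> C) : gdom c f -> gdom c (fun t => (Re (f t))%:C).
Proof.
move=> [K [r [K0 r0 hf]]]; exists K, r; split=> // t.
by rewrite normc_realc (le_trans (le_Re_normc _)).
Qed.

Lemma gdom_Im c (f : R -> C) : gdom c f -> gdom c (fun t => (Im (f t))%:C).
Proof.
move=> [K [r [K0 r0 hf]]]; exists K, r; split=> // t.
by rewrite normc_realc (le_trans (le_Im_normc _)).
Qed.

(** The derivative of [pgauss q c z] has integral 0. This identity yields both the differential
    equation in [cgauss_integral] and the Gaussian transform of Hermite functions. *)
Lemma pgauss_parts q c z : 0 < c ->
  cintegral leb (pgauss (q^`() - (2 * c)%:P * 'X * q) c z) =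
  - z * cintegral leb (pgauss q c z).
Proof.
move=> c0; pose q' := q^`() - (2 * c)%:P * 'X * q.
pose g t := pgauss q' c z t + z * pgauss q c z t.
have gg : gdom c g by apply: gdomD; [|apply: gdomZ]; exact: gdom_pgauss.
have [cr ci] : continuous (fun s => Re (g s)) /\ continuous (fun s => Im (g s)).
  apply: (@cder_continuous _ _ (fun t => _)) => t.
  apply: cderD; first exact: cder_pgauss.
  exact: (cderM (cder_cst z t) (cder_pgauss q c z t)).
have : cintegral leb g = 0.
  apply: complex_eq; rewrite /cintegral /=.
  - apply: (@integral_derive0 _ c (fun t => Re (pgauss q c z t))) => //.
    + by move=> t; have [] := cder_pgauss q c z t.
    + exact: gdom_Re (gdom_pgauss q c z).
    + exact: gdom_Re gg.
  - apply: (@integral_derive0 _ c (fun t => Im (pgauss q c z t))) => //.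
    + by move=> t; have [] := cder_pgauss q c z t.
    + exact: gdom_Im (gdom_pgauss q c z).
    + exact: gdom_Im gg.
rewrite /g cintegralD; last 2 first.
- exact: cintegrable_pgauss.
- exact/cintegrableZl/cintegrable_pgauss.
rewrite cintegralZl; last exact: cintegrable_pgauss.
by move/eqP; rewrite addr_eq0 mulNr => /eqP.
Qed.

Lemma cder_cgauss_param c a t b :
  cder (fun b => cgauss c (a +i* b)%C t) b ('i%C * t%:C * cgauss c (a +i* b)%C t).
Proof.
apply: cder_cexp; apply: (@cder_eq _ _ _ (0 + ('i%C * t%:C + (a +i* b)%C * 0))).
  apply: cderD; first exact: cder_cst.
  apply: (@cderM _ (fun b => a +i* b)%C); last exact: cder_cst.
  by split => /=; [exact: is_derive_cst|exact: is_derive_id].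
by rewrite mulr0 addr0 add0r.
Qed.

Lemma cder_cgauss_integral c a b : 0 < c ->
  cder (fun b => cintegral leb (cgauss c (a +i* b)%C)) b
    (cintegral leb (fun t => 'i%C * t%:C * cgauss c (a +i* b)%C t)).
Proof.
(* Differentiation brings down [i t], and [|t| <= exp |t|] costs the summand 1. The modulus of
   [cgauss] ignores the imaginary part of the parameter, so [G] is a uniform majorant. *)
move=> c0; pose G t := expR (- (c * t ^+ 2) + (1 + `|a|) * `|t|).
have iG : leb.-integrable setT (EFin \o G) := integrable_gauss _ c0.
have bI : `]b - 1, b + 1[%classic b.
  by rewrite /= in_itv /= ltrBlDr !ltrDl ltr01.
have dom x t : normc ('i%C * t%:C * cgauss c (a +i* x)%C t) <= G t.
  rewrite normcM (normcM 'i%C) normc_realc normc_cgauss /= expr0n/= add0r expr1n sqrtr1 mul1r.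
  rewrite /G mulrDl mul1r addrCA [leRHS]expRD; apply: ler_pM => //.
  - exact: le_normr_expR.
  - by rewrite ler_expR lerD2l (le_trans (ler_norm _))// normrM.
have G0 t : 0 <= G t by exact: expR_ge0.
split; rewrite /cintegral /=.
- have dR x t : is_derive x (1 : R) (fun x => Re (cgauss c (a +i* x)%C t))
      (Re ('i%C * t%:C * cgauss c (a +i* x)%C t)).
    by have [] := cder_cgauss_param c a t x.
  have h1 x : `]b - 1, b + 1[%classic x ->
      leb.-integrable setT (EFin \o (fun t => Re (cgauss c (a +i* x)%C t))).
    by move=> _; have [] := cintegrable_cgauss (a +i* x)%C c0.
  have h2 x t : `]b - 1, b + 1[%classic x -> setT t ->
      derivable (fun x => Re (cgauss c (a +i* x)%C t)) x 1.
    by move=> _ _; case: (dR x t).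
  have h3 x t : `]b - 1, b + 1[%classic x -> setT t ->
      `|partial1of2 (fun x t => Re (cgauss c (a +i* x)%C t)) x t| <= G t.
    move=> _ _; rewrite partial1of2E.
    have [_ ->] := dR x t.
    by rewrite (le_trans (le_Re_normc _)).
  apply: DeriveDef; first exact: (derivable_under_integral measurableT bI h1 h2 G0 iG h3).
  rewrite -derive1E (differentiation_under_integral measurableT bI h1 h2 G0 iG h3).
  apply: eq_Rintegral => t _; rewrite partial1of2E.
  by have [_ ->] := dR b t.
- have dI x t : is_derive x (1 : R) (fun x => Im (cgauss c (a +i* x)%C t))
      (Im ('i%C * t%:C * cgauss c (a +i* x)%C t)).
    by have [] := cder_cgauss_param c a t x.
  have h1 x : `]b - 1, b + 1[%classic x ->
      leb.-integrable setT (EFin \o (fun t => Im (cgauss c (a +i* x)%C t))).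
    by move=> _; have [] := cintegrable_cgauss (a +i* x)%C c0.
  have h2 x t : `]b - 1, b + 1[%classic x -> setT t ->
      derivable (fun x => Im (cgauss c (a +i* x)%C t)) x 1.
    by move=> _ _; case: (dI x t).
  have h3 x t : `]b - 1, b + 1[%classic x -> setT t ->
      `|partial1of2 (fun x t => Im (cgauss c (a +i* x)%C t)) x t| <= G t.
    move=> _ _; rewrite partial1of2E.
    have [_ ->] := dI x t.
    by rewrite (le_trans (le_Im_normc _)).
  apply: DeriveDef; first exact: (derivable_under_integral measurableT bI h1 h2 G0 iG h3).
  rewrite -derive1E (differentiation_under_integral measurableT bI h1 h2 G0 iG h3).
  apply: eq_Rintegral => t _; rewrite partial1of2E.
  by have [_ ->] := dI b t.
Qed.

(* As a function of b, both sides solve y' = (i (a + ib) / 2c) y; the left one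
   by an integration by parts. *)
Lemma cgauss_integral c z : 0 < c ->
  cintegral leb (cgauss c z) =
  (Num.sqrt (pi / c))%:C * cexp (((4 * c)^-1)%:C * z ^+ 2).
Proof.
move=> c0; case: z => a b; have c_neq0 : c != 0 by rewrite gt_eqF.
(* The inverse of the expected solution: [y * w] is then constant, and its value is read off at
   [x = 0], where the integral is a real Gaussian. *)
pose w x : C := cexp (- (((4 * c)^-1)%:C * (a +i* x)%C ^+ 2)).
pose y x : C := cintegral leb (cgauss c (a +i* x)%C).
have mom x : cintegral leb (fun t => 'i%C * t%:C * cgauss c (a +i* x)%C t) =
    'i%C * ((2 * c)^-1)%:C * (a +i* x)%C * y x.
  have /= := pgauss_parts 1 (a +i* x)%C c0.
  have -> : pgauss (1^`() - (2 * c)%:P * 'X * 1) c (a +i* x)%C =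
      (fun t => (- (2 * c))%:C * pgauss 'X c (a +i* x)%C t).
    apply/funext => t; rewrite /pgauss mulr1 -polyC1 derivC !hornerE /=.
    by rewrite -(realcM (- (2 * c)) t) mulNr.
  rewrite cintegralZl; last exact: cintegrable_pgauss.
  rewrite -cgauss_pgauss -/(y x) => h.
  transitivity ('i%C * cintegral leb (pgauss 'X c (a +i* x)%C)).
    rewrite -cintegralZl; last exact: cintegrable_pgauss.
    by apply: eq_cintegral => t; rewrite /pgauss hornerX mulrA.
  have k0 : (- (2 * c))%:C != 0 :> C.
    by rewrite realcN oppr_eq0; apply/eqP => -[/eqP]; rewrite mulf_eq0 (negbTE c_neq0) pnatr_eq0.
  apply: (mulfI k0); rewrite mulrCA h realcN.
  have e : (2 * c)%:C * ((2 * c)^-1)%:C = 1 :> C.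
    by rewrite -realcM divff// mulf_neq0.
  transitivity (- ((2 * c)%:C * ((2 * c)^-1)%:C) * ('i%C * ((a +i* x)%C * y x))).
    by rewrite e; ring.
  by ring.
have dw x : cder w x (- ('i%C * ((2 * c)^-1)%:C * (a +i* x)%C) * w x).
  apply: cder_cexp.
  have h : cder (fun x => a +i* x)%C x 'i%C.
    by split => /=; [exact: is_derive_cst|exact: is_derive_id].
  have := cderM (cder_cst (- ((4 * c)^-1)%:C) x) (cderM h h).
  under eq_fun do rewrite -expr2 mulNr.
  move/cder_eq; apply; rewrite mul0r add0r.
  have -> : ((2 * c)^-1)%:C = 2 * ((4 * c)^-1)%:C :> C.
    have -> : 2 = (2 : R)%:C :> C by rewrite rmorph_nat.
    by rewrite -realcM; congr (_%:C); field.
  by ring.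
have cst : y b * w b = y 0 * w 0.
  apply: (@cder0_cst _ (fun x => y x * w x)) => x.
  apply: (cder_eq (cderM (cder_cgauss_integral a x c0) (dw x))).
  rewrite mom -/(y x); move: (y x) (w x) => Y W; ring.
have y0 : y 0 = (Num.sqrt (pi / c))%:C * (expR (a ^+ 2 / (4 * c)))%:C.
  rewrite /y -realcM.
  transitivity (cintegral leb (fun t => (expR (- (c * t ^+ 2) + a * t))%:C)).
    by apply: eq_cintegral => t; rewrite -cexp_realc realcD (realcM a) realcN.
  by rewrite cintegral_real /Rintegral integral_gauss.
have w0 : w 0 = (expR (- (a ^+ 2 / (4 * c))))%:C.
  rewrite -cexp_realc /w; congr cexp; rewrite realcN realcM -realcX mulrC.
  by rewrite -[in RHS]realcM [in RHS]realcM realcX.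
move: cst; rewrite y0 w0 -mulrA -realcM -expRD subrr expR0 mulr1 => <-.
rewrite -mulrA /w -cexpD addNr cexp0 mulr1.
by [].
Qed.

End complex_gaussian.

(** * The bilinear form and Gaussian integrals on R^m *)

Section rv_gaussian.
Variable R : realType.
Local Notation C := R[i].
Local Notation leb := (@lebesgue_measure R).
Implicit Types (c r : R).

Lemma cdotC m (a b : 'rV[C]_m) : cdot a b = cdot b a.
Proof. by apply: eq_bigr => j _; rewrite mulrC. Qed.

Lemma cdotDl m (a b d : 'rV[C]_m) : cdot (a + b) d = cdot a d + cdot b d.
Proof. by rewrite /cdot -big_split; apply: eq_bigr => j _; rewrite mxE mulrDl. Qed.

Lemma cdotDr m (a b d : 'rV[C]_m) : cdot a (b + d) = cdot a b + cdot a d.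
Proof. by rewrite cdotC cdotDl !(cdotC a). Qed.

Lemma cdotNl m (a d : 'rV[C]_m) : cdot (- a) d = - cdot a d.
Proof. by rewrite /cdot -sumrN; apply: eq_bigr => j _; rewrite mxE mulNr. Qed.

Lemma cdotNr m (a d : 'rV[C]_m) : cdot a (- d) = - cdot a d.
Proof. by rewrite cdotC cdotNl cdotC. Qed.

Lemma cdotZl m (k : C) (a d : 'rV[C]_m) : cdot (k *: a) d = k * cdot a d.
Proof. by rewrite /cdot mulr_sumr; apply: eq_bigr => j _; rewrite mxE mulrA. Qed.

Lemma cdotZr m (k : C) (a d : 'rV[C]_m) : cdot a (k *: d) = k * cdot a d.
Proof. by rewrite cdotC cdotZl cdotC. Qed.

Lemma to_cvecD m (x y : 'rV[R]_m) : to_cvec (x + y) = to_cvec x + to_cvec y.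
Proof. by apply/rowP => j; rewrite !mxE realcD. Qed.

Lemma to_cvecZ m (k : R) (x : 'rV[R]_m) : to_cvec (k *: x) = k%:C *: to_cvec x.
Proof. by apply/rowP => j; rewrite !mxE realcM. Qed.

Lemma cdot_to_cvec m (x : 'rV[R]_m) : cdot (to_cvec x) (to_cvec x) = (rnorm2 x)%:C.
Proof.
rewrite /rnorm2 /cdot rmorph_sum; apply: eq_bigr => j _.
by rewrite !mxE -realcM expr2.
Qed.

Lemma Re_cdot_real m (a : 'rV[C]_m) (x : 'rV[R]_m) :
  Re (cdot a (to_cvec x)) = \sum_j Re (a 0 j) * x 0 j.
Proof.
rewrite /cdot Re_sum; apply: eq_bigr => j _.
by rewrite ReM !mxE /= mulr0 subr0.
Qed.

Lemma rnorm2Z m (k : R) (x : 'rV[R]_m) : rnorm2 (k *: x) = k ^+ 2 * rnorm2 x.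
Proof. by rewrite /rnorm2 mulr_sumr; apply: eq_bigr => j _; rewrite mxE exprMn. Qed.

Lemma rnorm2N m (x : 'rV[R]_m) : rnorm2 (- x) = rnorm2 x.
Proof. by apply: eq_bigr => j _; rewrite mxE sqrrN. Qed.

Lemma rnorm2_ge0 m (x : 'rV[R]_m) : 0 <= rnorm2 x.
Proof. by apply: sumr_ge0 => j _; rewrite sqr_ge0. Qed.

Section measurability.
Context d (T : measurableType d) (m : nat).

Lemma cmeas_cdot (f g : T -> 'rV[C]_m) :
  (forall j, cmeas (fun x => f x 0 j)) -> (forall j, cmeas (fun x => g x 0 j)) ->
  cmeas (fun x => cdot (f x) (g x)).
Proof. by move=> mf mg; apply: cmeas_sum => j; exact: cmeasM. Qed.

Lemma cmeas_to_cvec (f : T -> 'rV[R]_m) j : measurable_fun setT f ->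
  cmeas (fun x => to_cvec (f x) 0 j).
Proof.
move=> mf; under eq_fun do rewrite mxE; apply: cmeas_real.
exact: (measurableT_comp (measurable_rv_coord j) mf).
Qed.

Lemma measurable_rnorm2 (f : T -> 'rV[R]_m) : measurable_fun setT f ->
  measurable_fun setT (fun x => rnorm2 (f x)).
Proof.
move=> mf; apply: measurable_sum => j; apply: measurable_funX.
exact: (measurableT_comp (measurable_rv_coord j) mf).
Qed.

Lemma measurable_expR_rnorm2 (k : R) (f : T -> 'rV[R]_m) : measurable_fun setT f ->
  measurable_fun setT (fun x => expR (- (k * rnorm2 (f x)))).
Proof.
move=> mf; apply: (measurableT_comp (@measurable_expR R)).
apply: measurableT_comp => //; apply: measurable_funM => //.
exact: measurable_rnorm2.
Qed.

End measurability.

Lemma expR_sum (I : Type) (s : seq I) (F : I -> R) :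
  expR (\sum_(i <- s) F i) = \prod_(i <- s) expR (F i).
Proof. by elim/big_rec2: _ => [|i x y _ <-]; rewrite ?expR0 ?expRD. Qed.

(** The l^1 norm is chosen because its exponential factorises over the coordinates, and a multiple
    of it bounds every linear form. *)
Definition rv_l1 m (x : 'rV[R]_m) : R := \sum_j `|x 0 j|.

Lemma rv_l1_ge0 m (x : 'rV[R]_m) : 0 <= rv_l1 x.
Proof. by apply: sumr_ge0 => j _. Qed.

Lemma measurable_rv_l1 m : measurable_fun setT (@rv_l1 m).
Proof.
apply: measurable_sum => j; apply: measurableT_comp => //.
exact: measurable_rv_coord.
Qed.

Lemma integrable_rv_gauss m c r : 0 < c ->
  (lebesgue_rv R m).-integrable setT
    (fun x => (expR (- (c * rnorm2 x) + r * rv_l1 x))%:E).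
Proof.
move=> c0; pose phi (j : 'I_m) t : C := (expR (- (c * t ^+ 2) + r * `|t|))%:C.
have iphi j : cintegrable leb (phi j).
  by split; [exact: integrable_gauss|exact: integrable0].
have [h _] := cintegrable_rv_prod iphi.
apply: eq_integrable h => // x _; congr EFin.
rewrite -rmorph_prod /= -expR_sum big_split /= sumrN -mulr_sumr.
by rewrite /rnorm2 /rv_l1 -mulr_sumr.
Qed.

Lemma cgauss_rvE m c (z : 'rV[C]_m) (x : 'rV[R]_m) :
  cexp (- (c * rnorm2 x)%:C + cdot z (to_cvec x)) =
  \prod_j cgauss c (z 0 j) (x 0 j).
Proof.
rewrite -cexp_sum big_split /= sumrN -rmorph_sum /= /rnorm2 -mulr_sumr.
by congr (cexp (_ + _)); apply: eq_bigr => j _; rewrite mxE.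
Qed.

Lemma cintegral_rv_cgauss m c (z : 'rV[C]_m) : 0 < c ->
  cintegral (lebesgue_rv R m)
    (fun x => cexp (- (c * rnorm2 x)%:C + cdot z (to_cvec x))) =
  (Num.sqrt (pi / c) ^+ m)%:C * cexp (((4 * c)^-1)%:C * cdot z z).
Proof.
move=> c0; rewrite (eq_cintegral _ (cgauss_rvE c z)).
rewrite (cintegral_rv_prod (fun j => cintegrable_cgauss (z 0 j) c0)).
under eq_bigr => j _ do rewrite cgauss_integral//.
rewrite big_split /= prodr_const card_ord realcX; congr (_ * _).
by rewrite -cexp_sum -mulr_sumr.
Qed.

Lemma integral_rv_gauss m c : 0 < c ->
  (\int[lebesgue_rv R m]_x (expR (- (c * rnorm2 x)))%:E =
   (Num.sqrt (pi / c) ^+ m)%:E)%E.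
Proof.
move=> c0; have := integrable_rv_gauss m 0 c0.
under eq_fun do rewrite mul0r addr0; move=> ig.
rewrite -[LHS]fineK; last exact: integrable_fin_num.
congr EFin; have := cintegral_rv_cgauss (0 : 'rV[C]_m) c0.
have c0' : cdot (0 : 'rV[C]_m) 0 = 0.
  by rewrite /cdot big1// => j _; rewrite mxE mul0r.
have E (x : 'rV[R]_m) : cexp (- (c * rnorm2 x)%:C + cdot 0 (to_cvec x)) =
    (expR (- (c * rnorm2 x)))%:C.
  rewrite (_ : cdot _ _ = 0) ?addr0 -?realcN ?cexp_realc//.
  by rewrite /cdot big1// => j _; rewrite mxE mul0r.
by rewrite (eq_cintegral _ E) cintegral_real c0' mulr0 cexp0 mulr1 => -[].
Qed.

End rv_gaussian.

(** * Continuity of translations in L^2 *)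

Section eventually_small.
Variable R : realType.
Implicit Types w v : nat -> \bar R.

(** For nonnegative sequences this is convergence to 0, in a form that passes through majorants and
    sums without finiteness conditions. *)
Definition small w := forall e : R, 0 < e -> \forall k \near \oo, (w k <= e%:E)%E.

Lemma small_le w v : (forall k, (w k <= v k)%E) -> small v -> small w.
Proof.
by move=> wv sv e e0; apply: filterS (sv e e0) => k; exact: le_trans.
Qed.

Lemma smallD w v : small w -> small v -> small (fun k => w k + v k)%E.
Proof.
move=> sw sv e e0; have e2 : 0 < e / 2 by rewrite divr_gt0.
near=> k; rewrite [e]splitr EFinD; apply: leeD.
- by near: k; exact: sw.
- by near: k; exact: sv.
Unshelve. all: by end_near. Qed.

Lemma smallZ (c : R) w : 0 <= c -> (forall k, 0 <= w k)%E -> small w ->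
  small (fun k => c%:E * w k)%E.
Proof.
(* Division by [c + 1], since [c] may be 0. *)
move=> c0 w0 sw e e0; have c1 : 0 < c + 1 by rewrite ltr_wpDl.
have := sw (e / (c + 1)) (divr_gt0 e0 c1); apply: filterS => k wk.
apply: (@le_trans _ _ ((c + 1)%:E * w k)%E).
  by rewrite lee_wpmul2r// lee_fin lerDl.
apply: (@le_trans _ _ ((c + 1)%:E * (e / (c + 1))%:E)%E).
  by rewrite lee_wpmul2l// lee_fin ltW.
by rewrite -EFinM mulrC divfK// gt_eqF.
Qed.

Lemma cvg_small w : w k @[k --> \oo] --> 0%E -> small w.
Proof.
move=> cw e e0.
have /fine_cvgP[fw /cvgrPdist_le /(_ e e0) cw'] := cw.
apply: filterS2 fw cw' => k wk; rewrite sub0r normrN /= => h.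
by rewrite -(fineK wk) lee_fin (le_trans (ler_norm _)).
Qed.

Lemma small_dominated d (T : measurableType d) (mu : {measure set T -> \bar R})
    (f : nat -> T -> R) (g : T -> R) :
  (forall k, measurable_fun setT (f k)) ->
  mu.-integrable setT (fun x => (g x)%:E) ->
  (forall k x, `|f k x| <= g x) ->
  (forall x, f k x @[k --> \oo] --> 0) ->
  small (fun k => \int[mu]_x (f k x)%:E)%E.
Proof.
move=> mf ig fg f0; apply: cvg_small.
have [||||_ _] := @dominated_convergence _ _ _ mu setT measurableT
  (fun k x => (f k x)%:E) (fun=> 0%E) (fun x => (g x)%:E) _ _ _ ig.
- by move=> k; exact/measurable_EFinP.
- exact: measurable_cst.
- by apply: aeW => x _; apply: cvg_EFin; [exact: nearW|exact: f0].
- by apply: aeW => x k _; rewrite lee_fin.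
- by rewrite integral0.
Qed.

End eventually_small.

Section L2_translation.
Variables (R : realType) (m : nat).
Local Notation V := 'rV[R]_m.
Local Notation mu := (lebesgue_rv R m).
Implicit Types (u v : V -> R) (s e : R) (A B O : set V).

Let G (tau : V) := expR (- rnorm2 tau).
Let Z : R := Num.sqrt pi ^+ m.

Let G_ge0 tau : 0 <= G tau. Proof. exact: expR_ge0. Qed.

Let mG : measurable_fun setT G.
Proof.
have := @measurable_expR_rnorm2 R _ _ m 1 id (@measurable_id _ _ setT).
by under eq_fun do rewrite mul1r.
Qed.

Let intG : (\int[mu]_tau (G tau)%:E = Z%:E)%E.
Proof.
have := integral_rv_gauss m (@ltr01 R); rewrite divr1 => <-.
by apply: eq_integral => x _; rewrite mul1r.
Qed.

Let iG : mu.-integrable setT (fun tau => (G tau)%:E).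
Proof.
apply/integrableP; split; first exact/measurable_EFinP.
by under eq_integral do rewrite /= ger0_norm//; rewrite intG ltry.
Qed.

Let Z_ge0 : 0 <= Z. Proof. by rewrite exprn_ge0// sqrtr_ge0. Qed.

Lemma measurable_shift s : measurable_fun setT (fun p : V * V => p.1 + s *: p.2).
Proof.
apply: measurable_rvD; first exact: measurable_fst.
exact: (measurableT_comp (measurable_rvZ s) measurable_snd).
Qed.

Lemma integral_weight1 (f : V -> \bar R) : measurable_fun setT f ->
  (forall x, 0 <= f x)%E ->
  (\int[mu \x mu]_p (f p.1 * (G p.2)%:E) = \int[mu]_x f x * Z%:E)%E.
Proof.
move=> mf f0.
rewrite fubini_tonelli1 => [||[x y]]; last by rewrite mule_ge0// lee_fin.
  rewrite /fubini_F /=.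
  transitivity (\int[mu]_x (f x * Z%:E))%E.
    apply: eq_integral => x _; rewrite -intG -ge0_integralZl//.
    - exact/measurable_EFinP.
    - by move=> y _; rewrite lee_fin.
  by rewrite ge0_integralZr.
apply: emeasurable_funM; first exact: (measurableT_comp mf measurable_fst).
by apply/measurable_EFinP; exact: (measurableT_comp mG measurable_snd).
Qed.

Lemma integral_shift2 (f : V * V -> \bar R) s : measurable_fun setT f ->
  (forall p, 0 <= f p)%E ->
  (\int[mu \x mu]_p f (p.1 + s *: p.2, p.2)%R = \int[mu \x mu]_p f p)%E.
Proof.
move=> mf f0.
have mf' : measurable_fun setT (fun p : V * V => f (p.1 + s *: p.2, p.2)).
  apply: (measurableT_comp mf); apply: measurable_fun_pair => /=.
  - exact: measurable_shift.
  - exact: measurable_snd.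
rewrite (fubini_tonelli2 _ mf' (fun p => f0 _)) [RHS](fubini_tonelli2 _ mf f0); apply: eq_integral => y _.
rewrite /fubini_G /= (integral_rvD (s *: y) (f := fun x => f (x, y)))//.
exact: (measurableT_comp mf (measurable_pair2 y)).
Qed.

(** The squared L^2 distance between [u] and its translate by [s tau], averaged over [tau] with
    weight [exp(-|tau|^2)]. This average is the error term that the damped Plancherel identity
    leaves, see [ReL]. *)
Definition shift_dist u s :=
  (\int[mu \x mu]_p ((u p.1 - u (p.1 + s *: p.2)%R) ^+ 2 * G p.2)%:E)%E.

Lemma measurable_shift_dist u s : measurable_fun setT u ->
  measurable_fun setT (fun p : V * V => (u p.1 - u (p.1 + s *: p.2)) ^+ 2 * G p.2).
Proof.
move=> mu'; apply: measurable_funM.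
  apply: measurable_funX; apply: measurable_funB.
  - exact: (measurableT_comp mu' measurable_fst).
  - exact: (measurableT_comp mu' (measurable_shift s)).
exact: (measurableT_comp mG measurable_snd).
Qed.

Lemma shift_dist_ge0 u s : (0 <= shift_dist u s)%E.
Proof. by apply: integral_ge0 => p _; rewrite lee_fin mulr_ge0// sqr_ge0. Qed.

Lemma sqrD_le (x y : R) : (x + y) ^+ 2 <= 2 * x ^+ 2 + 2 * y ^+ 2.
Proof.
rewrite -subr_ge0; have -> : 2 * x ^+ 2 + 2 * y ^+ 2 - (x + y) ^+ 2 = (x - y) ^+ 2.
  by ring.
exact: sqr_ge0.
Qed.

Lemma shift_distD u v s : measurable_fun setT u -> measurable_fun setT v ->
  (shift_dist (fun x => u x + v x)%R s <=
   2%:E * shift_dist u s + 2%:E * shift_dist v s)%E.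
Proof.
move=> mu' mv; have [h1 h2] := (measurable_shift_dist s mu', measurable_shift_dist s mv).
rewrite /shift_dist -!ge0_integralZl//; last first.
- by move=> p _; rewrite lee_fin mulr_ge0// sqr_ge0.
- exact/measurable_EFinP.
- by move=> p _; rewrite lee_fin mulr_ge0// sqr_ge0.
- exact/measurable_EFinP.
rewrite -ge0_integralD//; last first.
- by apply/measurable_EFinP; exact: measurable_funM.
- by move=> p _; rewrite mule_ge0// lee_fin mulr_ge0// sqr_ge0.
- by apply/measurable_EFinP; exact: measurable_funM.
- by move=> p _; rewrite mule_ge0// lee_fin mulr_ge0// sqr_ge0.
apply: ge0_le_integral => //.
- by move=> p _; rewrite lee_fin mulr_ge0// sqr_ge0.
- by apply/measurable_EFinP; exact: (measurable_shift_dist s (measurable_funD mu' mv)).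
- by apply: emeasurable_funD; apply/measurable_EFinP; exact: measurable_funM.
move=> p _; rewrite -!EFinM -EFinD lee_fin !(mulrA 2 _ (G p.2)) -mulrDl ler_wpM2r//.
by rewrite opprD addrACA; exact: sqrD_le.
Qed.

Lemma shift_distZ (c : R) u s : measurable_fun setT u ->
  (shift_dist (fun x => c * u x)%R s = (c ^+ 2)%:E * shift_dist u s)%E.
Proof.
move=> mu'; rewrite /shift_dist -ge0_integralZl//; last first.
- by rewrite lee_fin sqr_ge0.
- by move=> p _; rewrite lee_fin mulr_ge0// sqr_ge0.
- by apply/measurable_EFinP; exact: measurable_shift_dist.
by apply: eq_integral => p _; rewrite -EFinM mulrA -exprMn mulrBr.
Qed.

(** By [(a - b)^2 <= 2 a^2 + 2 b^2] and translation invariance, each of the two terms contributes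
    [2 Z] times the squared norm. The bound is uniform in [s], which lets [shift_continuous] pass to
    limits in L^2. *)
Lemma shift_dist_le u s : measurable_fun setT u ->
  (shift_dist u s <= (4 * Z)%:E * \int[mu]_x (u x ^+ 2)%:E)%E.
Proof.
move=> mu'.
have mu2 : measurable_fun setT (fun x => (u x ^+ 2)%:E).
  by apply/measurable_EFinP; exact: measurable_funX.
pose f (p : V * V) := (2 * u p.1 ^+ 2 * G p.2)%:E.
have mf : measurable_fun setT f.
  apply/measurable_EFinP; apply: measurable_funM.
    apply: measurable_funM => //; apply: measurable_funX.
    exact: (measurableT_comp mu' measurable_fst).
  exact: (measurableT_comp mG measurable_snd).
have f0 p : (0 <= f p)%E by rewrite lee_fin mulr_ge0// mulr_ge0// sqr_ge0.
have mf' : measurable_fun setT (fun p : V * V => f (p.1 + s *: p.2, p.2)).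
  apply: (measurableT_comp mf); apply: measurable_fun_pair => /=.
  - exact: measurable_shift.
  - exact: measurable_snd.
have If : (\int[mu \x mu]_p f p = (2 * Z)%:E * \int[mu]_x (u x ^+ 2)%:E)%E.
  transitivity (\int[mu \x mu]_p ((2 * u p.1 ^+ 2)%:E * (G p.2)%:E))%E => //.
  rewrite (integral_weight1 (f := fun x => (2 * u x ^+ 2)%:E)); last 2 first.
  - by apply/measurable_EFinP; apply: measurable_funM => //; exact: measurable_funX.
  - by move=> x; rewrite lee_fin mulr_ge0// sqr_ge0.
  under eq_integral do rewrite EFinM.
  rewrite ge0_integralZl//; last by move=> x _; rewrite lee_fin sqr_ge0.
  by rewrite EFinM muleAC.
have -> : ((4 * Z)%:E * \int[mu]_x (u x ^+ 2)%:E =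
    \int[mu \x mu]_p f p + \int[mu \x mu]_p f (p.1 + s *: p.2, p.2)%R)%E.
  rewrite integral_shift2// If -ge0_muleDl ?lee_fin ?mulr_ge0//.
  by rewrite -EFinD -mulrDl; congr ((_ * _)%:E * _)%E; ring.
rewrite -ge0_integralD//; apply: ge0_le_integral => //.
- by move=> p _; rewrite lee_fin mulr_ge0// sqr_ge0.
- by apply/measurable_EFinP; exact: measurable_shift_dist.
- exact: emeasurable_funD.
move=> p _; rewrite /f -EFinD lee_fin -mulrDl ler_wpM2r//.
by apply: le_trans (sqrD_le _ _) _; rewrite sqrrN.
Qed.

Let step (k : nat) : R := k.+1%:R^-1.

(** Continuity of translations is tested along the single sequence [s = 1/(k+1)]: dominated
    convergence is stated for sequences, and [plancherel] lets [s] tend to 0 along this one. *)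
Definition shift_continuous u := small (fun k => shift_dist u (step k)).

Lemma shift_continuousD u v : measurable_fun setT u -> measurable_fun setT v ->
  shift_continuous u -> shift_continuous v ->
  shift_continuous (fun x => u x + v x).
Proof.
move=> mu' mv cu cv; apply: (small_le (fun k => shift_distD (step k) mu' mv)).
by apply: smallD; apply: smallZ => // k; exact: shift_dist_ge0.
Qed.

Lemma shift_continuousZ (c : R) u : measurable_fun setT u ->
  shift_continuous u -> shift_continuous (fun x => c * u x).
Proof.
move=> mu' cu.
apply: (small_le (v := fun k => ((c ^+ 2)%:E * shift_dist u (step k))%E)).
  by move=> k; rewrite shift_distZ.
by apply: smallZ => //; [exact: sqr_ge0|move=> k; exact: shift_dist_ge0].
Qed.

Lemma shift_continuous_lim u (v : nat -> V -> R) : measurable_fun setT u ->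
  (forall n, measurable_fun setT (v n)) -> (forall n, shift_continuous (v n)) ->
  small (fun n => \int[mu]_x ((u x - v n x) ^+ 2)%:E)%E ->
  shift_continuous u.
Proof.
move=> mu' mv cv uv e e0.
(* The factor 2 of [shift_distD] times the [4 Z] of [shift_dist_le], plus 1 for a positive
   denominator. *)
pose c := 8 * Z + 1.
have c0 : 0 < c by rewrite ltr_wpDl// mulr_ge0.
have [N _ hN] := uv (e / 2 / c) (divr_gt0 (divr_gt0 e0 (ltr0Sn R 1)) c0).
have {hN} := hN N (leqnn N); move=> hN.
have e4 : 0 < e / 4 by rewrite divr_gt0.
apply: filterS (cv N _ e4) => k hk.
have mw : measurable_fun setT (fun x => u x - v N x) by exact: measurable_funB.
have := shift_distD (step k) mw (mv N).
under eq_fun do rewrite subrK.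
move=> /le_trans; apply.
have -> : e = e / 2 + 2 * (e / 4) by field.
rewrite (EFinD (e / 2)); apply: leeD; last by rewrite (EFinM 2) lee_wpmul2l.
apply: (@le_trans _ _ (2%:E * ((4 * Z)%:E * (e / 2 / c)%:E))%E).
  rewrite lee_wpmul2l//; apply: le_trans (shift_dist_le _ mw) _.
  by rewrite lee_wpmul2l// lee_fin mulr_ge0.
rewrite -!EFinM lee_fin.
have -> : 2 * (4 * Z * (e / 2 / c)) = 8 * Z / c * (e / 2) by field; rewrite gt_eqF.
apply: ler_piMl; first by rewrite divr_ge0// ltW.
by rewrite ler_pdivrMr// mul1r /c lerDl.
Qed.

(** The last hypothesis is openness along rays. It makes the loss [1_O(x) (1 - 1_O(x + s tau))]
    vanish for small [s] at each point, under the integrable majorant [1_O(x) G(tau)]. The gain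
    [1_O(x + s tau) (1 - 1_O(x))] is the loss for [-s] after the substitution [x |-> x + s tau]. *)
Lemma shift_continuous_radial O : measurable O -> (mu O < +oo)%E ->
  (forall x y, O x -> \forall k \near \oo, O (x + step k *: y)) ->
  shift_continuous \1_O.
Proof.
move=> mO Ooo rO.
pose f s (p : V * V) : R := \1_O p.1 * (1 - \1_O (p.1 + s *: p.2)) * G p.2.
have mI : measurable_fun setT (\1_O : V -> R) by exact: measurable_indic.
have mf s : measurable_fun setT (f s).
  apply: measurable_funM; last exact: (measurableT_comp mG measurable_snd).
  apply: measurable_funM; first exact: (measurableT_comp mI measurable_fst).
  apply: measurable_funB => //; exact: (measurableT_comp mI (measurable_shift s)).
have I01 x : 0 <= (\1_O x : R) <= 1 by rewrite indicE; case: (_ \in _); rewrite /= ?lexx ?ler01.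
have f0 s p : 0 <= f s p.
  by rewrite mulr_ge0// mulr_ge0 ?subr_ge0.
have iI : mu.-integrable setT (fun x => (\1_O x : R)%:E).
  apply/integrableP; split; first exact/measurable_EFinP.
  under eq_integral do rewrite /= ger0_norm//.
  by rewrite integral_indic// setIT.
have sf (sg : R) : small (fun k => \int[(mu \x mu)%E]_p (f (sg * step k) p)%:E)%E.
  apply: (small_dominated (g := fun p => \1_O p.1 * G p.2)).
  - by move=> k; exact: mf.
  - exact: integrable_tensor iI iG.
  - move=> k p; rewrite ger0_norm// /f ler_wpM2r// ler_piMr// ?gerBl//.
  - move=> p; apply: cvg_near_cst.
    have [Op|nOp] := pselect (O p.1); last first.
      by apply: nearW => k; rewrite /f indicE memNset// !mul0r.
    apply: filterS (rO p.1 (sg *: p.2) Op) => k hk.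
    by rewrite /f [X in 1 - X]indicE mem_set ?subrr ?mulr0 ?mul0r// mulrC -scalerA.
apply: (small_le _ (smallD (sf 1) (sf (-1)))) => k.
rewrite mul1r mulN1r.
pose h p : \bar R := (f (- step k) p)%:E.
have mh : measurable_fun setT h by exact/measurable_EFinP.
rewrite -[X in (_ <= _ + X)%E](integral_shift2 (step k) mh); last first.
  by move=> p; rewrite lee_fin.
have mh' : measurable_fun setT (fun p : V * V => h (p.1 + step k *: p.2, p.2)).
  apply: (measurableT_comp mh); apply: measurable_fun_pair => /=.
  - exact: measurable_shift.
  - exact: measurable_snd.
rewrite -ge0_integralD//; last 3 first.
- by move=> p _; rewrite lee_fin.
- exact/measurable_EFinP.
- by move=> p _; rewrite lee_fin.
apply: ge0_le_integral => //.
- by move=> p _; rewrite lee_fin mulr_ge0// sqr_ge0.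
- by apply/measurable_EFinP; exact: measurable_shift_dist.
- by apply: emeasurable_funD => //; exact/measurable_EFinP.
move=> p _; rewrite /h /f /= -EFinD lee_fin -mulrDl ler_wpM2r//.
rewrite scaleNr addrK.
rewrite !indicE; case: (p.1 \in O); case: (_ \in O); rewrite /=.
- by rewrite !subrr expr0n /= mulr0 addr0.
- by rewrite subr0 expr1n mulr1 mul0r addr0.
- by rewrite sub0r sqrrN expr1n mul0r subr0 mulr1 add0r.
- by rewrite subr0 expr0n /= !mul0r addr0.
Qed.

End L2_translation.

Section L2_shift_continuity.
Variables (R : realType) (m : nat).
Local Notation V := 'rV[R]_m.
Local Notation mu := (lebesgue_rv R m).
Implicit Types (u v : V -> R) (A B O : set V).

Definition rv_box (r : R) : set V := [set x | forall j, `|x 0 j| < r].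

Lemma measurable_rv_coord_lt (j : 'I_m) (c : R) : measurable [set x : V | x 0 j < c].
Proof.
have := @measurable_rv_coord R m j measurableT `]-oo, c[%classic (measurable_itv _).
by rewrite setTI; congr measurable; apply/seteqP; split=> x /=; rewrite in_itv.
Qed.

Lemma measurable_rv_box r : measurable (rv_box r).
Proof.
have -> : rv_box r = \bigcap_(j in [set: 'I_m]) [set x : V | `|x 0 j| < r].
  by apply/seteqP; split=> x h j; [move=> _; exact: h|exact: h].
apply: fin_bigcap_measurable => // j _.
have := @measurable_rv_coord R m j measurableT `]- r, r[%classic (measurable_itv _).
by rewrite setTI; congr measurable; apply/seteqP; split=> x /=; rewrite in_itv /= -ltr_norml.
Qed.

(** On the box [|x|^2 <= m r^2], so its indicator is at most [exp(m r^2) exp(-|x|^2)]. *)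
Lemma rv_box_fin r : (mu (rv_box r) < +oo)%E.
Proof.
rewrite -(setIT (rv_box r)) -integral_indic//; last exact: measurable_rv_box.
have : mu.-integrable setT (fun x : V => (expR (m%:R * r ^+ 2) * expR (- (1 * rnorm2 x) + 0 * rv_l1 x))%:E).
  exact: (integrableZl measurableT _ (integrable_rv_gauss m 0 (@ltr01 R))).
move=> /integrableP[mg]; apply: le_lt_trans; apply: ge0_le_integral => //.
- by apply/measurable_EFinP; apply: measurable_indic; exact: measurable_rv_box.
- exact: measurableT_comp.
move=> x _; rewrite lee_fin -expRD mul0r addr0 mul1r ger0_norm ?expR_ge0//.
rewrite indicE; case: (boolP (x \in rv_box r)) => [/set_mem xr|_]; last exact: expR_ge0.
rewrite /= -[leLHS]expR0 ler_expR subr_ge0.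
have -> : m%:R * r ^+ 2 = \sum_(j < m) r ^+ 2 by rewrite sumr_const card_ord mulr_natl.
apply: ler_sum => j _; rewrite -real_normK ?num_real//.
by rewrite ler_sqr ?nnegrE// ?ltW// (le_lt_trans _ (xr j)).
Qed.

Lemma cvg_step (c : R) : k.+1%:R^-1 * c @[k --> \oo] --> 0.
Proof. by rewrite -[X in _ --> X](mul0r c); apply: cvgMl; exact: cvg_harmonic. Qed.

Lemma near_coord_lt (x y : V) j (c : R) : x 0 j < c ->
  \forall k \near \oo, (x + k.+1%:R^-1 *: y) 0 j < c.
Proof.
move=> xc; have := @cvg_step (y 0 j) => /cvgrPdist_lt /(_ (c - x 0 j)).
rewrite subr_gt0 => /(_ xc); apply: filterS => k.
by rewrite sub0r normrN !mxE -ltrBrDl; apply: le_lt_trans; exact: ler_norm.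
Qed.

Lemma near_coord_gt (x y : V) j (c : R) : c < x 0 j ->
  \forall k \near \oo, c < (x + k.+1%:R^-1 *: y) 0 j.
Proof.
move=> xc; have := @cvg_step (y 0 j) => /cvgrPdist_lt /(_ (x 0 j - c)).
rewrite subr_gt0 => /(_ xc); apply: filterS => k.
rewrite sub0r normrN !mxE => h; rewrite -ltrBlDl -ltrN2 opprB.
by apply: le_lt_trans h; rewrite -normrN ler_norm.
Qed.

Lemma near_rv_box r (x y : V) : rv_box r x ->
  \forall k \near \oo, rv_box r (x + k.+1%:R^-1 *: y).
Proof.
move=> xr.
suff : \forall k \near \oo, forall j, j \in enum 'I_m -> `|(x + k.+1%:R^-1 *: y) 0 j| < r.
  by apply: filterS => k h j; apply: h; rewrite mem_enum.
elim: (enum 'I_m) => [|j s IH]; first by apply: nearW.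
have := xr j; rewrite ltr_norml => /andP[h1 h2].
apply: filterS3 IH (near_coord_gt y h1) (near_coord_lt y h2) => k hs g1 g2 i.
by rewrite in_cons => /orP[/eqP ->|/hs //]; rewrite ltr_norml g1 g2.
Qed.

(** Cutting with a box keeps all measures finite and turns complements into differences of
    indicators. For fixed [r] these sets form a sigma-algebra that contains the half-spaces
    [x_j < c], hence every Borel set. *)
Let good r A := measurable A /\ shift_continuous (\1_(A `&` rv_box r) : V -> R).

Let mI r A : measurable A -> measurable_fun setT (\1_(A `&` rv_box r) : V -> R).
Proof. by move=> mA; apply: measurable_indic; apply: measurableI => //; exact: measurable_rv_box. Qed.

Let shift_continuous_box r : shift_continuous (\1_(rv_box r) : V -> R).
Proof.
apply: shift_continuous_radial; [exact: measurable_rv_box|exact: rv_box_fin|].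
by move=> x y; exact: near_rv_box.
Qed.

Let good_lt r j c : good r [set x | x 0 j < c].
Proof.
split; first exact: measurable_rv_coord_lt.
apply: shift_continuous_radial.
- by apply: measurableI; [exact: measurable_rv_coord_lt|exact: measurable_rv_box].
- apply: le_lt_trans (rv_box_fin r); apply: le_measure; rewrite ?inE.
  + by apply: measurableI; [exact: measurable_rv_coord_lt|exact: measurable_rv_box].
  + exact: measurable_rv_box.
  + exact: subIsetr.
- move=> x y [/= xc xr].
  by apply: filterS2 (near_coord_lt y xc) (near_rv_box y xr) => k.
Qed.

Let shift_dist_square u v (w : V -> R) (s : R) : measurable_fun setT u -> measurable_fun setT v ->
  measurable_fun setT w ->
  (forall x y, (w x - w y) ^+ 2 <= (u x - u y) ^+ 2 + (v x - v y) ^+ 2) ->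
  (@shift_dist R m w s <= shift_dist u s + shift_dist v s)%E.
Proof.
move=> mu' mv mw h; rewrite /shift_dist -ge0_integralD//; last first.
- by apply/measurable_EFinP; exact: measurable_shift_dist.
- by move=> p _; rewrite lee_fin mulr_ge0// ?sqr_ge0// expR_ge0.
- by apply/measurable_EFinP; exact: measurable_shift_dist.
- by move=> p _; rewrite lee_fin mulr_ge0// ?sqr_ge0// expR_ge0.
apply: ge0_le_integral => //.
- by move=> p _; rewrite lee_fin mulr_ge0// ?sqr_ge0// expR_ge0.
- by apply/measurable_EFinP; exact: measurable_shift_dist.
- by apply: emeasurable_funD; apply/measurable_EFinP; exact: measurable_shift_dist.
move=> p _; rewrite -EFinD lee_fin -mulrDl ler_wpM2r// ?expR_ge0//.
Qed.

(** Where the indicator of the intersection changes between two points, the indicator of one of the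
    two traces changes as well. *)
Let goodI r A B : good r A -> good r B -> good r (A `&` B).
Proof.
move=> [mA gA] [mB gB]; split; first exact: measurableI.
apply: (small_le _ (smallD gA gB)) => k.
apply: shift_dist_square; [exact: mI|exact: mI|by apply: mI; exact: measurableI|].
move=> x y; rewrite !indicE !in_setI.
case: (x \in A); case: (x \in B); case: (x \in rv_box r); case: (y \in A);
  case: (y \in B); case: (y \in rv_box r);
  rewrite /= ?(subrr, subr0, sub0r, sqrrN, expr1n, expr0n, addr0, add0r) //=;
  lra.
Qed.

Let goodC r A : good r A -> good r (~` A).
Proof.
move=> [mA gA]; split; first exact: measurableC.
have -> : (\1_(~` A `&` rv_box r) : V -> R) =
    (fun x => \1_(rv_box r) x + -1 * \1_(A `&` rv_box r) x).
  apply/funext => x; rewrite !indicE !in_setI in_setC.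
  by case: (x \in A); case: (x \in _) => /=; ring.
apply: shift_continuousD.
- (apply: measurable_indic; exact: measurable_rv_box).
- by apply: measurable_funM => //; exact: mI.
- exact: shift_continuous_box.
- by apply: shift_continuousZ => //; exact: mI.
Qed.

Let goodT r : good r setT.
Proof. by split => //; rewrite setTI; exact: shift_continuous_box. Qed.

(** Finite unions are good by De Morgan; their indicators converge pointwise, with the indicator of
    the box as majorant. *)
Let good_bigcup r (F : nat -> set V) : (forall n, good r (F n)) -> good r (\bigcup_n F n).
Proof.
move=> gF; have mF n : measurable (F n) by case: (gF n).
split; first exact: bigcupT_measurable.
pose S n := \big[setU/set0]_(i < n) F i.
have gS n : good r (S n).
  elim: n => [|n IH]; rewrite /S.
    by rewrite big_ord0 -setCT; exact/goodC/goodT.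
  by rewrite big_ord_recr /= -[X in good r X]setCK setCU; apply/goodC/goodI; apply: goodC.
have mS n : measurable (S n) by case: (gS n).
apply: (@shift_continuous_lim _ _ _ (fun n => \1_(S n `&` rv_box r))).
- by apply: mI; exact: bigcupT_measurable.
- by move=> n; exact: mI.
- by move=> n; case: (gS n).
apply: (small_dominated (g := \1_(rv_box r))).
- move=> n; apply: measurable_funX; apply: measurable_funB; last exact: mI.
  by apply: mI; exact: bigcupT_measurable.
- apply/integrableP; split; first by apply/measurable_EFinP; apply: measurable_indic; exact: measurable_rv_box.
  under eq_integral do rewrite /= ger0_norm//.
  by rewrite integral_indic ?setIT//; [exact: rv_box_fin|exact: measurable_rv_box].
- move=> n x; rewrite ger0_norm ?sqr_ge0// !indicE !in_setI.
  by case: (x \in _); case: (x \in _); case: (x \in _) => /=; lra.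
move=> x; apply: cvg_near_cst.
have [[i _ Fix]|nF] := pselect ((\bigcup_n F n) x).
  exists i.+1 => // n /= ni; rewrite !indicE !in_setI.
  rewrite (mem_set (A := S n)); last first.
    by rewrite /S -bigcup_mkord; exists i.
  by rewrite (mem_set (A := \bigcup_n F n)) ?subrr ?expr0n//; exists i.
apply: nearW => n; rewrite !indicE !in_setI.
rewrite (memNset (A := S n)); last first.
  by rewrite /S -bigcup_mkord => -[i _ Fi]; apply: nF; exists i.
by rewrite (memNset (A := \bigcup_n F n))// subrr expr0n.
Qed.

Lemma shift_continuous_indic r A : measurable A ->
  shift_continuous (\1_(A `&` rv_box r) : V -> R).
Proof.
move=> mA; suff : good r A by case.
have sgood : sigma_algebra setT (good r).
  split.
  - by rewrite -setCT; exact/goodC/goodT.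
  - by move=> B gB; rewrite setTD; exact: goodC.
  - by move=> F; exact: good_bigcup.
apply: (smallest_sub sgood _ mA).
rewrite -bigcup_seq; apply: bigcup_sub => j _ _ [B mB <-]; rewrite setTI.
(* A second generation argument, on the line: its Borel sets are generated by the rays []-oo, c[],
   whose preimages are half-spaces. *)
have sB : sigma_algebra setT [set B : set R | good r (rv_coord j @^-1` B)].
  split=> /=.
  - by rewrite preimage_set0 -setCT; exact/goodC/goodT.
  - by move=> D gD; rewrite setTD preimage_setC; exact: goodC.
  - by move=> F gF; rewrite preimage_bigcup; exact: good_bigcup.
move: mB; rewrite RGenInftyO.measurableE => mB.
apply: (smallest_sub sB _ mB) => _ [c ->] /=.
have -> : rv_coord j @^-1` `]-oo, c[ = [set x : V | x 0 j < c].
  by apply/seteqP; split=> x /=; rewrite in_itv.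
exact: good_lt.
Qed.

Import HBNNSimple.

Let shift_continuous_nnsfun r (h : {nnsfun V >-> R}) :
  shift_continuous (fun x => h x * \1_(rv_box r) x).
Proof.
have -> : (fun x => h x * \1_(rv_box r) x) = (fun x : V =>
    \sum_(c <- finmap.enum_fset (fset_set (range h))) c * \1_(h @^-1` [set c] `&` rv_box r) x).
  apply/funext => x; rewrite (fimfunE h x) fsbig_finite//= mulr_suml.
  by apply: eq_bigr => c _; rewrite -mulrA !indicE in_setI -natrM mulnb.
elim: (finmap.enum_fset _) => [|c s IH].
  under eq_fun do rewrite big_nil.
  rewrite /shift_continuous /shift_dist => e e0; apply: nearW => k.
  by rewrite integral0_eq ?lee_fin ?ltW// => p _; rewrite subrr expr0n mul0r.
under eq_fun do rewrite big_cons.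
have mh (d : R) : measurable (h @^-1` [set d]) by exact: measurable_sfunP.
apply: shift_continuousD => //.
- by apply: measurable_funM => //; exact: mI.
- by apply: measurable_sum => d; apply: measurable_funM => //; exact: mI.
- by apply: shift_continuousZ; [exact: mI|exact: shift_continuous_indic].
Qed.

Let shift_continuous_ge0 u : measurable_fun setT u -> (forall x, 0 <= u x) ->
  (\int[mu]_x (u x ^+ 2)%:E < +oo)%E -> shift_continuous u.
Proof.
move=> mu' u0 u2.
have mE : measurable_fun setT (fun x => (u x)%:E) by exact/measurable_EFinP.
pose h := nnsfun_approx measurableT mE.
have hu n x : h n x <= u x.
  have hc := cvg_nnsfun_approx measurableT mE (fun x _ => u0 x) (I : setT x).
  have hl : (h ^~ x) k @[k --> \oo] --> u x := fine_cvg hc.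
  have nd : nondecreasing_seq (h ^~ x).
    by move=> a b ab; have /lefP := nd_nnsfun_approx measurableT mE ab; apply.
  have -> : u x = limn (h ^~ x) by apply/esym/cvg_lim => //; exact: hl.
  by apply: nondecreasing_cvgn_le => //; apply/cvg_ex; exists (u x); exact: hl.
(* The simple functions are cut off to growing boxes, since indicators are controlled only inside a
   box. The error lies between 0 and [u], so its square is dominated by [u^2]. *)
apply: (@shift_continuous_lim _ _ _ (fun n x => h n x * \1_(rv_box n%:R) x)) => //.
- move=> n; apply: measurable_funM => //.
  (apply: measurable_indic; exact: measurable_rv_box).
apply: (small_dominated (g := fun x => u x ^+ 2)).
- move=> n; apply: measurable_funX; apply: measurable_funB => //.
  by apply: measurable_funM => //; (apply: measurable_indic; exact: measurable_rv_box).
- apply/integrableP; split; first exact/measurable_EFinP/measurable_funX.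
  by under eq_integral do rewrite /= ger0_norm ?sqr_ge0//.
- move=> n x; rewrite ger0_norm ?sqr_ge0// ler_sqr ?nnegrE//.
    by rewrite gerBl mulr_ge0.
  rewrite subr_ge0 indicE; case: (x \in _); rewrite /= ?mulr1 ?mulr0.
    exact: hu.
  exact: u0.
move=> x.
have hc : h n x @[n --> \oo] --> u x.
  exact: (fine_cvg (cvg_nnsfun_approx measurableT mE (fun x _ => u0 x) (I : setT x))).
have : (u x - h n x) ^+ 2 @[n --> \oo] --> (u x - u x) ^+ 2.
  have hB : u x - h n x @[n --> \oo] --> u x - u x.
    by apply: cvgB; [exact: cvg_cst|exact: hc].
  by rewrite expr2; under eq_fun do rewrite expr2; exact: (cvgM hB hB).
rewrite subrr expr0n /=; apply: cvg_trans; apply: near_eq_cvg.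
exists (Num.truncn (rv_l1 x)).+1 => // n /= xn.
rewrite indicE mem_set ?mulr1// => j.
apply: (@le_lt_trans _ _ (rv_l1 x)).
  by rewrite /rv_l1 (bigD1 j)//= lerDl sumr_ge0.
by apply: lt_le_trans (truncnS_gt _) _; rewrite ler_nat.
Qed.

Lemma shift_continuous_L2 u : measurable_fun setT u ->
  (\int[mu]_x (u x ^+ 2)%:E < +oo)%E -> shift_continuous u.
Proof.
move=> mu' u2.
have sq (v : V -> R) : measurable_fun setT v -> (forall x, 0 <= v x) ->
    (forall x, v x <= `|u x|) -> shift_continuous v.
  move=> mv v0 vu; apply: shift_continuous_ge0 => //.
  apply: le_lt_trans u2; apply: ge0_le_integral => //.
  - by move=> x _; rewrite lee_fin sqr_ge0.
  - exact/measurable_EFinP/measurable_funX.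
  - exact/measurable_EFinP/measurable_funX.
  by move=> x _; rewrite lee_fin -[u x ^+ 2]real_normK ?num_real// ler_sqr ?nnegrE.
pose up x := Num.max (u x) 0; pose un x := Num.max (- u x) 0.
have mup : measurable_fun setT up by exact: measurable_maxr.
have mun : measurable_fun setT un by apply: measurable_maxr => //; exact: measurableT_comp.
have -> : u = (fun x => up x + -1 * un x).
  apply/funext => x; rewrite /up /un; case: (leP (u x) 0) => ux.
    by rewrite max_l ?oppr_ge0//; ring.
  by rewrite max_r ?oppr_le0 ?ltW//; ring.
apply: shift_continuousD => //; first exact: measurable_funM.
  by apply: sq => // x; rewrite /up ?le_max ?lexx ?orbT// ge_max ler_norm normr_ge0.
apply: shift_continuousZ => //.
by apply: sq => // x; rewrite /un ?le_max ?lexx ?orbT// ge_max -normrN ler_norm normr_ge0.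
Qed.

End L2_shift_continuity.

(** * Plancherel's identity for functions in L^1 and L^2 *)

Section plancherel.
Variables (R : realType) (m : nat).
Local Notation C := R[i].
Local Notation V := 'rV[R]_m.
Local Notation mu := (lebesgue_rv R m).

Definition cis (y x : V) : C := cexp ('i%C * cdot (to_cvec y) (to_cvec x)).

Definition rdot (x y : V) : R := \sum_j x 0 j * y 0 j.

Lemma cdot_rdot (x y : V) : cdot (to_cvec x) (to_cvec y) = (rdot x y)%:C.
Proof. by rewrite /rdot rmorph_sum; apply: eq_bigr => j _; rewrite !mxE -realcM. Qed.

Arguments cis : simpl never.

Lemma normc_cis (y x : V) : normc (cis y x) = 1.
Proof. by rewrite normc_cexp cdot_rdot ReM /= mulr0 mul0r subr0 expR0. Qed.

Lemma cisDr (y x x' : V) : cis y (x + x') = cis y x * cis y x'.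
Proof. by rewrite /cis to_cvecD cdotDr mulrDr cexpD. Qed.

Lemma cisC (y x : V) : cis y x = cis x y.
Proof. by rewrite /cis cdotC. Qed.

Lemma cisN (y x : V) : cis y (- x) = conjc (cis y x).
Proof.
rewrite /cis cexpJ; congr cexp.
rewrite -(scaleN1r x) to_cvecZ cdotZr cdot_rdot.
by apply: complex_eq; rewrite !ReImE /=; ring.
Qed.

Lemma cmeas_cis : cmeas (fun p : V * V => cis p.1 p.2).
Proof.
apply: cmeas_cexp; apply: cmeasM; first exact: cmeas_cst.
by apply: cmeas_cdot => j; apply: cmeas_to_cvec; [exact: measurable_fst|exact: measurable_snd].
Qed.

Lemma cmeas_cis2 d (T : measurableType d) (f g : T -> V) :
  measurable_fun setT f -> measurable_fun setT g -> cmeas (fun x => cis (f x) (g x)).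
Proof.
move=> mf mg; apply: (cmeas_comp (phi := fun x => (f x, g x)) _ cmeas_cis).
exact: measurable_fun_pair.
Qed.

(** Unnormalised and with the sign [+i], as it arises from [exp(z.xi)] at [z = x + iy]; hence the
    factor [(2 pi)^m] in [plancherel]. *)
Definition fourier (u : V -> C) (y : V) : C := cintegral mu (fun x => u x * cis y x).

Lemma cmeas_fourier (u : V -> C) : cmeas u -> cmeas (fourier u).
Proof.
move=> mu'; apply: (cmeas_cintegral mu (f := fun p : V * V => u p.2 * cis p.1 p.2)).
by apply: cmeasM; [exact: cmeas_comp measurable_snd mu'|exact: cmeas_cis].
Qed.

Lemma gauss_fourier (c : R) (x : V) : 0 < c ->
  cintegral mu (fun y => (expR (- (c * rnorm2 y)))%:C * cis y x) =
  (Num.sqrt (pi / c) ^+ m * expR (- (rnorm2 x / (4 * c))))%:C.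
Proof.
move=> c0; have := cintegral_rv_cgauss ('i%C *: to_cvec x) c0.
have -> : ((4 * c)^-1)%:C * cdot ('i%C *: to_cvec x) ('i%C *: to_cvec x) =
    (- (rnorm2 x / (4 * c)))%:C.
  rewrite cdotZl cdotZr cdot_to_cvec.
  transitivity (((4 * c)^-1)%:C * ('i%C * 'i%C) * (rnorm2 x)%:C); first by ring.
  by rewrite -expr2 sqr_i realcN realcM; ring.
rewrite cexp_realc -realcM => <-; apply: eq_cintegral => y.
by rewrite cexpD -realcN cexp_realc cdotZl cisC.
Qed.

Section square.
Variable u : V -> C.
Hypothesis iu : cintegrable mu u.
Hypothesis u2 : (\int[mu]_x (sqmod (u x))%:E < +oo)%E.

Let mu' : cmeas u. Proof. exact: cintegrable_cmeas iu. Qed.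

Let iuc (y : V) : cintegrable mu (fun x => u x * cis y x).
Proof.
apply: (cintegrable_le _ (integrable_normc iu)).
  by apply: cmeasM => //; apply: cmeas_cis2.
by move=> x; rewrite normcM normc_cis mulr1.
Qed.

Let K := 2 * \int[mu]_x normc (u x).

Let K0 : 0 <= K.
Proof. by rewrite mulr_ge0// Rintegral_ge0// => x _; exact: normc_ge0. Qed.

Let fourier_bounded (y : V) : normc (fourier u y) <= K.
Proof.
apply: le_normc_cintegral => //.
- by have [? ?] := cintegrable_cmeas (iuc y).
- exact: integrable_normc iu.
- by move=> x; rewrite normcM normc_cis mulr1.
Qed.

Let sq_integrable (c : R) : 0 < c -> mu.-integrable setT
  (fun y => (sqmod (fourier u y) * expR (- (c * rnorm2 y)))%:E).
Proof.
move=> c0; have := integrable_rv_gauss m 0 c0.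
under eq_fun do rewrite mul0r addr0; move=> ig.
apply: (le_integrable _ _ _ (integrableZl measurableT (K ^+ 2) ig)) => //.
  apply/measurable_EFinP; apply: measurable_funM.
    exact/measurable_sqmod/cmeas_fourier.
  exact: measurable_expR_rnorm2.
move=> y _; rewrite lee_fin [leLHS]ger0_norm ?mulr_ge0 ?sqmod_ge0 ?expR_ge0//.
rewrite [leRHS]ger0_norm; last by rewrite mulr_ge0 ?sqr_ge0 ?expR_ge0.
by rewrite ler_wpM2r ?expR_ge0// sqmod_normc ler_sqr ?nnegrE ?normc_ge0.
Qed.

Let measurable_diff : measurable_fun setT (fun p : V * V => p.1 - p.2).
Proof.
apply: measurable_rvD; first exact: measurable_fst.
rewrite (_ : (fun x : V * V => - x.2) = (fun x => (-1) *: x.2)).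
  exact: (measurableT_comp (measurable_rvZ _) measurable_snd).
by apply/funext => x; rewrite scaleN1r.
Qed.

Let integrable_sqmod : mu.-integrable setT (fun x => (sqmod (u x))%:E).
Proof.
apply/integrableP; split; first exact/measurable_EFinP/measurable_sqmod.
by under eq_integral do rewrite /= ger0_norm ?sqmod_ge0//.
Qed.

Let I := \int[mu]_x sqmod (u x).
Let Z : R := Num.sqrt pi ^+ m.

Let IE : (\int[mu]_x (sqmod (u x))%:E)%E = I%:E.
Proof. by rewrite fineK//; exact: integrable_fin_num. Qed.

Let weight1 : (\int[mu \x mu]_p (sqmod (u p.1) * expR (- rnorm2 p.2))%:E)%E = (Z * I)%:E.
Proof.
have := integral_weight1 (f := fun x => (sqmod (u x))%:E).
rewrite IE -EFinM mulrC => <- //; first exact/measurable_EFinP/measurable_sqmod.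
by move=> x; rewrite lee_fin sqmod_ge0.
Qed.

Let msq : measurable_fun setT (fun p : V * V => sqmod (u p.1) * expR (- rnorm2 p.2)).
Proof.
apply: measurable_funM; first exact: (measurableT_comp (measurable_sqmod mu') measurable_fst).
have := @measurable_expR_rnorm2 R _ _ m 1 _ (@measurable_snd _ _ V V).
by under eq_fun do rewrite mul1r.
Qed.

Let weight2 (s : R) :
  (\int[mu \x mu]_p (sqmod (u (p.1 + s *: p.2)%R) * expR (- rnorm2 p.2))%:E)%E = (Z * I)%:E.
Proof.
rewrite -weight1.
have := integral_shift2 (f := fun p => (sqmod (u p.1) * expR (- rnorm2 p.2))%:E) s.
apply; first exact/measurable_EFinP.
by move=> p; rewrite lee_fin mulr_ge0 ?sqmod_ge0 ?expR_ge0.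
Qed.

Let msq2 (s : R) : measurable_fun setT
  (fun p : V * V => sqmod (u (p.1 + s *: p.2)) * expR (- rnorm2 p.2)).
Proof.
apply: (measurableT_comp (f := fun p : V * V => sqmod (u p.1) * expR (- rnorm2 p.2))
  (g := fun p : V * V => (p.1 + s *: p.2, p.2))) => //.
by apply: measurable_fun_pair => /=; [exact: measurable_shift|exact: measurable_snd].
Qed.

Let ge0_integrable d (T : measurableType d) (nu : {measure set T -> \bar R}) (f : T -> R) r :
  measurable_fun setT f -> (forall x, 0 <= f x) ->
  (\int[nu]_x (f x)%:E = r%:E)%E -> nu.-integrable setT (fun x => (f x)%:E).
Proof.
move=> mf f0 fr; apply/integrableP; split; first exact/measurable_EFinP.
by under eq_integral do rewrite /= ger0_norm//; rewrite fr ltry.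
Qed.

Let iw1 : (mu \x mu)%E.-integrable setT
  (fun p => (sqmod (u p.1) * expR (- rnorm2 p.2))%:E).
Proof.
by apply: (ge0_integrable msq _ weight1) => p; rewrite mulr_ge0 ?sqmod_ge0 ?expR_ge0.
Qed.

Let iw2 (s : R) : (mu \x mu)%E.-integrable setT
  (fun p => (sqmod (u (p.1 + s *: p.2)%R) * expR (- rnorm2 p.2))%:E).
Proof.
by apply: (ge0_integrable (msq2 s) _ (weight2 s)) => p; rewrite mulr_ge0 ?sqmod_ge0 ?expR_ge0.
Qed.

(** What remains of [u(x) conj(u(x')) exp(-|x - x'|^2/s^2)] after substituting [x' = x + s tau],
    apart from the Jacobian [s^m]. *)
Let L (s : R) (p : V * V) : C :=
  u p.1 * conjc (u (p.1 + s *: p.2)) * (expR (- rnorm2 p.2))%:C.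

Let iL (s : R) : cintegrable (mu \x mu)%E (L s).
Proof.
apply: (cintegrable_le _ (integrableD measurableT iw1 (iw2 s))) => [|p].
  apply: cmeasM.
    apply: cmeasM; first exact: cmeas_comp measurable_fst mu'.
    apply: cmeasJ; apply: (cmeas_comp (phi := fun p : V * V => p.1 + s *: p.2) _ mu').
    exact: measurable_shift.
  apply: cmeas_real.
  have := @measurable_expR_rnorm2 R _ _ m 1 _ (@measurable_snd _ _ V V).
  by under eq_fun do rewrite mul1r.
rewrite /L normcM normc_realc ger0_norm ?expR_ge0// -mulrDl ler_wpM2r ?expR_ge0//.
rewrite normcM normcJ !sqmod_normc.
have h := sqr_ge0 (normc (u p.1) - normc (u (p.1 + s *: p.2))).
have h1 := sqr_ge0 (normc (u p.1)); have h2 := sqr_ge0 (normc (u (p.1 + s *: p.2))).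
by move: h; rewrite sqrrB; move: h1 h2; lra.
Qed.

Let shift_dist_fin (v : V -> R) s : measurable_fun setT v ->
  (forall x, v x ^+ 2 <= sqmod (u x)) -> shift_dist v s \is a fin_num.
Proof.
move=> mv vu; rewrite ge0_fin_numE ?shift_dist_ge0//.
apply: (le_lt_trans (shift_dist_le s mv)).
rewrite lte_mul_pinfty ?lee_fin ?mulr_ge0 ?exprn_ge0 ?sqrtr_ge0//.
apply: le_lt_trans u2; apply: ge0_le_integral => //.
- by move=> x _; rewrite lee_fin sqr_ge0.
- exact/measurable_EFinP/measurable_funX.
- exact/measurable_EFinP/measurable_sqmod.
- by move=> x _; rewrite lee_fin; exact: vu.
Qed.

(** From [2 Re(a conj b) = |a|^2 + |b|^2 - |a - b|^2] with [a = u(x)] and [b = u(x + s tau)]: the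
    first two terms integrate to [Z I] each, and the third to the distances of the real and
    imaginary parts. *)
Let ReL (s : R) : Re (cintegral (mu \x mu)%E (L s)) =
  Z * I - 2^-1 * (fine (shift_dist (fun x => Re (u x)) s) +
                  fine (shift_dist (fun x => Im (u x)) s)).
Proof.
have [mr mi] := mu'.
pose dR (p : V * V) := (Re (u p.1) - Re (u (p.1 + s *: p.2))) ^+ 2 * expR (- rnorm2 p.2).
pose dI (p : V * V) := (Im (u p.1) - Im (u (p.1 + s *: p.2))) ^+ 2 * expR (- rnorm2 p.2).
have fR : shift_dist (fun x => Re (u x)) s \is a fin_num.
  by apply: shift_dist_fin => // x; rewrite /sqmod lerDl sqr_ge0.
have fI : shift_dist (fun x => Im (u x)) s \is a fin_num.
  by apply: shift_dist_fin => // x; rewrite /sqmod lerDr sqr_ge0.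
have iR : (mu \x mu)%E.-integrable setT (fun p => (dR p)%:E).
  apply: (ge0_integrable (r := fine (shift_dist (fun x => Re (u x)) s))).
  - exact: (measurable_shift_dist s mr).
  - by move=> p; rewrite mulr_ge0 ?sqr_ge0 ?expR_ge0.
  - by rewrite fineK.
have iI : (mu \x mu)%E.-integrable setT (fun p => (dI p)%:E).
  apply: (ge0_integrable (r := fine (shift_dist (fun x => Im (u x)) s))).
  - exact: (measurable_shift_dist s mi).
  - by move=> p; rewrite mulr_ge0 ?sqr_ge0 ?expR_ge0.
  - by rewrite fineK.
pose w1 (p : V * V) := sqmod (u p.1) * expR (- rnorm2 p.2).
pose w2 (p : V * V) := sqmod (u (p.1 + s *: p.2)) * expR (- rnorm2 p.2).
have E p : Re (L s p) = 2^-1 * ((w1 p + w2 p) - (dR p + dI p)).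
  by rewrite /L /w1 /w2 /dR /dI /sqmod !ReImE /=; field.
rewrite /cintegral /=; under eq_Rintegral do rewrite E.
have i12 := integrableD measurableT iw1 (iw2 s).
have iRI := integrableD measurableT iR iI.
rewrite RintegralZl//; last exact: (integrableB measurableT i12 iRI).
rewrite RintegralB// RintegralD//; last exact: iw2.
rewrite (RintegralD _ iR iI)//.
have -> : \int[(mu \x mu)%E]_p w1 p = Z * I by rewrite /Rintegral weight1.
have -> : \int[(mu \x mu)%E]_p w2 p = Z * I by rewrite /Rintegral weight2.
by rewrite /Rintegral -/(shift_dist _ _); field.
Qed.

(* Fubini turns the damped integral of [|fourier u|^2] into a Gaussian average of
   [u(x) conj(u(x + s t))], whose real part is polarised. *)
Let fourier_damped (s : R) : 0 < s ->
  \int[mu]_y (sqmod (fourier u y) * expR (- (s ^+ 2 / 4 * rnorm2 y))) =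
  Num.sqrt (4 * pi) ^+ m * Re (cintegral (mu \x mu)%E (L s)).
Proof.
move=> s0; have c0 : 0 < s ^+ 2 / 4 by rewrite divr_gt0// exprn_gt0.
pose c := s ^+ 2 / 4; pose g (y : V) := expR (- (c * rnorm2 y)).
have ig : cintegrable mu (fun y => (g y)%:C).
  have := integrable_rv_gauss m 0 c0.
  under eq_fun do rewrite mul0r addr0; move=> ig.
  by split => //; exact: integrable0.
have mg : cmeas (fun y => (g y)%:C) := cintegrable_cmeas ig.
have iuu : cintegrable (mu \x mu)%E (fun p => u p.1 * conjc (u p.2)).
  exact: (cintegrable_tensor iu (cintegrableJ iu)).
pose k := Num.sqrt (pi / c) ^+ m.
pose H (p : V * V) : C :=
  u p.1 * conjc (u p.2) * (expR (- (rnorm2 (p.1 - p.2) / s ^+ 2)))%:C.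
have mH : cmeas H.
  apply: cmeasM; first exact: (cintegrable_cmeas iuu).
  apply: cmeas_real; apply: (measurableT_comp (@measurable_expR R)).
  apply: measurableT_comp => //; apply: measurable_funM => //.
  exact: measurable_rnorm2.
have iH : cintegrable (mu \x mu)%E H.
  apply: (cintegrable_le mH (integrable_normc iuu)) => p.
  rewrite normcM normc_realc ger0_norm ?expR_ge0// ler_piMr ?normc_ge0//.
  by rewrite -[leRHS]expR0 ler_expR oppr_le0 divr_ge0 ?rnorm2_ge0 ?sqr_ge0.
(* Only the conjugate factor of [|fourier u|^2] is expanded here; the other one stays whole and is
   bounded by [K]. It is expanded in [Q] for fixed [eta], so Fubini is only ever applied to two
   variables at a time. *)
pose P (q : V * V) : C :=
  fourier u q.1 * (conjc (u q.2) * conjc (cis q.1 q.2)) * (g q.1)%:C.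
have mP : cmeas P.
  apply: cmeasM; last exact: cmeas_comp measurable_fst mg.
  apply: cmeasM.
    exact: cmeas_comp measurable_fst (cmeas_fourier mu').
  apply: cmeasM; first exact/cmeasJ/(cmeas_comp measurable_snd mu').
  exact/cmeasJ/cmeas_cis.
have iP : cintegrable (mu \x mu)%E P.
  apply: (cintegrable_le mP (integrableZl measurableT K
    (integrable_tensor (integrable_normc ig) (integrable_normc iu)))) => q.
  rewrite /P !normcM !normcJ normc_cis mulr1 /=.
  rewrite [X in _ <= K * X]mulrC mulrA ler_wpM2r ?normc_ge0//.
  by rewrite ler_wpM2r ?normc_ge0// fourier_bounded.
pose Q (eta : V) (q : V * V) : C :=
  u q.2 * (cis q.1 q.2 * conjc (cis q.1 eta)) * (g q.1)%:C.
have iQ eta : cintegrable (mu \x mu)%E (Q eta).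
  apply: (cintegrable_le _ (integrable_tensor (integrable_normc ig) (integrable_normc iu))).
    apply: cmeasM; last exact: cmeas_comp measurable_fst mg.
    apply: cmeasM; first exact: cmeas_comp measurable_snd mu'.
    apply: cmeasM; first exact: cmeas_cis.
    by apply: cmeasJ; apply: cmeas_cis2; [exact: measurable_fst|exact: measurable_cst].
  by move=> q; rewrite /Q normcM (normcM (u _)) (normcM (cis _ _)) normcJ !normc_cis !mulr1 mulrC.
transitivity (Re (cintegral mu (fun y => (sqmod (fourier u y) * g y)%:C))).
  by rewrite cintegral_real.
rewrite (@eq_cintegral _ _ _ mu _ (fun y => cintegral mu (fun x => P (y, x)))); last first.
  move=> y; rewrite realcM -mulc_conj /fourier -cintegralJ// mulrC mulrA.
  rewrite -cintegralZl; last exact: cintegrableJ.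
  by apply: eq_cintegral => x; rewrite /P /fourier rmorphM /=; ring.
rewrite (cintegral12 iP) -(cintegral21 iP).
rewrite (@eq_cintegral _ _ _ mu _ (fun eta => k%:C * cintegral mu (fun x => H (x, eta)))); last first.
  move=> eta.
  transitivity (conjc (u eta) * cintegral mu (fun y => cintegral mu (fun x => Q eta (y, x)))).
    rewrite -cintegralZl.
      apply: eq_cintegral => y.
      have -> : cintegral mu (fun x => Q eta (y, x)) =
          conjc (cis y eta) * (g y)%:C * fourier u y.
        by rewrite /fourier -cintegralZl//; apply: eq_cintegral => x; rewrite /Q /=; ring.
      by rewrite /P /=; ring.
    exact: (cintegrable_fubini1 (iQ eta)).
  rewrite (cintegral12 (iQ eta)) -(cintegral21 (iQ eta)) -!cintegralZl.
  - apply: eq_cintegral => x.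
    have QE y : Q eta (y, x) = u x * (cis y x * conjc (cis y eta)) * (g y)%:C by [].
    rewrite (eq_cintegral _ QE) /H.
    transitivity (conjc (u eta) * (u x * (k * expR (- (rnorm2 (x - eta) / s ^+ 2)))%:C)).
      congr (_ * _).
      have -> : s ^+ 2 = 4 * c by rewrite /c; field.
      rewrite /k -gauss_fourier// -cintegralZl.
        by apply: eq_cintegral => y; rewrite /g cisDr cisN; ring.
      apply: (cintegrable_le _ (integrable_normc ig)) => [|y].
        by apply: cmeasM => //; exact: cmeas_cis2.
      by rewrite normcM normc_cis mulr1.
    by rewrite realcM; ring.
  - apply: (cintegrable_le _ (integrable_normc (cintegrableZl (conjc (u eta)) iu))) => [|x].
      exact: (cmeas_comp (measurable_pair2 eta) mH).
    rewrite /H normcM normc_realc ger0_norm ?expR_ge0// [u x * _]mulrC.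
    rewrite ler_piMr ?normc_ge0// -[leRHS]expR0 ler_expR oppr_le0.
    by rewrite divr_ge0 ?rnorm2_ge0 ?sqr_ge0.
  - exact: (cintegrable_fubini2 (iQ eta)).
rewrite cintegralZl; last exact: (cintegrable_fubini2 iH).
(* For fixed [x], the affine substitution [tau |-> s tau + x] in the second variable. *)
have key : cintegral (mu \x mu)%E H = (s ^+ m)%:C * cintegral (mu \x mu)%E (L s).
  rewrite -(cintegral12 iH) -(cintegral12 (iL s)) -cintegralZl; last first.
    exact: (cintegrable_fubini1 (iL s)).
  apply: eq_cintegral => x.
  have := cintegral_rv_affine x s0 (cmeas_comp (measurable_pair1 x) mH).
  rewrite (@eq_cintegral _ _ _ mu _ (fun y => L s (x, y))) => [->|y].
    rewrite mulrA -realcM -exprMn divff ?gt_eqF// expr1n mul1r.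
    exact: eq_cintegral.
  rewrite /H /L /= (addrC _ x) opprD addrA subrr sub0r rnorm2N rnorm2Z.
  congr (_ * (expR (- _))%:C).
  by rewrite mulrAC divff ?mul1r// sqrf_eq0 gt_eqF.
rewrite (cintegral21 iH) key mulrA -realcM; set J := cintegral _ _.
rewrite ReM [Im _%:C]/= mul0r subr0 [Re _%:C]/=; congr (_ * _).
rewrite /k -exprMn; congr (_ ^+ _).
(* The powers of [s] cancel: [k s^m = sqrt(4 pi)^m]. *)
have -> : pi / c = (4 * pi) * s^-1 ^+ 2.
  by rewrite /c; field; rewrite gt_eqF.
rewrite sqrtrM ?mulr_ge0 ?pi_ge0// sqrtr_sqr ger0_norm ?invr_ge0 ?ltW//.
by rewrite divfK// gt_eqF.
Qed.

(** The damping factors increase to 1, so monotone convergence identifies the limit on the left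
    before it is known to be finite. On the right the shift distances vanish in the limit, which
    leaves [sqrt(4 pi)^m Z I], and [4 pi * pi = (2 pi)^2]. *)
Lemma plancherel : (\int[mu]_y (sqmod (fourier u y))%:E =
  ((2 * pi) ^+ m)%:E * \int[mu]_x (sqmod (u x))%:E)%E.
Proof.
have [mr mi] := mu'.
pose s (k : nat) : R := k.+1%:R^-1.
have s0 k : 0 < s k by rewrite invr_gt0.
pose f k y := (sqmod (fourier u y) * expR (- (s k ^+ 2 / 4 * rnorm2 y)))%:E.
have mf k : measurable_fun setT (f k).
  apply/measurable_EFinP; apply: measurable_funM.
    exact/measurable_sqmod/cmeas_fourier.
  exact: measurable_expR_rnorm2.
have f0 k y : setT y -> (0 <= f k y)%E.
  by move=> _; rewrite lee_fin mulr_ge0 ?sqmod_ge0 ?expR_ge0.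
have ndf y : setT y -> nondecreasing_seq (f ^~ y).
  move=> _ a b ab; rewrite lee_fin ler_wpM2l ?sqmod_ge0// ler_expR lerN2.
  rewrite ler_wpM2r ?rnorm2_ge0// ler_wpM2r// ler_sqr ?nnegrE ?(ltW (s0 _))//.
  by rewrite /s lef_pV2 ?posrE// ler_nat.
have scvg : s k @[k --> \oo] --> (0 : R) by exact: cvg_harmonic.
have fcvg y : (f ^~ y) k @[k --> \oo] --> (sqmod (fourier u y))%:E.
  have h : - (s k ^+ 2 / 4 * rnorm2 y) @[k --> \oo] --> (0 : R).
    rewrite -[X in _ --> X]oppr0; apply: cvgN.
    rewrite -[X in _ --> X](mul0r (rnorm2 y)); apply: cvgMl.
    rewrite -[X in _ --> X](mul0r (4^-1)); apply: cvgMl.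
    rewrite -[X in _ --> X](mul0r 0); under eq_fun do rewrite expr2.
    exact: cvgM.
  have {}h : expR (- (s k ^+ 2 / 4 * rnorm2 y)) @[k --> \oo] --> expR (0 : R).
    by apply: continuous_cvg => //; exact: continuous_expR.
  rewrite expR0 in h.
  apply: cvg_EFin; first exact: nearW.
  by rewrite /comp /= -[X in _ --> X]mulr1; apply: cvgMr.
have lim1 : (\int[mu]_y f k y)%E @[k --> \oo] --> (\int[mu]_y (sqmod (fourier u y))%:E)%E.
  have <- : (\int[mu]_y limn (f ^~ y) = \int[mu]_y (sqmod (fourier u y))%:E)%E.
    by apply: eq_integral => y _; apply/cvg_lim => //; exact: fcvg.
  exact: cvg_monotone_convergence.
pose w k := fine (shift_dist (fun x => Re (u x)) (s k)) +
            fine (shift_dist (fun x => Im (u x)) (s k)).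
pose K1 : R := Num.sqrt (4 * pi) ^+ m.
have fE k : (\int[mu]_y f k y)%E = (K1 * (Z * I - 2^-1 * w k))%:E.
  have c0 : 0 < s k ^+ 2 / 4 by rewrite divr_gt0// exprn_gt0.
  rewrite -[LHS]fineK; last exact: integrable_fin_num (sq_integrable c0).
  by congr EFin; rewrite -[LHS]/(Rintegral _ _ _) fourier_damped// ReL.
have rR : (\int[mu]_x (Re (u x) ^+ 2)%:E < +oo)%E.
  apply: le_lt_trans u2; apply: ge0_le_integral => //.
  - by move=> x _; rewrite lee_fin sqr_ge0.
  - exact/measurable_EFinP/measurable_funX.
  - exact/measurable_EFinP/measurable_sqmod.
  - by move=> x _; rewrite lee_fin /sqmod lerDl sqr_ge0.
have rI : (\int[mu]_x (Im (u x) ^+ 2)%:E < +oo)%E.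
  apply: le_lt_trans u2; apply: ge0_le_integral => //.
  - by move=> x _; rewrite lee_fin sqr_ge0.
  - exact/measurable_EFinP/measurable_funX.
  - exact/measurable_EFinP/measurable_sqmod.
  - by move=> x _; rewrite lee_fin /sqmod lerDr sqr_ge0.
have fR k : shift_dist (fun x => Re (u x)) (s k) \is a fin_num.
  by apply: shift_dist_fin => // x; rewrite /sqmod lerDl sqr_ge0.
have fI k : shift_dist (fun x => Im (u x)) (s k) \is a fin_num.
  by apply: shift_dist_fin => // x; rewrite /sqmod lerDr sqr_ge0.
have w0 : w k @[k --> \oo] --> (0 : R).
  apply/cvgrPdist_le => e e0.
  have := smallD (shift_continuous_L2 mr rR) (shift_continuous_L2 mi rI) => /(_ e e0).
  apply: filterS => k; rewrite sub0r normrN ger0_norm; last first.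
    by rewrite addr_ge0 ?fine_ge0 ?shift_dist_ge0.
  by rewrite -lee_fin EFinD !fineK.
have lim2 : (\int[mu]_y f k y)%E @[k --> \oo] --> (K1 * (Z * I))%:E.
  under eq_fun do rewrite fE.
  apply: cvg_EFin; first exact: nearW.
  rewrite /comp /=; apply: cvgMr; rewrite -[X in _ --> X]subr0.
  apply: cvgB; first exact: cvg_cst.
  by rewrite -[X in _ --> X](mulr0 2^-1); apply: cvgMr.
rewrite (cvg_unique _ lim1 lim2)// IE -EFinM mulrA; congr (_ * _)%:E.
rewrite /K1 /Z -exprMn -sqrtrM ?mulr_ge0 ?pi_ge0//; congr (_ ^+ _).
have -> : 4 * pi * pi = (2 * pi) ^+ 2 :> R by ring.
by rewrite sqrtr_sqr ger0_norm// mulr_ge0 ?pi_ge0.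
Qed.

End square.
End plancherel.

(** * The Gaussian transform *)

Section gaussian_transform.
Variables (R : realType) (m : nat).
Local Notation C := R[i].
Local Notation V := 'rV[R]_m.
Local Notation mu := (lebesgue_rv R m).
Implicit Types (h f g : V -> C) (x y : V) (z : 'rV[C]_m).

Lemma in_L2_cmeas h : in_L2 h -> cmeas h.
Proof. by case. Qed.

Lemma L2_integrable_sqmod h : in_L2 h -> mu.-integrable setT (fun x => (sqmod (h x))%:E).
Proof.
move=> [mr mi h2]; apply/integrableP; split.
  by apply/measurable_EFinP; exact: measurable_sqmod.
by under eq_integral do rewrite /= ger0_norm ?sqmod_ge0//.
Qed.

Lemma le_normcM_sq (a b : C) : normc (a * b) <= sqmod a + sqmod b.
Proof.
rewrite normcM !sqmod_normc.
have := sqr_ge0 (normc a - normc b); rewrite sqrrB.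
by have := sqr_ge0 (normc a); have := sqr_ge0 (normc b); lra.
Qed.

Lemma L2M_cintegrable f g : in_L2 f -> in_L2 g -> cintegrable mu (fun x => f x * g x).
Proof.
move=> lf lg; apply: (cintegrable_le _
  (integrableD measurableT (L2_integrable_sqmod lf) (L2_integrable_sqmod lg))).
  by apply: cmeasM; exact: in_L2_cmeas.
by move=> x; exact: le_normcM_sq.
Qed.

Lemma in_L2J h : in_L2 h -> in_L2 (fun x => conjc (h x)).
Proof.
move=> lh; have [mr mi] := cmeasJ (in_L2_cmeas lh); split => //.
by under eq_integral do rewrite sqmodJ; case: lh.
Qed.

Lemma in_L2Z (k : C) h : in_L2 h -> in_L2 (fun x => k * h x).
Proof.
move=> lh; have [mr mi] := cmeasM (cmeas_cst _ k) (in_L2_cmeas lh); split => //.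
under eq_integral do rewrite sqmodM EFinM.
case: lh => [? ? h2]; rewrite ge0_integralZl//.
- by rewrite lte_mul_pinfty// ?lee_fin ?sqmod_ge0.
- by apply/measurable_EFinP; exact: measurable_sqmod.
- by move=> x _; rewrite lee_fin sqmod_ge0.
- by rewrite lee_fin sqmod_ge0.
Qed.

Lemma in_L2D f g : in_L2 f -> in_L2 g -> in_L2 (fun x => f x + g x).
Proof.
move=> lf lg; have [mr mi] := cmeasD (in_L2_cmeas lf) (in_L2_cmeas lg); split => //.
have i1 := integrableZl measurableT 2 (L2_integrable_sqmod lf).
have i2 := integrableZl measurableT 2 (L2_integrable_sqmod lg).
have /integrableP[mD] := integrableD measurableT i1 i2.
apply: le_lt_trans; apply: ge0_le_integral => //.
- by move=> x _; rewrite lee_fin sqmod_ge0.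
- by apply/measurable_EFinP; exact: measurable_sqmod.
- exact: measurableT_comp.
move=> x _ /=; rewrite lee_fin ger0_norm; first exact: sqmodD_le.
by rewrite addr_ge0 ?mulr_ge0 ?sqmod_ge0.
Qed.

Lemma in_L2N h : in_L2 h -> in_L2 (fun x => - h x).
Proof. by move=> lh; under eq_fun do rewrite -mulN1r; exact: in_L2Z. Qed.

Lemma in_L2B f g : in_L2 f -> in_L2 g -> in_L2 (fun x => f x - g x).
Proof. by move=> lf lg; apply: in_L2D => //; exact: in_L2N. Qed.

Lemma in_L2_gauss (c r : R) h : 0 < c -> cmeas h ->
  (forall x, normc (h x) <= expR (- (c * rnorm2 x) + r * rv_l1 x)) -> in_L2 h.
Proof.
move=> c0 mh hb; have [mr mi] := mh; split => //.
have c2 : 0 < 2 * c by rewrite mulr_gt0.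
have /integrableP[mD] := integrable_rv_gauss m (2 * r) c2.
apply: le_lt_trans; apply: ge0_le_integral => //.
- by move=> x _; rewrite lee_fin sqmod_ge0.
- by apply/measurable_EFinP; exact: measurable_sqmod.
- exact: measurableT_comp.
move=> x _; rewrite lee_fin ger0_norm ?expR_ge0// sqmod_normc.
have -> : - (2 * c * rnorm2 x) + 2 * r * rv_l1 x =
  (- (c * rnorm2 x) + r * rv_l1 x) + (- (c * rnorm2 x) + r * rv_l1 x) by ring.
by rewrite expRD -expr2 ler_sqr ?nnegrE ?normc_ge0 ?expR_ge0.
Qed.

Lemma le_Re_cdot (z : 'rV[C]_m) x :
  exists2 r, 0 <= r & forall x, `|Re (cdot z (to_cvec x))| <= r * rv_l1 x.
Proof.
exists (\sum_j normc (z 0 j)); first by apply: sumr_ge0 => j _; exact: normc_ge0.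
move=> {}x; rewrite Re_cdot_real (le_trans (ler_norm_sum _ _ _))//.
rewrite /rv_l1 mulr_sumr; apply: ler_sum => j _; rewrite normrM ler_wpM2r//.
apply: (le_trans (le_Re_normc _)).
by rewrite (bigD1 j)//= lerDl sumr_ge0// => i _; exact: normc_ge0.
Qed.

Definition gint h z : C :=
  cintegral mu (fun x => h x * (cexp (- (2^-1 * rnorm2 x)%:C + cdot z (to_cvec x)))).

Lemma cmeas_gint_kernel z :
  cmeas (fun x : V => cexp (- (2^-1 * rnorm2 x)%:C + cdot z (to_cvec x))).
Proof.
apply: cmeas_cexp; apply: cmeasD.
  apply: cmeasN; apply: cmeas_real; apply: measurable_funM => //.
  exact: measurable_rnorm2.
apply: cmeas_cdot => j; first exact: cmeas_cst.
by apply: cmeas_to_cvec; exact: measurable_id.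
Qed.

Lemma in_L2_gint_kernel z :
  in_L2 (fun x : V => cexp (- (2^-1 * rnorm2 x)%:C + cdot z (to_cvec x))).
Proof.
have [r r0 hr] := le_Re_cdot z 0.
apply: (@in_L2_gauss 2^-1 r) => //; first exact: cmeas_gint_kernel.
move=> x; rewrite normc_cexp !ReImE ler_expR lerD2l.
exact: le_trans (ler_norm _) (hr x).
Qed.

Lemma cintegrable_gint h z : in_L2 h -> cintegrable mu
  (fun x => h x * (cexp (- (2^-1 * rnorm2 x)%:C + cdot z (to_cvec x)))).
Proof. by move=> lh; apply: L2M_cintegrable => //; exact: in_L2_gint_kernel. Qed.

Lemma gintD f g z : in_L2 f -> in_L2 g ->
  gint (fun x => f x + g x) z = gint f z + gint g z.
Proof.
move=> lf lg; rewrite /gint -cintegralD; [|exact: cintegrable_gint..].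
by apply: eq_cintegral => x; rewrite mulrDl.
Qed.

Lemma gintZ (k : C) h z : in_L2 h -> gint (fun x => k * h x) z = k * gint h z.
Proof.
move=> lh; rewrite /gint -cintegralZl; last exact: cintegrable_gint.
by apply: eq_cintegral => x; rewrite mulrA.
Qed.

Lemma cpoint_cdot (p : V * V) x :
  cdot (cpoint p) (to_cvec x) = (rdot p.1 x)%:C + 'i%C * (rdot p.2 x)%:C.
Proof.
apply: complex_eq; rewrite !ReImE /=.
  rewrite Re_cdot_real /rdot; under eq_bigr do rewrite mxE /=.
  by ring.
rewrite /cdot Im_sum /rdot; under eq_bigr do rewrite !mxE ImM /= mulr0 add0r.
by ring.
Qed.

Lemma Re_cpoint_sq (p : V * V) :
  Re (cdot (cpoint p) (cpoint p)) = rnorm2 p.1 - rnorm2 p.2.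
Proof.
rewrite /cdot Re_sum /rnorm2 -sumrB; apply: eq_bigr => j _.
by rewrite ReM !mxE /= -!expr2.
Qed.

Lemma cnorm2_cpoint (p : V * V) : cnorm2 (cpoint p) = rnorm2 p.1 + rnorm2 p.2.
Proof.
rewrite /cnorm2 /cdot Re_sum /rnorm2 -big_split; apply: eq_bigr => j _.
by rewrite /cconj !mxE ReM /=; ring.
Qed.

Lemma rnorm2B x y : rnorm2 (x - y) = rnorm2 x - 2 * rdot x y + rnorm2 y.
Proof.
rewrite /rnorm2 /rdot mulr_sumr -sumrB -big_split; apply: eq_bigr => j _ /=.
by rewrite !mxE; ring.
Qed.

Lemma cmeas_cpoint d (T : measurableType d) (a b : T -> V) j :
  measurable_fun setT a -> measurable_fun setT b ->
  cmeas (fun t => cpoint (a t, b t) 0 j).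
Proof.
move=> ma mb; split; under eq_fun do rewrite mxE /=.
- exact: (measurableT_comp (measurable_rv_coord j) ma).
- exact: (measurableT_comp (measurable_rv_coord j) mb).
Qed.

Lemma cmeas_gint h : cmeas h -> cmeas (fun p : V * V => gint h (cpoint p)).
Proof.
move=> mh; apply: (cmeas_cintegral mu (f := fun q : (V * V) * V =>
  h q.2 * cexp (- (2^-1 * rnorm2 q.2)%:C + cdot (cpoint q.1) (to_cvec q.2)))).
apply: cmeasM; first exact: cmeas_comp measurable_snd mh.
apply: cmeas_cexp; apply: cmeasD.
  apply: cmeasN; apply: cmeas_real; apply: measurable_funM => //.
  by apply: measurable_rnorm2; exact: measurable_snd.
apply: cmeas_cdot => j; last by apply: cmeas_to_cvec; exact: measurable_snd.
under eq_fun => q do rewrite [q.1]surjective_pairing.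
apply: cmeas_cpoint.
- exact: (measurableT_comp measurable_fst measurable_fst).
- exact: (measurableT_comp measurable_snd measurable_fst).
Qed.

(* For fixed [x] this is Plancherel's identity in [y] for
   [h(xi) exp (- |xi|^2 / 2 + x.xi)]. *)
Lemma gint_isometry h : in_L2 h ->
  (\int[mu \x mu]_p (expR (- rnorm2 p.1) * sqmod (gint h (cpoint p)))%:E =
   ((2 * pi) ^+ m * Num.sqrt pi ^+ m)%:E * \int[mu]_x (sqmod (h x))%:E)%E.
Proof.
move=> lh; have mh := in_L2_cmeas lh.
have mE1 : measurable_fun setT (fun p : V * V => expR (- rnorm2 p.1)).
  have := @measurable_expR_rnorm2 R _ _ m 1 _ (@measurable_fst _ _ V V).
  by under eq_fun do rewrite mul1r.
rewrite fubini_tonelli1; last 2 first.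
- apply/measurable_EFinP; apply: measurable_funM => //.
  by apply: measurable_sqmod; exact: cmeas_gint.
- by move=> p; rewrite lee_fin mulr_ge0 ?sqmod_ge0 ?expR_ge0.
(* Completing the square: the weight [exp(-|x|^2)] times the squared modulus of the function
   transformed in [y]. Its integral over [x] supplies the factor [sqrt(pi)^m]. *)
pose ker (q : V * V) := sqmod (h q.2) * expR (- (1 * rnorm2 (q.2 - q.1))).
have ker0 q : 0 <= ker q by rewrite mulr_ge0 ?sqmod_ge0 ?expR_ge0.
have mdiff : measurable_fun setT (fun q : V * V => q.2 - q.1).
  rewrite (_ : (fun q => _) = (fun q : V * V => q.2 + (-1) *: q.1)).
    apply: measurable_rvD; first exact: measurable_snd.
    exact: (measurableT_comp (measurable_rvZ _) measurable_fst).
  by apply/funext => q; rewrite scaleN1r.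
have mker : measurable_fun setT ker.
  apply: measurable_funM.
    exact: (measurableT_comp (measurable_sqmod mh) measurable_snd).
  exact: measurable_expR_rnorm2.
transitivity (\int[mu]_x (((2 * pi) ^+ m)%:E * \int[mu]_xi (ker (x, xi))%:E))%E.
  apply: eq_integral => x _; rewrite /fubini_F /=.
  pose u xi := h xi * cexp (- (2^-1 * rnorm2 xi)%:C + cdot (to_cvec x) (to_cvec xi)).
  have gE y : gint h (cpoint (x, y)) = fourier u y.
    apply: eq_cintegral => xi.
    by rewrite /u cpoint_cdot addrA cexpD mulrA /cis !cdot_rdot.
  have sqE xi : expR (- rnorm2 x) * sqmod (u xi) = ker (x, xi).
    rewrite /u /ker sqmodM sqmod_cexp cdot_rdot !ReImE /= mulrCA -expRD mul1r.
    congr (_ * expR _); rewrite rnorm2B.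
    have -> : rdot x xi = rdot xi x by apply: eq_bigr => j _; rewrite mulrC.
    by field.
  have iu : cintegrable mu u by exact: cintegrable_gint.
  have mu2 : measurable_fun setT (fun xi => (sqmod (u xi))%:E).
    apply/measurable_EFinP; exact: measurable_sqmod (cintegrable_cmeas iu).
  have u2 : (\int[mu]_xi (sqmod (u xi))%:E < +oo)%E.
    have /integrableP[mD] := integrableZl measurableT (expR (rnorm2 x)) (L2_integrable_sqmod lh).
    apply: le_lt_trans; apply: ge0_le_integral => //.
    - by move=> xi _; rewrite lee_fin sqmod_ge0.
    - exact: measurableT_comp.
    move=> xi _; rewrite lee_fin ger0_norm ?mulr_ge0 ?sqmod_ge0 ?expR_ge0//.
    rewrite -[leLHS]mul1r -(expRxMexpNx_1 (rnorm2 x)) -mulrA sqE ler_wpM2l ?expR_ge0//.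
    rewrite /ker ler_piMr ?sqmod_ge0// -[leRHS]expR0 ler_expR oppr_le0 mul1r.
    exact: rnorm2_ge0.
  under eq_integral do rewrite gE EFinM.
  rewrite ge0_integralZl//; last 2 first.
  - apply/measurable_EFinP; apply: measurable_sqmod; apply: cmeas_fourier.
    exact: (cintegrable_cmeas iu).
  - by move=> y _; rewrite lee_fin sqmod_ge0.
  rewrite plancherel// muleCA; congr (_ * _)%E.
  rewrite -ge0_integralZl//; last by move=> y _; rewrite lee_fin sqmod_ge0.
  by apply: eq_integral => xi _; rewrite -EFinM sqE.
have mkerE : measurable_fun setT (fun q => (ker q)%:E) by exact/measurable_EFinP.
rewrite ge0_integralZl//; last 3 first.
- exact: (measurable_fun_fubini_tonelli_F _ mkerE).
- by move=> x _; apply: integral_ge0 => y _; rewrite lee_fin.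
- by rewrite lee_fin exprn_ge0// mulr_ge0 ?pi_ge0.
rewrite EFinM -muleA; congr (_ * _)%E.
rewrite (fubini_tonelli _ mkerE)//.
rewrite -ge0_integralZl//; last 2 first.
- by apply/measurable_EFinP; exact: measurable_sqmod.
- by move=> x _; rewrite lee_fin sqmod_ge0.
apply: eq_integral => xi _; rewrite /ker /=.
under eq_integral => x _ do rewrite EFinM.
have mk : measurable_fun setT (fun x => (expR (- (1 * rnorm2 (xi - x))))%:E).
  apply/measurable_EFinP; apply: measurable_expR_rnorm2.
  exact: (measurableT_comp mdiff (measurable_pair2 xi)).
rewrite (ge0_integralZl _ measurableT mk) ?lee_fin ?sqmod_ge0//.
rewrite muleC; congr (_ * _)%E.
transitivity (\int[mu]_x (expR (- (1 * rnorm2 (x - xi)%R)))%:E)%E.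
  by apply: eq_integral => x _; rewrite -rnorm2N opprB.
rewrite (integral_rvD (- xi) (f := fun x => (expR (- (1 * rnorm2 x)))%:E)).
- by rewrite integral_rv_gauss// divr1.
- by apply/measurable_EFinP; exact: measurable_expR_rnorm2.
- by move=> x; rewrite lee_fin expR_ge0.
Qed.

End gaussian_transform.

Section complex_integral_sum.
Context d (T : measurableType d) (R : realType) (mu : {measure set T -> \bar R}).

Lemma cintegrable_sum (I : Type) (s : seq I) (f : I -> T -> R[i]) :
  (forall i, cintegrable mu (f i)) -> cintegrable mu (fun x => \sum_(i <- s) f i x).
Proof.
move=> mf; elim: s => [|i s ih].
  by under eq_fun do rewrite big_nil; split; exact: (integrable0 mu setT).
by under eq_fun do rewrite big_cons; exact: cintegrableD.
Qed.

Lemma cintegral_sum (I : Type) (s : seq I) (f : I -> T -> R[i]) :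
  (forall i, cintegrable mu (f i)) ->
  cintegral mu (fun x => \sum_(i <- s) f i x) = \sum_(i <- s) cintegral mu (f i).
Proof.
move=> mf; elim: s => [|i s ih].
  under eq_cintegral do rewrite big_nil.
  by rewrite big_nil; apply: complex_eq; rewrite /cintegral /= /Rintegral integral0.
under eq_cintegral do rewrite big_cons.
by rewrite cintegralD ?ih ?big_cons//; exact: cintegrable_sum.
Qed.

End complex_integral_sum.

(** * Holomorphy of the Gaussian transform *)

Section complex_differentiability.
Variable R : realType.
Local Notation C := R[i].

Lemma normr_sin_le (t : R) : `|sin t| <= `|t|.
Proof.
wlog t0 : t / 0 <= t.
  move=> h; case: (leP 0 t) => [/h //|t0].
  by have := h (- t); rewrite sinN !normrN; apply; rewrite oppr_ge0 ltW.
have [c _] := @MVT_segment R sin cos 0 t t0 (fun x _ => is_derive_sin x)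
  (continuous_subspaceT (@continuous_sin R)).
by rewrite sin0 !subr0 => ->; rewrite normrM ler_piMl// cos_max.
Qed.

Lemma cos_sub1 (t : R) : `|cos t - 1| <= t ^+ 2 / 2.
Proof.
have -> : cos t - 1 = - (2 * sin (t / 2) ^+ 2).
  have h : t / 2 *+ 2 = t by rewrite mulr2n; field.
  by rewrite -{1}h cos_mulr2n cos2sin2; move: (sin _) => s; ring.
rewrite normrN normrM ger0_norm// normrX.
have h : `|sin (t / 2)| ^+ 2 <= `|t / 2| ^+ 2.
  by rewrite ler_sqr ?nnegrE// normr_sin_le.
apply: (le_trans (ler_wpM2l _ h)) => //.
by rewrite real_normK ?num_real// le_eqVlt; apply/orP; left; apply/eqP; field.
Qed.

(** A quadratic bound is enough for [cexp_remainder]. The mean value theorem gives [|cos c - 1| t]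
    with [0 < c < t]; here [|cos c - 1| <= c^2/2 <= t] when [t <= 2], and [|cos c - 1| <= 2]
    otherwise. *)
Lemma sin_sub_id (t : R) : `|sin t - t| <= t ^+ 2.
Proof.
wlog t0 : t / 0 <= t.
  move=> h; case: (leP 0 t) => [/h //|t0].
  by have := h (- t); rewrite sinN -opprD normrN sqrrN; apply; rewrite oppr_ge0 ltW.
have [c + ] := @MVT_segment R sin cos 0 t t0 (fun x _ => is_derive_sin x)
  (continuous_subspaceT (@continuous_sin R)).
rewrite in_itv /= sin0 !subr0 => /andP[c0 ct] ->.
have -> : cos c * t - t = (cos c - 1) * t by ring.
rewrite normrM (ger0_norm t0) expr2 ler_wpM2r//.
have [t2|t2] := leP t 2.
  apply: (le_trans (cos_sub1 c)); rewrite ler_pdivrMr// expr2.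
  by apply: ler_pM => //; exact: le_trans ct t2.
apply: le_trans (ltW t2); rewrite (le_trans (ler_normB _ _))// normr1.
by rewrite -[leRHS]/(1 + 1) lerD2r cos_max.
Qed.

Lemma expR_sub1 (x : R) : `|expR x - 1| <= `|x| * expR `|x|.
Proof.
have h1 := expR_ge1Dx x; have h2 := expR_ge1Dx (- x).
have h3 := expRxMexpNx_1 x; have h4 := expR_gt0 x; have h5 := expR_gt0 (- x).
have [x0|x0] := ger0P x.
  rewrite ger0_norm; last by lra.
  by nra.
rewrite ler0_norm; last by nra.
by nra.
Qed.

Lemma expR_sub1_id (x : R) : `|expR x - 1 - x| <= x ^+ 2 * expR `|x|.
Proof.
have h0 := expR_ge1Dx x.
rewrite ger0_norm; last by rewrite -addrA -opprD subr_ge0.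
have h := expR_sub1 x.
have h1 : expR x - 1 - x <= x * (expR x - 1).
  have := expR_ge1Dx (- x); have := expR_gt0 x; have := expRxMexpNx_1 x.
  by move=> a b c; nra.
apply: (le_trans h1); apply: (le_trans (ler_norm _)); rewrite normrM.
rewrite -[x ^+ 2]real_normK ?num_real// expr2 -mulrA.
by rewrite ler_wpM2l.
Qed.

(** The real and imaginary parts each split into two terms of second order, and each of the four is
    at most [t^2 exp t] with [t = |z|]. *)
Lemma cexp_remainder (z : C) :
  normc (cexp z - 1 - z) <= 4 * (normc z ^+ 2 * expR (normc z)).
Proof.
have hx := le_Re_normc z; have hy := le_Im_normc z.
set t := normc z in hx hy *; have t0 : 0 <= t := normc_ge0 z.
apply: (le_trans (le_normc_ReIm _)).
set x := Re z in hx *; set y := Im z in hy *.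
have -> : Re (cexp z - 1 - z) = (expR x - 1 - x) + expR x * (cos y - 1).
  by rewrite /cexp !ReImE /= -/x -/y; ring.
have -> : Im (cexp z - 1 - z) = (expR x - 1) * sin y + (sin y - y).
  by rewrite /cexp !ReImE /= -/x -/y; ring.
have M1 : 1 <= expR t by rewrite -[leLHS]expR0 ler_expR.
have xM : expR `|x| <= expR t by rewrite ler_expR.
have xM' : expR x <= expR t by rewrite ler_expR (le_trans (ler_norm _)).
have x2 : x ^+ 2 <= t ^+ 2 by rewrite -[x ^+ 2]real_normK ?num_real// ler_sqr ?nnegrE.
have y2 : y ^+ 2 <= t ^+ 2 by rewrite -[y ^+ 2]real_normK ?num_real// ler_sqr ?nnegrE.
have t2 : 0 <= t ^+ 2 by exact: sqr_ge0.
have b1 : `|expR x - 1 - x| <= t ^+ 2 * expR t.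
  by apply: (le_trans (expR_sub1_id x)); apply: ler_pM; rewrite ?sqr_ge0 ?expR_ge0.
have b2 : `|expR x * (cos y - 1)| <= t ^+ 2 * expR t.
  rewrite normrM ger0_norm ?expR_ge0// mulrC; apply: ler_pM; rewrite ?expR_ge0//.
  apply: (le_trans (cos_sub1 y)); rewrite ler_pdivrMr//.
  by apply: (le_trans y2); rewrite ler_peMr// ler1n.
have b3 : `|(expR x - 1) * sin y| <= t ^+ 2 * expR t.
  rewrite normrM expr2 mulrAC; apply: ler_pM => //.
    by apply: (le_trans (expR_sub1 x)); apply: ler_pM; rewrite ?expR_ge0.
  by apply: (le_trans (normr_sin_le y)).
have b4 : `|sin y - y| <= t ^+ 2 * expR t.
  by apply: (le_trans (sin_sub_id y)); apply: (le_trans y2); rewrite ler_peMr.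
have c1 := ler_normD (expR x - 1 - x) (expR x * (cos y - 1)).
have c2 := ler_normD ((expR x - 1) * sin y) (sin y - y).
by lra.
Qed.

(** Norms of spaces over [C] take values in [C]; estimates are made on the real part. *)
Lemma Re_normrE (V : normedModType C) (w : V) : `|w| = (Re `|w|)%:C.
Proof. by apply/esym/RRe_real; exact: normr_real. Qed.

Lemma differentiable_quadratic (V : normedModType C) (F : V -> C) (z : V)
    (L : V -> C^o) (K : R) : linear L -> continuous L -> 0 <= K ->
  (forall w : V, Re `|w| <= 1 ->
    normc (F (w + z) - F z - L w) <= K * Re `|w| ^+ 2) ->
  differentiable (F : V -> C^o) z.
Proof.
move=> lL cL K0 hF.
pose fL := @GRing.isLinear.Build C V C^o *:%R L lL.
pose L' : {linear V -> C^o} := HB.pack L fL.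
have dF : (F : V -> C^o) \o shift z = cst (F z) + L' +o_ (0 : V) id.
  apply/eqaddoP => eps eps0.
  have epsE : eps = (Re eps)%:C by apply/esym/RRe_real/gtr0_real.
  have e0 : 0 < Re eps by rewrite -ltcR -epsE.
  (* The bound 1 gives access to [hF]; the other one gives [K |w|^2 <= eps |w|], with [K + 1]
     because [K] may be 0. *)
  pose d : R := Num.min 1 (Re eps / (K + 1)).
  have K1 : 0 < K + 1 by rewrite ltr_wpDl.
  have d0 : 0 < d by rewrite lt_min ltr01 divr_gt0.
  apply/nbhs_norm0P; exists d%:C; first by rewrite /= ltcR.
  move=> w /=; rewrite Re_normrE ltcR => wd.
  have w0 : 0 <= Re `|w| by rewrite -lecR -Re_normrE normr_ge0.
  have wd1 : Re `|w| <= 1 by rewrite (le_trans (ltW wd))// ge_min lexx.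
  have wd2 : Re `|w| <= Re eps / (K + 1) by rewrite (le_trans (ltW wd))// ge_min lexx orbT.
  rewrite [leRHS](_ : _ = (Re eps * Re `|w|)%:C); last first.
    by rewrite realcM -Re_normrE -epsE.
  rewrite [leLHS]normcE lecR.
  have -> : ((F : V -> C^o) \o shift z - (cst (F z) + L')) w = F (w + z) - F z - L w.
    by rewrite /= /shift /cst !fctE opprD addrA.
  apply: (le_trans (hF w wd1)); rewrite expr2 mulrA ler_wpM2r//.
  apply: (le_trans (ler_wpM2l K0 wd2)); rewrite mulrCA ler_piMr ?(ltW e0)//.
  by rewrite ler_pdivrMr// mul1r lerDl.
have cL' : continuous L' by move=> v; exact: cL.
have dE := diff_unique cL' dF.
by apply/diff_locallyP; rewrite dE.
Qed.

Lemma differentiable_cexp (z : C^o) : differentiable (@cexp R : C^o -> C^o) z.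
Proof.
apply: (@differentiable_quadratic _ _ _ ( *:%R (cexp z)) (normc (cexp z) * (4 * expR 1))).
- by move=> a u v; rewrite /GRing.scale /=; ring.
- exact: scaler_continuous.
- by rewrite mulr_ge0 ?normc_ge0// mulr_ge0// expR_ge0.
move=> w w1; rewrite normcE in w1 *.
have -> : cexp (w + z) - cexp z - cexp z *: w = cexp z * (cexp w - 1 - w).
  by rewrite cexpD /GRing.scale /=; ring.
rewrite normcM -!mulrA ler_wpM2l ?normc_ge0//.
apply: (le_trans (cexp_remainder w)); rewrite ler_wpM2l// [leRHS]mulrC.
by rewrite ler_wpM2l ?sqr_ge0// ler_expR.
Qed.

Section row_vectors.
Variable m : nat.
Implicit Types (z w M : 'rV[C]_m).

Lemma cdot_linear M : linear (fun w => cdot M w : C^o).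
Proof. by move=> a u v; rewrite cdotDr cdotZr. Qed.

Lemma entire_coord j : entire (fun w : 'rV[C]_m => w 0 j).
Proof. by move=> z; exact: differentiable_coord. Qed.

Lemma entireM (F G : 'rV[C]_m -> C) : entire F -> entire G -> entire (fun w => F w * G w).
Proof. by move=> dF dG z; exact: (differentiableM (dF z) (dG z)). Qed.

Lemma entire_cst (k : C) : entire (fun _ : 'rV[C]_m => k).
Proof. by move=> z; exact: differentiable_cst. Qed.

Lemma entire_sum (F : 'I_m -> 'rV[C]_m -> C) :
  (forall j, entire (F j)) -> entire (fun w => \sum_j F j w).
Proof.
move=> dF z; have := differentiable_sum (fun j => dF j z).
by rewrite (_ : \sum_j _ = fun w => \sum_j F j w)//; apply/funext => w; rewrite fct_sumE.
Qed.

Lemma entire_cexp (F : 'rV[C]_m -> C) : entire F -> entire (fun w => cexp (F w)).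
Proof.
move=> dF z; exact: (@differentiable_comp _ _ _ _ (F : _ -> C^o) (@cexp R : C^o -> C^o)
  z (dF z) (@differentiable_cexp (F z))).
Qed.

Lemma le_normc_coord w j : normc (w 0 j) <= Re `|w|.
Proof.
rewrite -lecR -Re_normrE -normcE.
rewrite [leRHS]/Num.norm/= mx_normE -[leLHS]nngE num_le.
exact: (le_bigmax _ _ (0, j)).
Qed.

Lemma le_normc_cdot w (x : 'rV[R]_m) :
  normc (cdot w (to_cvec x)) <= Re `|w| * rv_l1 x.
Proof.
apply: (le_trans (normc_sum _ _)); rewrite /rv_l1 mulr_sumr.
apply: ler_sum => j _; rewrite normcM mxE normc_realc ler_wpM2r//.
exact: le_normc_coord.
Qed.

Lemma differentiable_rv (V : normedModType C) (s : V -> 'rV[C]_m) (z : V) :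
  (forall j, differentiable (fun v => s v 0 j : C^o) z) -> differentiable s z.
Proof.
move=> ds.
have := differentiable_sum (fun j => differentiableZl (delta_mx 0 j : 'rV[C]_m) (ds j)).
rewrite (_ : \sum_j _ = s)//.
by apply/funext => w; rewrite fct_sumE [RHS]row_sum_delta.
Qed.

Lemma entire_cdot M : entire (cdot M).
Proof.
by apply: entire_sum => j; apply: entireM; [exact: entire_cst|exact: entire_coord].
Qed.

Lemma entire_comp (F : 'rV[C]_m -> C) (s : 'rV[C]_m -> 'rV[C]_m) :
  (forall j, entire (fun w => s w 0 j)) -> entire F -> entire (fun w => F (s w)).
Proof.
move=> ds dF z; exact: (differentiable_comp (differentiable_rv (ds ^~ z)) (dF (s z))).
Qed.

Local Notation mu := (lebesgue_rv R m).

(* Differentiation under the integral sign: the remainder is controlled by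
   [cexp_remainder], and [l1^2 e^l1 <= e^(3 l1)] is absorbed by the Gaussian. *)
Lemma entire_gint (h : 'rV[R]_m -> C) : in_L2 h -> entire (gint h).
Proof.
move=> lh z.
pose ker (x : 'rV[R]_m) := cexp (- (2^-1 * rnorm2 x)%:C + cdot z (to_cvec x)).
have mker : cmeas ker := cmeas_gint_kernel z.
have [r r0 hr] := le_Re_cdot z 0.
have kerb x : normc (ker x) <= expR (- (2^-1 * rnorm2 x) + r * rv_l1 x).
  rewrite normc_cexp !ReImE ler_expR lerD2l.
  exact: le_trans (ler_norm _) (hr x).
pose dker (x : 'rV[R]_m) := (expR (3 * rv_l1 x))%:C * ker x.
have ldker : in_L2 dker.
  apply: (@in_L2_gauss _ _ 2^-1 (3 + r)) => //.
    apply: cmeasM => //; apply: cmeas_real; apply: measurableT_comp => //.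
    by apply: measurable_funM => //; exact: measurable_rv_l1.
  move=> x; rewrite normcM normc_realc ger0_norm ?expR_ge0//.
  apply: (le_trans (ler_wpM2l (expR_ge0 _) (kerb x))).
  by rewrite -expRD ler_expR mulrDl; lra.
have idk : cintegrable mu (fun x => h x * dker x) := L2M_cintegrable lh ldker.
have l1e (x : 'rV[R]_m) : rv_l1 x <= expR (rv_l1 x).
  by have := expR_ge1Dx (rv_l1 x); lra.
have l10 (x : 'rV[R]_m) : 0 <= rv_l1 x by exact: rv_l1_ge0.
have l1e3 (x : 'rV[R]_m) : expR (rv_l1 x) <= expR (3 * rv_l1 x) by rewrite ler_expR; have := l10 x; lra.
have ndk x : normc (h x * dker x) = normc (h x * ker x) * expR (3 * rv_l1 x).
  by rewrite !normcM normc_realc ger0_norm ?expR_ge0//; ring.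
have icoord j : cintegrable mu (fun x => h x * ker x * (x 0 j)%:C).
  apply: (cintegrable_le _ (integrable_normc idk)).
    apply: cmeasM; [apply: cmeasM => //; exact: in_L2_cmeas|].
    by apply: cmeas_real; exact: (measurable_rv_coord j).
  move=> x; rewrite ndk normcM normc_realc ler_wpM2l ?normc_ge0//.
  apply: le_trans (l1e3 x); apply: le_trans (l1e x).
  rewrite /rv_l1 (bigD1 j)//= lerDl.
  by apply: sumr_ge0 => i _.
(* The gradient at [z], obtained by formally differentiating [exp(z.x)] under the integral; [cdot M]
   is the candidate differential. *)
pose M : 'rV[C]_m := \row_j cintegral mu (fun x => h x * ker x * (x 0 j)%:C).
have iker : cintegrable mu (fun x => h x * ker x) := cintegrable_gint z lh.
have icd w j : cintegrable mu (fun x => h x * ker x * (w 0 j * to_cvec x 0 j)).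
  by under eq_fun do rewrite mxE mulrCA; exact: cintegrableZl.
have cdM w : cdot M w = cintegral mu (fun x => h x * ker x * cdot w (to_cvec x)).
  under [RHS]eq_cintegral => x do rewrite mulr_sumr.
  rewrite cintegral_sum => [|j]; last exact: icd.
  apply: eq_bigr => j _; rewrite mxE mulrC -cintegralZl//.
  by apply: eq_cintegral => x; rewrite mxE mulrCA.
pose K := 2 * (4 * fine (\int[mu]_x (normc (h x * dker x))%:E)).
apply: (@differentiable_quadratic _ _ z (cdot M) K).
- exact: cdot_linear.
- by move=> v; apply/differentiable_continuous; exact: (entire_cdot M).
- rewrite !mulr_ge0// fine_ge0// integral_ge0// => x _; rewrite lee_fin; exact: normc_ge0.
move=> w w1; have iw v : cintegrable mu (fun x => h x * ker x * cexp (cdot v (to_cvec x))).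
  have := cintegrable_gint (v + z) lh.
  by under eq_fun do rewrite cdotDl addrCA cexpD (mulrC (cexp _)) mulrA.
have -> : gint h (w + z) - gint h z - cdot M w = cintegral mu (fun x =>
    h x * ker x * (cexp (cdot w (to_cvec x)) - 1 - cdot w (to_cvec x))).
  have -> : gint h (w + z) = cintegral mu (fun x => h x * ker x * cexp (cdot w (to_cvec x))).
    by apply: eq_cintegral => x; rewrite cdotDl addrCA cexpD (mulrC (cexp _)) mulrA.
  have iB : cintegrable mu (fun x => h x * ker x * cexp (cdot w (to_cvec x)) - h x * ker x).
    by apply: cintegrableD; [exact: (iw w)|exact: (cintegrableN iker)].
  have icdw : cintegrable mu (fun x => h x * ker x * cdot w (to_cvec x)).
    under eq_fun do rewrite mulr_sumr.
    by apply: cintegrable_sum => j; exact: icd.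
  rewrite cdM /gint -(cintegralB (iw w) iker) -(cintegralB iB icdw).
  by apply: eq_cintegral => x; ring.
set t := Re `|w| in w1 *.
have t0 : 0 <= t by rewrite /t -lecR -Re_normrE normr_ge0.
have idk4 := integrableZl measurableT (4 * t ^+ 2) (integrable_normc idk).
apply: (le_trans (le_normc_cintegral _ idk4 _)).
- apply: cmeasM; first exact: (cintegrable_cmeas iker).
  have mw : cmeas (fun x : 'rV[R]_m => cdot w (to_cvec x)).
    apply: cmeas_cdot => j; first exact: cmeas_cst.
    by apply: cmeas_to_cvec; exact: measurable_id.
  apply: cmeasB => //; apply: cmeasB; [exact: cmeas_cexp|exact: cmeas_cst].
- move=> x; rewrite ndk normcM [leRHS]mulrCA ler_wpM2l ?normc_ge0//.
  apply: (le_trans (cexp_remainder _)).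
  rewrite -[leRHS]mulrA ler_wpM2l//.
  set c := normc _; have cb : c <= t * rv_l1 x := le_normc_cdot w x.
  have c0 : 0 <= c by exact: normc_ge0.
  have -> : 3 * rv_l1 x = rv_l1 x + rv_l1 x + rv_l1 x by ring.
  rewrite !expRD mulrA ler_pM ?sqr_ge0 ?expR_ge0//.
    apply: (@le_trans _ _ ((t * rv_l1 x) ^+ 2)).
      by rewrite ler_sqr ?nnegrE// mulr_ge0.
    rewrite exprMn ler_wpM2l ?sqr_ge0// expr2.
    exact: ler_pM.
  by rewrite ler_expR (le_trans cb)// ler_piMl.
rewrite RintegralZl//; last exact: integrable_normc.
rewrite le_eqVlt; apply/orP; left; apply/eqP; rewrite /K /Rintegral; ring.
Qed.

End row_vectors.
End complex_differentiability.

(** * The Bargmann transform: holomorphy and isometry *)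

Section bargmann_transform.
Variables (R : realType) (n : nat).
Local Notation C := R[i].
Local Notation V := 'rV[R]_(n + n).
Local Notation mu := (lebesgue_rv R (n + n)).
Implicit Types (f g h : V -> C) (x y : V).

Lemma bargmann_kernelE (zeta : 'rV[C]_(n + n)) x :
  cexp (4^-1 * cdot zeta zeta) *
    cexp (- (2^-1 * cdot (to_cvec x - zeta) (to_cvec x - zeta))) =
  cexp (- (4^-1 * cdot zeta zeta)) *
    cexp (- (2^-1 * rnorm2 x)%:C + cdot zeta (to_cvec x)).
Proof.
rewrite -!cexpD; congr cexp.
rewrite !(cdotDl, cdotDr, cdotNl, cdotNr) cdot_to_cvec (cdotC (to_cvec x)).
by rewrite realcM realcV rmorph_nat; field.
Qed.

Lemma bargmannE f (zeta : 'rV[C]_(n + n)) : in_L2 f ->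
  bargmann f zeta = (pi ^- n)%:C * cexp (- (4^-1 * cdot zeta zeta)) * gint f zeta.
Proof.
move=> lf; rewrite /bargmann -[LHS]mulrA -[RHS]mulrA; congr (_ * _).
have ig := cintegrable_gint zeta lf.
rewrite -[RHS](cintegralZl (cexp (- (4^-1 * cdot zeta zeta))) ig).
set k := cexp (4^-1 * _).
have kV : k != 0 by exact: cexp_neq0.
(* The factor [k] stands outside the integral, whereas [bargmann_kernelE] needs it next to the
   kernel; [k] is nonzero and is divided out under the integral sign. *)
have ig2 := cintegrableZl (k^-1 * cexp (- (4^-1 * cdot zeta zeta))) ig.
transitivity (k * cintegral mu (fun x => k^-1 * cexp (- (4^-1 * cdot zeta zeta)) *
  (f x * cexp (- (2^-1 * rnorm2 x)%:C + cdot zeta (to_cvec x))))).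
  congr (_ * _); apply: eq_cintegral => x.
  rewrite [RHS]mulrCA -[k^-1 * _ * _]mulrA -bargmann_kernelE; congr (_ * _).
  by rewrite mulKf.
rewrite -[LHS](cintegralZl k ig2).
by apply: eq_cintegral => x; rewrite mulrA mulVKf.
Qed.

Lemma entire_bargmann f : in_L2 f -> entire (bargmann f).
Proof.
move=> lf.
have -> : bargmann f =
    fun zeta => (pi ^- n)%:C * cexp (- 4^-1 * cdot zeta zeta) * gint f zeta.
  by apply/funext => zeta; rewrite bargmannE// mulNr.
apply: entireM; last exact: entire_gint.
apply: entireM; first exact: entire_cst.
apply: entire_cexp; apply: entireM; first exact: entire_cst.
by apply: entire_sum => j; apply: entireM; exact: entire_coord.
Qed.

Lemma cmeas_cpoint_comp (p : V * V -> V * V) : measurable_fun setT p ->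
  forall j, cmeas (fun q => cpoint (p q) 0 j).
Proof.
move=> mp j; under eq_fun => q do rewrite [p q]surjective_pairing.
apply: cmeas_cpoint; first exact: (measurableT_comp measurable_fst mp).
exact: (measurableT_comp measurable_snd mp).
Qed.

Lemma cmeas_bargmann f : in_L2 f -> cmeas (fun p : V * V => bargmann f (cpoint p)).
Proof.
move=> lf; under eq_fun do rewrite bargmannE//.
apply: cmeasM; last exact: cmeas_gint (in_L2_cmeas lf).
apply: cmeasM; first exact: cmeas_cst.
apply: cmeas_cexp; apply: cmeasN; apply: cmeasM; first exact: cmeas_cst.
by apply: cmeas_cdot => j; exact: cmeas_cpoint_comp.
Qed.

(** For [zeta = x + iy], [|exp(-zeta^2/4)|^2 exp(-|zeta|^2/2) = exp(-|x|^2)]: the weight loses its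
    dependence on [y], as [gint_isometry] requires. The factor [(4 pi)^n] is there because the Fock
    measure is left unnormalised. *)
Lemma bargmann_isometry f : in_L2 f ->
  (\int[mu \x mu]_p (sqmod (bargmann f (cpoint p)) *
     expR (- (2^-1 * cnorm2 (cpoint p))))%:E =
   ((4 * pi) ^+ n)%:E * \int[mu]_x (sqmod (f x))%:E)%E.
Proof.
move=> lf; have pi0 : (pi : R) != 0 by rewrite gt_eqF ?pi_gt0.
transitivity (\int[mu \x mu]_p ((pi ^- n ^+ 2)%:E *
    (expR (- rnorm2 p.1) * sqmod (gint f (cpoint p)))%:E))%E.
  apply: eq_integral => p _; rewrite bargmannE// -EFinM; congr (_%:E).
  rewrite (sqmodM (_ * _)) sqmodM sqmod_realc sqmod_cexp.
  have <- : expR (2 * Re (- (4^-1 * cdot (cpoint p) (cpoint p)))) *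
      expR (- (2^-1 * cnorm2 (cpoint p))) = expR (- rnorm2 p.1).
    by rewrite -expRD !ReImE Re_cpoint_sq cnorm2_cpoint /=; congr expR; field.
  by ring.
rewrite ge0_integralZl//; last 3 first.
- apply/measurable_EFinP; apply: measurable_funM.
    have := @measurable_expR_rnorm2 R _ _ (n + n) 1 _ (@measurable_fst _ _ V V).
    by under eq_fun do rewrite mul1r.
  by apply: measurable_sqmod; exact: cmeas_gint (in_L2_cmeas lf).
- by move=> p _; rewrite lee_fin mulr_ge0 ?sqmod_ge0 ?expR_ge0.
- by rewrite lee_fin sqr_ge0.
rewrite gint_isometry// muleA -EFinM; congr (_%:E * _)%E.
(* With [s] for the square root of [pi], the comparison of constants is an identity of rational
   functions. *)
have h (s : R) : s != 0 -> (s ^+ 2) ^- n ^+ 2 * ((2 * s ^+ 2) ^+ (n + n) * s ^+ (n + n)) =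
    (4 * s ^+ 2) ^+ n.
  move=> s0; rewrite (_ : 4 = 2 * 2); last by ring.
  rewrite !expr2 !exprMn !exprD.
  have : s ^+ n != 0 by rewrite expf_neq0.
  by move: (s ^+ n) (2 ^+ n) => a b a0; field.
have := h (Num.sqrt pi); rewrite sqr_sqrtr ?pi_ge0//; apply.
by rewrite gt_eqF// sqrtr_gt0 pi_gt0.
Qed.

End bargmann_transform.

(** * The twisted Bargmann transform *)

Section hyperbolic.
Variable R : realType.
Implicit Types x lam : R.

Lemma cosh_gt0 x : 0 < cosh x.
Proof. by rewrite divr_gt0// addr_gt0// expR_gt0. Qed.

Lemma cosh2_sinh2 x : cosh x ^+ 2 - sinh x ^+ 2 = 1.
Proof.
have := expRxMexpNx_1 x; rewrite /cosh /sinh => h.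
by rewrite -[RHS]h; field.
Qed.

Lemma cosh_double lam : cosh lam = cosh (lam / 2) ^+ 2 + sinh (lam / 2) ^+ 2.
Proof.
have e : lam = lam / 2 + lam / 2 by field.
rewrite /cosh /sinh {1 2}e opprD !expRD; move: (expR _) (expR _) => a b.
by field.
Qed.

Lemma sinh_double lam : sinh lam = 2 * (sinh (lam / 2) * cosh (lam / 2)).
Proof.
have e : lam = lam / 2 + lam / 2 by field.
rewrite /cosh /sinh {1 2}e opprD !expRD; move: (expR _) (expR _) => a b.
by field.
Qed.

(** [sinh] has the sign of its argument. Positivity makes [Num.sqrt (lam / sinh lam)] a genuine
    square root, for negative [lam] too. *)
Lemma divr_sinh_gt0 lam : lam != 0 -> 0 < lam / sinh lam.
Proof.
move=> /eqP/eqP; rewrite neq_lt => /orP[l0|l0].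
  rewrite -mulrNN -invrN mulr_gt0 ?oppr_gt0 ?invr_gt0// /sinh.
  by rewrite -mulNr divr_gt0// opprB subr_gt0 ltr_expR; lra.
by rewrite divr_gt0// /sinh divr_gt0// subr_gt0 ltr_expR; lra.
Qed.

Lemma sinh_neq0 lam : lam != 0 -> sinh lam != 0.
Proof. by move=> /divr_sinh_gt0; apply: contraTneq => ->; rewrite invr0 mulr0 ltxx. Qed.

End hyperbolic.

Section twisted_transform.
Variables (R : realType) (n : nat) (lam : R).
Hypothesis lam0 : lam != 0.
Local Notation C := R[i].
Local Notation V := 'rV[R]_(n + n).
Local Notation mu := (lebesgue_rv R (n + n)).
Local Notation s := (Num.sqrt (lam / sinh lam)).
Local Notation ch := (cosh (lam / 2)).
Local Notation sh := (sinh (lam / 2)).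
Implicit Types (f g h : V -> C) (x y : V).

Lemma scale_gt0 : 0 < s.
Proof. by rewrite sqrtr_gt0 divr_sinh_gt0. Qed.

Lemma half_sinh_neq0 : sh != 0.
Proof. by rewrite sinh_neq0// mulf_neq0// invr_eq0. Qed.

Lemma scale_sq : s ^+ 2 * (sh * ch) = lam / 2.
Proof.
have c0 : ch != 0 by rewrite gt_eqF ?cosh_gt0.
have := half_sinh_neq0.
rewrite sqr_sqrtr ?ltW ?divr_sinh_gt0// (sinh_double lam) => sh0.
by field; rewrite c0 sh0.
Qed.

Lemma kappa_gt0 : 0 < kappa lam.
Proof. by rewrite mulr_gt0 ?cosh_gt0 ?scale_gt0. Qed.

Lemma kappa_sq : kappa lam ^+ 2 = lam / 2 * coth (lam / 2).
Proof.
transitivity ((s ^+ 2 * (sh * ch)) * (ch / sh)); last by rewrite scale_sq.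
rewrite /kappa; have := half_sinh_neq0.
by move: s ch sh => a b c c0; field.
Qed.

(** This matches the terms quadratic in [zeta]: [-kappa^2/2] from the convolution and
    [(lam/4) coth lam] from the inverse of [p_1] have to add up to the [-s^2/4] of
    [exp(-(sigma_lam zeta)^2/4)]. *)
Lemma scale_sq_coth :
  4^-1 * s ^+ 2 = 2^-1 * kappa lam ^+ 2 - 4^-1 * lam * coth lam.
Proof.
rewrite kappa_sq sqr_sqrtr ?ltW ?divr_sinh_gt0// /coth (cosh_double lam) (sinh_double lam).
have -> : lam / (2 * (sh * ch)) = lam * (ch ^+ 2 - sh ^+ 2) / (2 * (sh * ch)).
  by rewrite cosh2_sinh2 mulr1.
have : ch != 0 by rewrite gt_eqF ?cosh_gt0.
have := half_sinh_neq0; move: ch sh => a b b0 a0.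
by field; rewrite a0 b0.
Qed.

Lemma cdot_split (a b : 'rV[C]_(n + n)) :
  cdot a b = cdot (lsubmx a) (lsubmx b) + cdot (rsubmx a) (rsubmx b).
Proof.
by rewrite /cdot big_split_ord; congr (_ + _); apply: eq_bigr => j _; rewrite !mxE.
Qed.

(** The second term is the phase [w.y - z.v] of the twisted convolution; for [b = kappa xi] its
    coefficient is [kappa s sh = lam/2]. *)
Lemma cdot_sigma_lam (zeta b : 'rV[C]_(n + n)) :
  cdot (sigma_lam lam zeta) b = (kappa lam)%:C * cdot zeta b
    - 'i%C * (s * sh)%:C * (cdot (rsubmx zeta) (lsubmx b) - cdot (lsubmx zeta) (rsubmx b)).
Proof.
rewrite /sigma_lam cdotZl !cdot_split row_mxKl row_mxKr.
rewrite !(cdotDl, cdotNl, cdotZl) /kappa !realcM.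
by ring.
Qed.

(** [sigma_lam] is [s] times the rotation by the imaginary angle [i lam/2]: the cross terms cancel
    and [ch^2 + (i sh)^2 = 1]. *)
Lemma sigma_lam_sq (zeta : 'rV[C]_(n + n)) :
  cdot (sigma_lam lam zeta) (sigma_lam lam zeta) = (s ^+ 2)%:C * cdot zeta zeta.
Proof.
rewrite /sigma_lam cdotZl cdotZr !cdot_split row_mxKl row_mxKr.
rewrite !(cdotDl, cdotNl, cdotZl, cdotDr, cdotNr, cdotZr).
rewrite (cdotC (rsubmx zeta) (lsubmx zeta)).
have i2 : ('i : C)%C * 'i%C = -1 by rewrite -expr2 sqr_i.
have h : (ch ^+ 2)%:C - (sh ^+ 2)%:C = 1 :> C by rewrite -realcN -realcD cosh2_sinh2.
move: (cdot (lsubmx zeta) (lsubmx zeta)) (cdot (rsubmx zeta) (rsubmx zeta)) => a b.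
move: (cdot (lsubmx zeta) (rsubmx zeta)) => c.
rewrite realcX in h; rewrite realcX in h; rewrite realcX.
move: (ch%:C) (sh%:C) (s%:C) h i2 => p q r h.
move: ('i%C : C) => i i2.
transitivity (r ^+ 2 * ((p ^+ 2 + (i * i) * q ^+ 2) * (a + b))); first by ring.
by rewrite i2 mulN1r h mul1r.
Qed.

Lemma cnlam_gt0 : 0 < cnlam n lam.
Proof.
apply: mulr_gt0; last by rewrite exprn_gt0// divr_sinh_gt0.
by rewrite invr_gt0 exprn_gt0// mulr_gt0// pi_gt0.
Qed.

Lemma anlamE : anlam n lam = (s / 2) ^+ n.
Proof.
have h (p a : R) : p != 0 -> p ^+ n * ((4 * p) ^- n * (a ^+ 2) ^+ n) = ((a / 2) ^+ n) ^+ 2.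
  move=> p0; rewrite -exprVn -!exprMn exprAC; congr (_ ^+ _).
  by field.
rewrite /anlam /cnlam -sqrtrM ?exprn_ge0 ?pi_ge0//.
rewrite -{1}[lam / sinh lam]sqr_sqrtr ?ltW ?divr_sinh_gt0// h ?gt_eqF ?pi_gt0//.
by rewrite sqrtr_sqr ger0_norm// exprn_ge0// divr_ge0// sqrtr_ge0.
Qed.

Lemma kappa_sinh : kappa lam * (s * sh) = lam / 2.
Proof. by apply: etrans scale_sq; rewrite /kappa; ring. Qed.

(** Up to a term in [zeta] alone, this is the exponent of [gint] at [sigma_lam zeta], evaluated at
    [kappa x]; hence the substitution by [kappa] in [twisted_bargmann_dilation]. *)
Lemma twisted_exponent (zeta : 'rV[C]_(n + n)) x :
  let z := lsubmx zeta in let w := rsubmx zeta in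
  let y := to_cvec (lsubmx x) in let v := to_cvec (rsubmx x) in
  - ((4^-1 * lam * coth (lam / 2))%:C * (cdot (z - y) (z - y) + cdot (w - v) (w - v)))
  - 'i%C * (lam / 2)%:C * (cdot w y - cdot z v) =
  - ((2^-1 * kappa lam ^+ 2)%:C * cdot zeta zeta)
  + (- (2^-1 * rnorm2 (kappa lam *: x))%:C
     + cdot (sigma_lam lam zeta) (to_cvec (kappa lam *: x))).
Proof.
move=> z w y v.
have <- : 2^-1 * kappa lam ^+ 2 = 4^-1 * lam * coth (lam / 2).
  by rewrite kappa_sq; field.
have -> : y = lsubmx (to_cvec x) by apply/rowP => j; rewrite !mxE.
have -> : v = rsubmx (to_cvec x) by apply/rowP => j; rewrite !mxE.
rewrite {y v}/z /w -!linearB -cdot_split to_cvecZ rnorm2Z cdotZr cdot_sigma_lam.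
rewrite !(cdotDl, cdotDr, cdotNl, cdotNr) cdot_to_cvec (cdotC (to_cvec x)).
rewrite -{1}kappa_sinh !realcM.
by rewrite realcV rmorph_nat; field.
Qed.

Lemma twisted_bargmann_dilation f : in_L2 f ->
  twisted_bargmann lam (dilation lam f) = Tlam lam (bargmann f).
Proof.
move=> lf; apply/funext => zeta.
have k0 := kappa_gt0; have k0' : kappa lam != 0 by rewrite gt_eqF.
have p0 : (pi : R) != 0 by rewrite gt_eqF ?pi_gt0.
rewrite /Tlam bargmannE//.
pose K := (4 * pi) ^- n * (lam / sh) ^+ n.
pose k := (kappa lam ^+ n * K)%:C * cexp (- ((2^-1 * kappa lam ^+ 2)%:C * cdot zeta zeta)).
pose G x := k * (f x * cexp (- (2^-1 * rnorm2 x)%:C + cdot (sigma_lam lam zeta) (to_cvec x))).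
have igint := cintegrable_gint (sigma_lam lam zeta) lf.
have -> : twisted_bargmann lam (dilation lam f) zeta =
    cexp ((4^-1 * lam * coth lam)%:C * cdot zeta zeta) *
    cintegral mu (fun x => G (kappa lam *: x + 0)).
  rewrite /twisted_bargmann.
  have h1 : (cnlam n lam)%:C * (heat lam 1 (lsubmx zeta) (rsubmx zeta))^-1 =
      cexp ((4^-1 * lam * coth lam)%:C * cdot zeta zeta).
    rewrite /heat mul1r -/(cnlam n lam) invfM mulrA mulfV ?mul1r.
      by rewrite -cexpN opprK -cdot_split.
    apply/eqP => /complexI /eqP; apply/negP.
    by rewrite gt_eqF// cnlam_gt0.
  rewrite h1; congr (_ * _).
  apply: eq_cintegral => x; rewrite /G addr0.
  have e : heat lam 2^-1 (lsubmx zeta - to_cvec (lsubmx x)) (rsubmx zeta - to_cvec (rsubmx x))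
      * cexp (- ('i%C * (lam / 2)%:C * (cdot (rsubmx zeta) (to_cvec (lsubmx x))
           - cdot (lsubmx zeta) (to_cvec (rsubmx x))))) =
      K%:C * (cexp (- ((2^-1 * kappa lam ^+ 2)%:C * cdot zeta zeta)) *
        cexp (- (2^-1 * rnorm2 (kappa lam *: x))%:C
          + cdot (sigma_lam lam zeta) (to_cvec (kappa lam *: x)))).
    by rewrite /heat (mulrC 2^-1 lam) -[LHS]mulrA -!cexpD twisted_exponent.
  rewrite -[LHS]mulrA e /k /dilation realcM.
  by move: (cexp _) (cexp _) (f _) => a b c; ring.
rewrite cintegral_rv_affine//; last first.
  apply: cmeasM; first exact: cmeas_cst.
  exact: cintegrable_cmeas igint.
rewrite -[cintegral _ _]/(cintegral mu (fun x => k * _)).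
rewrite (cintegralZl k igint) -/(gint f (sigma_lam lam zeta)).
have -> : cexp (- (4^-1 * cdot (sigma_lam lam zeta) (sigma_lam lam zeta))) =
    cexp ((4^-1 * lam * coth lam)%:C * cdot zeta zeta) *
    cexp (- ((2^-1 * kappa lam ^+ 2)%:C * cdot zeta zeta)).
  rewrite -cexpD; congr cexp; rewrite sigma_lam_sq.
  have -> : 4^-1 * ((s ^+ 2)%:C * cdot zeta zeta) = (4^-1 * s ^+ 2)%:C * cdot zeta zeta.
    by rewrite mulrA; congr (_ * _); rewrite [RHS]realcM [in RHS]realcV rmorph_nat.
  by rewrite scale_sq_coth realcD realcN; ring.
(* The Jacobian of the substitution, the normalisation of the dilation and the constant of [p_{1/2}]
   combine to [(s/(2 pi))^n], which determines the normalisation of [Tlam]. *)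
have cst : (kappa lam)^-1 ^+ (n + n) * (kappa lam ^+ n * K) = anlam n lam * pi ^- n.
  rewrite /K anlamE exprD -!exprVn -!exprMn; congr (_ ^+ _).
  have -> : lam / sh = 2 * (s ^+ 2 * ch).
    rewrite [X in X / _](_ : _ = 2 * (lam / 2)); last by field.
    by rewrite -{1}scale_sq; have := half_sinh_neq0; move: s sh ch => a b c b0; field.
  have : ch != 0 by rewrite gt_eqF ?cosh_gt0.
  have : s != 0 by rewrite gt_eqF ?scale_gt0.
  move: (pi : R) p0 => p p0; rewrite /kappa; move: s ch => a b a0 b0.
  by field; rewrite a0 b0 p0.
transitivity (((kappa lam)^-1 ^+ (n + n) * (kappa lam ^+ n * K))%:C *
  (cexp ((4^-1 * lam * coth lam)%:C * cdot zeta zeta) *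
   cexp (- ((2^-1 * kappa lam ^+ 2)%:C * cdot zeta zeta)) * gint f (sigma_lam lam zeta))).
  by rewrite realcM /k; move: (cexp _) (cexp _) => a b; ring.
by rewrite cst realcM; move: (cexp _) (cexp _) => a b; ring.
Qed.

End twisted_transform.

(** * Scalings and the symplectic change of variables *)

Section scaling.
Variables (R : realType) (n : nat).
Local Notation C := R[i].
Local Notation V := 'rV[R]_(n + n).
Local Notation mu := (lebesgue_rv R (n + n)).
Implicit Types (f g h : V -> C) (x y : V) (c : R).

(** [dilation lam] with a free factor, so that its inverse has the same form. *)
Definition scaling c f : V -> C := fun x => (c ^+ n)%:C * f (c *: x).

Lemma scalingK c f : c != 0 -> scaling c (scaling c^-1 f) = f.
Proof.
move=> c0; apply/funext => x; rewrite /scaling scalerA mulVf// scale1r mulrA.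
by rewrite -realcM -exprMn mulfV// expr1n mul1r.
Qed.

Lemma cmeas_scaling c f : cmeas f -> cmeas (scaling c f).
Proof.
move=> mf; apply: cmeasM; first exact: cmeas_cst.
exact: cmeas_comp (measurable_rvZ c) mf.
Qed.

Lemma integral_sqmod_scaling c f : 0 < c -> cmeas f ->
  (\int[mu]_x (sqmod (scaling c f x))%:E = \int[mu]_x (sqmod (f x))%:E)%E.
Proof.
move=> c0 mf; have mf2 : measurable_fun setT (fun x => (sqmod (f x))%:E).
  by apply/measurable_EFinP; exact: measurable_sqmod.
have f2 x : (0 <= (sqmod (f x))%:E)%E by rewrite lee_fin sqmod_ge0.
transitivity (\int[mu]_x ((c ^+ (n + n))%:E * (sqmod (f (c *: x + 0)))%:E))%E.
  apply: eq_integral => x _.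
  by rewrite addr0 /scaling sqmodM sqmod_realc EFinM expr2 exprD.
have mf3 : measurable_fun setT (fun x => (sqmod (f (c *: x + 0)))%:E).
  apply/measurable_EFinP; under eq_fun do rewrite addr0.
  exact: (measurableT_comp (measurable_sqmod mf) (measurable_rvZ c)).
rewrite (ge0_integralZl _ measurableT mf3) ?lee_fin ?exprn_ge0 ?ltW//.
rewrite (integral_rv_affine 0 c0 mf2 f2) muleA -EFinM -exprMn mulfV ?gt_eqF//.
by rewrite expr1n mul1e.
Qed.

Lemma in_L2_scaling c f : 0 < c -> in_L2 f -> in_L2 (scaling c f).
Proof.
move=> c0 lf; have [mr mi] := cmeas_scaling c (in_L2_cmeas lf); split => //.
by rewrite integral_sqmod_scaling//; [case: lf|exact: in_L2_cmeas].
Qed.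

Definition symp x : V := row_mx (rsubmx x) (- lsubmx x).

Lemma symp_lshift x k : symp x 0 (lshift n k) = x 0 (rshift n k).
Proof. by rewrite /symp row_mxEl mxE. Qed.

Lemma symp_rshift x k : symp x 0 (rshift n k) = - x 0 (lshift n k).
Proof. by rewrite /symp row_mxEr !mxE. Qed.

Lemma rv_linE c d x y j : (c *: x + d *: y) 0 j = c * x 0 j + d * y 0 j.
Proof. by rewrite !mxE. Qed.

Lemma rv_linBE c d x y j : (c *: x - d *: y) 0 j = c * x 0 j - d * y 0 j.
Proof. by rewrite !mxE. Qed.

Lemma sympD x y : symp (x + y) = symp x + symp y.
Proof. by rewrite /symp !linearD add_row_mx. Qed.

Lemma sympZ c x : symp (c *: x) = c *: symp x.
Proof. by rewrite /symp !linearZ scale_row_mx. Qed.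

Lemma sympK x : symp (symp x) = - x.
Proof. by rewrite /symp row_mxKl row_mxKr -opp_row_mx hsubmxK. Qed.

Lemma rnorm2_split x : rnorm2 x = rnorm2 (lsubmx x) + rnorm2 (rsubmx x).
Proof.
by rewrite /rnorm2 big_split_ord; congr (_ + _); apply: eq_bigr => j _; rewrite !mxE.
Qed.

Lemma rnorm2_symp x : rnorm2 (symp x) = rnorm2 x.
Proof. by rewrite !rnorm2_split row_mxKl row_mxKr rnorm2N addrC. Qed.

Lemma rdot_split x y :
  rdot x y = rdot (lsubmx x) (lsubmx y) + rdot (rsubmx x) (rsubmx y).
Proof.
by rewrite /rdot big_split_ord; congr (_ + _); apply: eq_bigr => j _; rewrite !mxE.
Qed.

Lemma rdot_symp x y : rdot y (symp x) = - rdot x (symp y).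
Proof.
rewrite !rdot_split /symp !row_mxKl !row_mxKr /rdot opprD -!sumrN.
rewrite addrC; congr (_ + _); apply: eq_bigr => j _; rewrite !mxE; ring.
Qed.

Lemma rnorm2_lin c d x y :
  rnorm2 (c *: x + d *: y) = c ^+ 2 * rnorm2 x + 2 * (c * d) * rdot x y + d ^+ 2 * rnorm2 y.
Proof.
rewrite /rnorm2 /rdot !mulr_sumr -!big_split; apply: eq_bigr => j _ /=.
by rewrite !mxE; ring.
Qed.

Lemma rnorm2_linB c d x y :
  rnorm2 (c *: x - d *: y) = c ^+ 2 * rnorm2 x - 2 * (c * d) * rdot x y + d ^+ 2 * rnorm2 y.
Proof. by rewrite -scaleNr rnorm2_lin; ring. Qed.

Lemma measurable_symp : measurable_fun setT symp.
Proof.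
apply: measurable_fun_rv => j; rewrite -[j](@splitK n n).
case: (@fintype.split n n j) => k.
  rewrite (_ : _ \o _ = rv_coord (rshift n k)); first exact: measurable_rv_coord.
  by apply/funext => x; rewrite /= /rv_coord /symp row_mxEl mxE.
rewrite (_ : _ \o _ = fun x => - rv_coord (lshift n k) x).
  by apply: measurableT_comp => //; exact: measurable_rv_coord.
by apply/funext => x; rewrite /= /rv_coord /symp row_mxEr !mxE.
Qed.

Definition symp_map c d (p : V * V) : V * V :=
  (c *: p.1 + d *: symp p.2, c *: p.2 - d *: symp p.1).

Lemma measurable_lin_symp c d (u v : V * V -> V) :
  measurable_fun setT u -> measurable_fun setT v ->
  measurable_fun setT (fun p => c *: u p + d *: symp (v p)).
Proof.
move=> mu' mv; apply: measurable_rvD.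
  exact: (measurableT_comp (measurable_rvZ c) mu').
exact: (measurableT_comp (measurable_rvZ d) (measurableT_comp measurable_symp mv)).
Qed.

Lemma measurable_symp_map c d : measurable_fun setT (symp_map c d).
Proof.
apply: measurable_fun_pair; first exact: measurable_lin_symp.
by under eq_fun do rewrite -scaleNr; exact: measurable_lin_symp.
Qed.

(* For fixed [y] substitute [p = s c x + s d Jy], which turns [s c y - s d Jx]
   into [(s / c) y - (d / c) Jp]; then substitute in [y] for fixed [p]. *)
Lemma integral_symplectic (s c d : R) (F : V * V -> \bar R) :
  0 < s -> 0 < c -> c ^+ 2 - d ^+ 2 = 1 ->
  measurable_fun setT F -> (forall p, 0 <= F p)%E ->
  (\int[mu \x mu]_p F (symp_map (s * c) (s * d) p) =
   ((s ^+ 2)^-1 ^+ (n + n))%:E * \int[mu \x mu]_p F p)%E.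
Proof.
move=> s0 c0 cd mF F0.
have c0' : c != 0 by rewrite gt_eqF.
have s0' : s != 0 by rewrite gt_eqF.
pose G (q : V * V) := F (q.1, (s / c) *: q.2 - (d / c) *: symp q.1).
have mG : measurable_fun setT G.
  apply: (measurableT_comp mF); apply: measurable_fun_pair => //.
  by under eq_fun do rewrite -scaleNr; exact: measurable_lin_symp.
have mFs : measurable_fun setT (fun p => F (symp_map (s * c) (s * d) p)).
  exact: (measurableT_comp mF (measurable_symp_map _ _)).
rewrite fubini_tonelli2// /fubini_G.
transitivity (\int[mu]_y (((s * c)^-1 ^+ (n + n))%:E * \int[mu]_x G (x, y)))%E.
  apply: eq_integral => y _.
  have sc0 : 0 < s * c by rewrite mulr_gt0.
  rewrite -(integral_rv_affine ((s * d) *: symp y) sc0); last 2 first.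
  - exact: (measurableT_comp mG (measurable_pair2 y)).
  - by move=> x; exact: F0.
  apply: eq_integral => x _; rewrite /G /=; congr (F (_, _)).
  rewrite sympD !sympZ sympK; move: (symp x) => u.
  apply/rowP => j; rewrite !mxE.
  (* Prepares [c^2 = d^2 + 1]; the other side has the coefficient [s (1 + d^2)/c], where [d^2] comes
     from [J^2 = -1]. *)
  have -> : s * c * y 0 j = s * (c ^+ 2 - (c ^+ 2 - d ^+ 2) + (c ^+ 2 - d ^+ 2)) / c * y 0 j.
    by field.
  by rewrite {2}cd; field.
rewrite ge0_integralZl//; last 3 first.
- by apply: (measurable_fun_fubini_tonelli_G _ mG) => q; exact: F0.
- by move=> y _; apply: integral_ge0 => x _; exact: F0.
- by rewrite lee_fin exprn_ge0// invr_ge0 ltW// mulr_gt0.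
rewrite -(fubini_tonelli _ mG); last by move=> p; exact: F0.
transitivity (((s * c)^-1 ^+ (n + n))%:E *
  \int[mu]_x (((s / c)^-1 ^+ (n + n))%:E * \int[mu]_y F (x, y)))%E.
  congr (_ * _)%E; apply: eq_integral => x _.
  have sc0 : 0 < s / c by rewrite divr_gt0.
  rewrite -(integral_rv_affine (- ((d / c) *: symp x)) sc0)//.
  exact: (measurableT_comp mF (measurable_pair1 x)).
rewrite ge0_integralZl//; last 3 first.
- exact: (measurable_fun_fubini_tonelli_F _ mF).
- by move=> y _; apply: integral_ge0 => x _; exact: F0.
- by rewrite lee_fin exprn_ge0// invr_ge0 ltW// divr_gt0.
rewrite muleA -EFinM -exprMn fubini_tonelli1//.
by congr ((_ ^+ _)%:E * _)%E; field; rewrite c0' s0'.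
Qed.

End scaling.

(** * Isometry of [Tlam] after the Bargmann transform *)

Section twisted_isometry.
Variables (R : realType) (n : nat) (lam : R).
Hypothesis lam0 : lam != 0.
Local Notation C := R[i].
Local Notation V := 'rV[R]_(n + n).
Local Notation mu := (lebesgue_rv R (n + n)).
Local Notation s := (Num.sqrt (lam / sinh lam)).
Local Notation ch := (cosh (lam / 2)).
Local Notation sh := (sinh (lam / 2)).
Implicit Types (f g h : V -> C) (x y : V) (p : V * V).

Definition sigma_real : V * V -> V * V := symp_map (s * ch) (s * sh).

Lemma sigma_cpoint p : sigma_lam lam (cpoint p) = cpoint (sigma_real p).
Proof.
apply/rowP => j; rewrite /sigma_lam.
rewrite [RHS]mxE /sigma_real [(_, _).1]/= [(_, _).2]/= rv_linE rv_linBE.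
case: (split_ordP j) => k ->; rewrite ?symp_lshift ?symp_rshift [LHS]mxE ?(row_mxEl, row_mxEr) !mxE;
  by apply: complex_eq; rewrite !ReImE /=; ring.
Qed.

Lemma Im_cdot_cpoint p :
  Im (cdot (lsubmx (cpoint p)) (cconj (rsubmx (cpoint p)))) = - rdot p.1 (symp p.2).
Proof.
rewrite rdot_split /symp row_mxKl row_mxKr /cdot Im_sum /rdot -big_split -sumrN.
by apply: eq_bigr => j _; rewrite !mxE ImM ReJ ImJ /=; ring.
Qed.

Lemma cnorm2_split (a : 'rV[C]_(n + n)) : cnorm2 a = cnorm2 (lsubmx a) + cnorm2 (rsubmx a).
Proof.
rewrite /cnorm2 cdot_split ReD.
have -> : lsubmx (cconj a) = cconj (lsubmx a) by apply/rowP => j; rewrite !mxE.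
by have -> : rsubmx (cconj a) = cconj (rsubmx a) by apply/rowP => j; rewrite !mxE.
Qed.

(** For [p = (x, y)], [|sigma p|^2 = s^2 (ch^2 + sh^2) |p|^2 + 4 s^2 ch sh <x, Jy>]. The first
    coefficient is [lam coth lam], the second is [2 lam], and [Im(z . conj w) = - <x, Jy>]. *)
Lemma wlam_cpoint p :
  wlam lam (cpoint p) = 4 ^+ n * cnlam n lam *
    expR (- (2^-1 * cnorm2 (cpoint (sigma_real p)))).
Proof.
rewrite /wlam -mulrA -expRD; congr (_ * expR _).
rewrite Im_cdot_cpoint -cnorm2_split !cnorm2_cpoint /sigma_real /= rnorm2_lin rnorm2_linB.
rewrite !rnorm2_symp (rdot_symp p.1 p.2).
have h1 := scale_sq lam0.
have h2 : lam * coth lam = s ^+ 2 * (ch ^+ 2 + sh ^+ 2).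
  rewrite /coth (cosh_double lam) sqr_sqrtr ?ltW ?divr_sinh_gt0//.
  by have := sinh_neq0 lam0; move: (sinh lam) => a a0; field.
rewrite -(mulrA 2^-1) h2.
have -> : lam * - rdot p.1 (symp p.2) = - (2 * (lam / 2) * rdot p.1 (symp p.2)) by field.
rewrite -{1}h1; move: s ch sh => a b c; by field.
Qed.

Lemma measurable_sigma_real : measurable_fun setT sigma_real.
Proof. exact: measurable_symp_map. Qed.

Lemma cmeas_Tlam f : in_L2 f -> cmeas (fun p => Tlam lam (bargmann f) (cpoint p)).
Proof.
move=> lf; apply: cmeasM; first exact: cmeas_cst.
under eq_fun do rewrite sigma_cpoint.
exact: cmeas_comp measurable_sigma_real (cmeas_bargmann lf).
Qed.

Lemma measurable_wlam : measurable_fun setT (fun p => wlam lam (cpoint p)).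
Proof.
under eq_fun do rewrite wlam_cpoint cnorm2_cpoint.
apply: measurable_funM => //; apply: (measurableT_comp (@measurable_expR R)).
apply: measurableT_comp => //; apply: measurable_funM => //.
have mf (u : V * V -> V) : measurable_fun setT u ->
    measurable_fun setT (fun p => rnorm2 (u (sigma_real p))).
  by move=> mu'; apply: measurable_rnorm2; exact: (measurableT_comp mu' measurable_sigma_real).
by apply: measurable_funD; apply: mf; [exact: measurable_fst|exact: measurable_snd].
Qed.

Lemma wlam_ge0 p : 0 <= wlam lam (cpoint p).
Proof. by rewrite wlam_cpoint mulr_ge0 ?expR_ge0// mulr_ge0// ltW// cnlam_gt0. Qed.

Lemma Tlam_isometry f : in_L2 f ->
  (\int[mu \x mu]_p (sqmod (Tlam lam (bargmann f) (cpoint p)) * wlam lam (cpoint p))%:E =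
   \int[mu]_x (sqmod (f x))%:E)%E.
Proof.
move=> lf.
pose F p := (sqmod (bargmann f (cpoint p)) * expR (- (2^-1 * cnorm2 (cpoint p))))%:E.
have F0 p : (0 <= F p)%E by rewrite lee_fin mulr_ge0 ?sqmod_ge0 ?expR_ge0.
have mF : measurable_fun setT F.
  apply/measurable_EFinP; apply: measurable_funM.
    exact: measurable_sqmod (cmeas_bargmann lf).
  apply: (measurableT_comp (@measurable_expR R)); apply: measurableT_comp => //.
  apply: measurable_funM => //; under eq_fun do rewrite cnorm2_cpoint.
  by apply: measurable_funD; apply: measurable_rnorm2;
    [exact: measurable_fst|exact: measurable_snd].
pose K := anlam n lam ^+ 2 * (4 ^+ n * cnlam n lam).
transitivity (\int[mu \x mu]_p (K%:E * F (sigma_real p)))%E.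
  apply: eq_integral => p _; rewrite -EFinM; congr (_%:E).
  rewrite /Tlam sqmodM sqmod_realc sigma_cpoint wlam_cpoint /K; ring.
rewrite ge0_integralZl//; last 2 first.
- exact: (measurableT_comp mF measurable_sigma_real).
- by rewrite lee_fin mulr_ge0 ?sqr_ge0// mulr_ge0// ltW// cnlam_gt0.
rewrite (@integral_symplectic R n s ch sh F)//; last 3 first.
- exact: scale_gt0.
- exact: cosh_gt0.
- exact: cosh2_sinh2.
rewrite bargmann_isometry// !muleA -!EFinM -[RHS]mul1e; congr (_%:E * _)%E.
(* The constants of [Tlam], of [wlam], of the Jacobian and of [bargmann_isometry] multiply to 1; [a]
   stands for [s], [b] for [pi] and [q] for [lam / sinh lam]. *)
have h (a b q : R) : a != 0 -> b != 0 -> a ^+ 2 = q ->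
    ((a / 2) ^+ n) ^+ 2 * (4 ^+ n * ((4 * b) ^- n * q ^+ n)) *
    (a ^+ 2)^-1 ^+ (n + n) * (4 * b) ^+ n = 1.
  move=> a0 b0 <-.
  rewrite (expr2 (_ ^+ n)) exprD -!exprVn -!exprMn -[RHS](expr1n R n); congr (_ ^+ n).
  by field; rewrite a0 b0.
rewrite /K anlamE// /cnlam.
apply: h; rewrite ?gt_eqF ?scale_gt0 ?pi_gt0// sqr_sqrtr// ltW// divr_sinh_gt0//.
Qed.

End twisted_isometry.

(** * Inner products under the twisted Bargmann transform, and its adjoint *)

Section twisted_unitarity.
Variables (R : realType) (n : nat) (lam : R).
Hypothesis lam0 : lam != 0.
Local Notation C := R[i].
Local Notation V := 'rV[R]_(n + n).
Local Notation mu := (lebesgue_rv R (n + n)).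
Implicit Types (f g h : V -> C) (x y : V) (p : V * V).

(** Every element of L^2 is the dilation of its undilation, so [twisted_bargmann_dilation] describes
    the transform on all of L^2. *)
Definition undilation f := scaling (kappa lam)^-1 f.

Lemma undilationK f : dilation lam (undilation f) = f.
Proof. by apply: scalingK; rewrite gt_eqF ?kappa_gt0. Qed.

Lemma in_L2_dilation f : in_L2 f -> in_L2 (dilation lam f).
Proof. by apply: in_L2_scaling; exact: kappa_gt0. Qed.

Lemma in_L2_undilation f : in_L2 f -> in_L2 (undilation f).
Proof. by apply: in_L2_scaling; rewrite invr_gt0 kappa_gt0. Qed.

Lemma twisted_bargmannE h : in_L2 h ->
  twisted_bargmann lam h = Tlam lam (bargmann (undilation h)).
Proof.
by move=> lh; rewrite -{1}(undilationK h) twisted_bargmann_dilation//; exact: in_L2_undilation.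
Qed.

Lemma bargmann_lin h g (k : C) zeta : in_L2 h -> in_L2 g ->
  bargmann (fun x => h x + k * g x) zeta = bargmann h zeta + k * bargmann g zeta.
Proof.
move=> lh lg; have lkg := in_L2Z k lg.
rewrite !bargmannE//; last exact: in_L2D.
by rewrite gintD// gintZ//; move: (cexp _) => e; ring.
Qed.

Lemma twisted_bargmann_lin h g (k : C) zeta : in_L2 h -> in_L2 g ->
  twisted_bargmann lam (fun x => h x + k * g x) zeta =
  twisted_bargmann lam h zeta + k * twisted_bargmann lam g zeta.
Proof.
move=> lh lg; rewrite !twisted_bargmannE//; last by apply: in_L2D => //; exact: in_L2Z.
have -> : undilation (fun x => h x + k * g x) = fun x => undilation h x + k * undilation g x.
  by apply/funext => x; rewrite /undilation /scaling mulrDr mulrCA.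
by rewrite /Tlam bargmann_lin; [ring|exact: in_L2_undilation..].
Qed.

Lemma twisted_isometry h : in_L2 h ->
  (\int[mu \x mu]_p (sqmod (twisted_bargmann lam h (cpoint p)) * wlam lam (cpoint p))%:E =
   \int[mu]_x (sqmod (h x))%:E)%E.
Proof.
move=> lh; rewrite twisted_bargmannE// Tlam_isometry//; last exact: in_L2_undilation.
by rewrite integral_sqmod_scaling ?invr_gt0 ?kappa_gt0//; exact: in_L2_cmeas.
Qed.

Lemma cmeas_twisted_bargmann h : in_L2 h ->
  cmeas (fun p => twisted_bargmann lam h (cpoint p)).
Proof.
by move=> lh; rewrite twisted_bargmannE//; apply: cmeas_Tlam; exact: in_L2_undilation.
Qed.

Lemma cdot_delta (j : 'I_(n + n)) (w : 'rV[C]_(n + n)) : cdot (delta_mx 0 j) w = w 0 j.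
Proof.
rewrite /cdot (bigD1 j)//= mxE !eqxx mul1r big1 ?addr0// => i /negPf ij.
by rewrite mxE eqxx ij mul0r.
Qed.

Lemma entire_Tlam (F : 'rV[C]_(n + n) -> C) : entire F -> entire (Tlam lam F).
Proof.
move=> eF; apply: entireM; first exact: entire_cst.
apply: entire_comp eF => j; rewrite /sigma_lam.
set c := (_ %:C); set a := (_ %:C); set b := 'i%C * _.
case: (split_ordP j) => k ->.
  rewrite (_ : (fun _ => _) =
    cdot (c *: (a *: delta_mx 0 (lshift n k) - b *: delta_mx 0 (rshift n k)))).
    exact: entire_cdot.
  apply/funext => w; rewrite mxE row_mxEl cdotZl cdotDl cdotNl !cdotZl !cdot_delta.
  by rewrite !mxE.
rewrite (_ : (fun _ => _) =
  cdot (c *: (a *: delta_mx 0 (rshift n k) + b *: delta_mx 0 (lshift n k)))).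
  exact: entire_cdot.
apply/funext => w; rewrite mxE row_mxEr cdotZl cdotDl !cdotZl !cdot_delta.
by rewrite !mxE.
Qed.

Lemma in_twisted_fock_Tlam f : in_L2 f -> in_twisted_fock lam (Tlam lam (bargmann f)).
Proof.
move=> lf; split; first by apply: entire_Tlam; exact: entire_bargmann.
by rewrite Tlam_isometry//; case: lf.
Qed.

Let N h := \int[mu]_x sqmod (h x).

Lemma twisted_isometry_real h : in_L2 h ->
  (mu \x mu)%E.-integrable setT
    (fun p => (sqmod (twisted_bargmann lam h (cpoint p)) * wlam lam (cpoint p))%:E) /\
  \int[(mu \x mu)%E]_p (sqmod (twisted_bargmann lam h (cpoint p)) * wlam lam (cpoint p)) = N h.
Proof.
move=> lh; split; last by rewrite /N /Rintegral twisted_isometry.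
apply/integrableP; split.
  apply/measurable_EFinP; apply: measurable_funM; last exact: measurable_wlam.
  exact: measurable_sqmod (cmeas_twisted_bargmann lh).
rewrite (eq_integral (fun p =>
  (sqmod (twisted_bargmann lam h (cpoint p)) * wlam lam (cpoint p))%:E)) => [|p _].
  by rewrite twisted_isometry//; case: lh.
by rewrite /= ger0_norm// mulr_ge0 ?sqmod_ge0// wlam_ge0.
Qed.

Lemma Re_mul_real (z : C) (a : R) : Re (z * a%:C) = Re z * a.
Proof. by rewrite ReM /= mulr0 subr0. Qed.

Lemma Im_mul_real (z : C) (a : R) : Im (z * a%:C) = Im z * a.
Proof. by rewrite ImM /= mulr0 add0r. Qed.

Lemma Re_twisted_unitary h g : in_L2 h -> in_L2 g ->
  \int[(mu \x mu)%E]_p Re (twisted_bargmann lam h (cpoint p) *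
     conjc (twisted_bargmann lam g (cpoint p)) * (wlam lam (cpoint p))%:C) =
  4^-1 * (N (fun x => h x + g x) - N (fun x => h x - g x)).
Proof.
move=> lh lg.
have lD := in_L2D lh lg; have lB := in_L2B lh lg.
have [iD <-] := twisted_isometry_real lD; have [iB <-] := twisted_isometry_real lB.
rewrite -RintegralB// -RintegralZl//; last first.
  exact: integrableB iD iB.
apply: eq_Rintegral => p _.
have -> : twisted_bargmann lam (fun x => h x + g x) (cpoint p) =
    twisted_bargmann lam h (cpoint p) + twisted_bargmann lam g (cpoint p).
  by have := twisted_bargmann_lin 1 (cpoint p) lh lg; under eq_fun do rewrite mul1r; rewrite mul1r.
have -> : twisted_bargmann lam (fun x => h x - g x) (cpoint p) =
    twisted_bargmann lam h (cpoint p) - twisted_bargmann lam g (cpoint p).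
  by have := twisted_bargmann_lin (-1) (cpoint p) lh lg;
    under eq_fun do rewrite mulN1r; rewrite mulN1r.
by rewrite Re_mul_real ReJ_mul; ring.
Qed.

Lemma Re_L2_inner h g : in_L2 h -> in_L2 g ->
  \int[mu]_x Re (h x * conjc (g x)) =
  4^-1 * (N (fun x => h x + g x) - N (fun x => h x - g x)).
Proof.
move=> lh lg.
have iD := L2_integrable_sqmod (in_L2D lh lg); have iB := L2_integrable_sqmod (in_L2B lh lg).
rewrite /N -RintegralB// -RintegralZl//; last exact: integrableB iD iB.
by apply: eq_Rintegral => x _; rewrite ReJ_mul.
Qed.

(** It reduces the imaginary part of an inner product to real polarisation applied to [i g]. *)
Lemma Im_conjc (z w : C) : Im (z * conjc w) = Re (z * conjc ('i%C * w)).
Proof. by rewrite !ReImE /=; ring. Qed.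

Lemma twisted_unitary h g : in_L2 h -> in_L2 g ->
  twisted_fock_inner lam (twisted_bargmann lam h) (twisted_bargmann lam g) = L2_inner h g.
Proof.
move=> lh lg; have lig := in_L2Z 'i%C lg.
apply: complex_eq.
  exact: (etrans (Re_twisted_unitary lh lg) (esym (Re_L2_inner lh lg))).
transitivity (\int[mu]_x Re (h x * conjc ('i%C * g x))); last first.
  by apply: eq_Rintegral => x _; rewrite -Im_conjc.
rewrite (Re_L2_inner lh lig) -(Re_twisted_unitary lh lig).
apply: eq_Rintegral => p _.
have -> : twisted_bargmann lam (fun x => 'i%C * g x) (cpoint p) =
    'i%C * twisted_bargmann lam g (cpoint p).
  (* [i g] is written as [g + (i - 1) g] to fit the shape of [twisted_bargmann_lin]. *)
  have := twisted_bargmann_lin ('i%C - 1) (cpoint p) lg lg.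
  have -> : (fun x => g x + ('i%C - 1) * g x) = fun x => 'i%C * g x.
    by apply/funext => x; ring.
  by move=> ->; ring.
by rewrite [LHS]Im_mul_real [RHS]Re_mul_real Im_conjc.
Qed.

Lemma ae_eqf_L2 f g : in_L2 f -> in_L2 g ->
  (\int[mu]_x (sqmod (f x - g x))%:E = 0)%E -> ae_eqf f g.
Proof.
move=> lf lg h0; have lB := in_L2B lf lg.
have m : measurable_fun setT (fun x => (sqmod (f x - g x))%:E).
  by apply/measurable_EFinP; exact: measurable_sqmod (in_L2_cmeas lB).
have : ae_eq mu setT (fun x => (sqmod (f x - g x))%:E) (cst 0%E).
  apply/ae_eq_integral_abs => //.
  by under eq_integral do rewrite /= ger0_norm ?sqmod_ge0//.
apply: filterS => x /(_ I) /= [/sqmod_eq0 /eqP]; rewrite subr_eq0; exact/eqP.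
Qed.

Lemma twisted_bargmann_inj f g : in_L2 f -> in_L2 g ->
  twisted_bargmann lam f = twisted_bargmann lam g -> ae_eqf f g.
Proof.
move=> lf lg fg; apply: ae_eqf_L2 => //.
have lB := in_L2B lf lg; rewrite -(twisted_isometry lB).
apply: integral0_eq => p _.
have -> : twisted_bargmann lam (fun x => f x - g x) (cpoint p) = 0.
  have := twisted_bargmann_lin (-1) (cpoint p) lf lg; under eq_fun do rewrite mulN1r.
  by rewrite fg mulN1r subrr.
by rewrite -[0 : C]/(0%:C) sqmod_realc expr2 !mul0r.
Qed.

Lemma L2_innerB h g k : in_L2 h -> in_L2 g -> in_L2 k ->
  L2_inner h (fun x => g x - k x) = L2_inner h g - L2_inner h k.
Proof.
move=> lh lg lk; rewrite /L2_inner -cintegralB.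
- by apply: eq_cintegral => x; rewrite rmorphB mulrBr.
- by apply: L2M_cintegrable => //; exact: in_L2J.
- by apply: L2M_cintegrable => //; exact: in_L2J.
Qed.

(** [dilation lam f] has the defining property of the adjoint by [twisted_unitary]. If [g] is the
    chosen solution, then [g] and [dilation lam f] have the same inner product with every [h];
    taking for [h] their difference shows that it has norm 0. *)
Lemma twisted_bargmann_adj_Tlam f : in_L2 f ->
  ae_eqf (twisted_bargmann_adj lam (Tlam lam (bargmann f))) (dilation lam f).
Proof.
move=> lf; have lD := in_L2_dilation lf.
rewrite /twisted_bargmann_adj; set A := [set g | _].
have AD : A (dilation lam f).
  split; [exact: in_twisted_fock_Tlam|exact: lD|].
  by move=> h lh; rewrite -twisted_bargmann_dilation//; exact: twisted_unitary.
case: xgetP => [g _ [_ lg hg]|/(_ (dilation lam f))//].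
apply: ae_eqf_L2 => //; have lB := in_L2B lg lD.
have [_ _ hD] := AD.
have : L2_inner (fun x => g x - dilation lam f x) (fun x => g x - dilation lam f x) = 0.
  by rewrite L2_innerB// -hg// -hD// subrr.
rewrite /L2_inner; under eq_cintegral do rewrite mulc_conj.
rewrite cintegral_real => /complexI h0.
rewrite -[LHS]fineK; first by rewrite -[X in X%:E]/(\int[mu]_x _)%R h0.
exact: integrable_fin_num (L2_integrable_sqmod lB).
Qed.

End twisted_unitarity.

(** * Hermite functions *)

Section gaussian_polynomials.
Variables (R : realType) (m : nat).
Local Notation V := 'rV[R]_m.
Implicit Types (c K : R) (q : {poly R}) (x : V) (j : 'I_m).

Definition hstep c q : {poly R} := q^`() - (2 * c)%:P * 'X * q.

Lemma is_derive_hgauss c q t :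
  is_derive t (1 : R) (fun s => q.[s] * expR (- (c * s ^+ 2)))
    ((hstep c q).[t] * expR (- (c * t ^+ 2))).
Proof.
have := cder_pgauss q c 0 t; rewrite mul0r addr0 => -[h _].
have reE (p : {poly R}) s : Re (pgauss p c 0 s) = p.[s] * expR (- (c * s ^+ 2)).
  by rewrite /pgauss /cgauss mul0r addr0 -realcN cexp_realc -realcM.
by rewrite -reE; under eq_fun do rewrite -reE.
Qed.

Definition gtensor c (Q : 'I_m -> {poly R}) x : R :=
  \prod_i ((Q i).[x 0 i] * expR (- (c * x 0 i ^+ 2))).

Definition gtensor_deriv c j (Q : 'I_m -> {poly R}) : 'I_m -> {poly R} :=
  fun i => if i == j then hstep c (Q i) else Q i.

(** The free base point [a] lets the line through [x] be parametrised by the value of a coordinate,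
    [a = x_j], so that one-variable derivatives apply unchanged. *)
Lemma is_derive_line (f : V -> R) x v (a d : R) :
  is_derive a (1 : R) (fun t => f ((t - a) *: v + x)) d -> is_derive x v f d.
Proof.
have e : (fun h => h^-1 *: ((f \o shift x) (h *: v) - f x)) =
    (fun h => h^-1 *: (((fun t => f ((t - a) *: v + x)) \o shift a) (h *: (1 : R)) -
      f ((a - a) *: v + x))).
  apply/funext => h; rewrite /= /shift /= subrr scale0r add0r addrK.
  by rewrite /GRing.scale /= mulr1.
move=> [dG GE]; split.
  by move: dG; rewrite /derivable -e.
by rewrite -GE /derive e.
Qed.

Lemma is_derive_gtensor c j Q x :
  is_derive x (delta_mx 0 j : V) (gtensor c Q) (gtensor c (gtensor_deriv c j Q) x).
Proof.
apply: (@is_derive_line _ _ _ (x 0 j)).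
pose P := \prod_(i | i != j) ((Q i).[x 0 i] * expR (- (c * x 0 i ^+ 2))).
have e : (fun t : R => gtensor c Q ((t - x 0 j) *: (delta_mx 0 j : V) + x)) =
    fun t => P * ((Q j).[t] * expR (- (c * t ^+ 2))).
  apply/funext => t; rewrite /gtensor (bigD1 j)//= mulrC !mxE !eqxx mulr1 subrK; congr (_ * _).
  by apply: eq_bigr => i /negPf ij; rewrite !mxE eqxx ij /= mulr0 add0r.
rewrite e.
have -> : gtensor c (gtensor_deriv c j Q) x =
    P * ((hstep c (Q j)).[x 0 j] * expR (- (c * (x 0 j) ^+ 2))).
  rewrite /gtensor (bigD1 j)//= mulrC /gtensor_deriv eqxx; congr (_ * _).
  by apply: eq_bigr => i /negPf ij; rewrite ij.
exact: (is_deriveZ P (is_derive_hgauss c (Q j) (x 0 j))).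
Qed.

Lemma pderiv_gtensor K c j Q :
  pderiv j (fun x => K * gtensor c Q x) = fun x => K * gtensor c (gtensor_deriv c j Q) x.
Proof.
by apply/funext => x; have [_] := is_deriveZ K (is_derive_gtensor c j Q x).
Qed.

Lemma continuous_gtensor K c Q : continuous (fun x => K * gtensor c Q x).
Proof.
have cont i : continuous (fun x : V => (Q i).[x 0 i] * expR (- (c * x 0 i ^+ 2))).
  move=> x; have [df _] := is_derive_hgauss c (Q i) (x 0 i).
  apply: (@continuous_comp _ _ _ (fun x : V => x 0 i)
    (fun t : R => (Q i).[t] * expR (- (c * t ^+ 2)))).
    exact: coord_continuous.
  by apply: differentiable_continuous; exact/derivable1_diffP.
have contP (s : seq 'I_m) :
    continuous (fun x : V => \prod_(i <- s) ((Q i).[x 0 i] * expR (- (c * x 0 i ^+ 2)))).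
  elim: s => [|i s ih] x.
    rewrite (_ : (fun _ => _) = cst 1); first exact: cst_continuous.
    by apply/funext => y; rewrite big_nil.
  rewrite (_ : (fun _ => _) = fun x : V => ((Q i).[x 0 i] * expR (- (c * x 0 i ^+ 2))) *
    \prod_(i <- s) ((Q i).[x 0 i] * expR (- (c * x 0 i ^+ 2)))).
    exact: (cvgM (cont i x) (ih x)).
  by apply/funext => y; rewrite big_cons.
have contG : continuous (gtensor c Q) by exact: (contP (index_enum 'I_m)).
move=> x; exact: (cvgM (@cst_continuous V R K x) (contG x)).
Qed.

Lemma C2_gtensor K c Q : C2 (fun x => K * gtensor c Q x).
Proof.
move=> j; split.
- by move=> x; have [] := is_deriveZ K (is_derive_gtensor c j Q x).
- by rewrite pderiv_gtensor; exact: continuous_gtensor.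
move=> k; rewrite !pderiv_gtensor; split; last exact: continuous_gtensor.
by move=> x; have [] := is_deriveZ K (is_derive_gtensor c k (gtensor_deriv c j Q) x).
Qed.

Lemma gtensor_mul c (Q Q' : 'I_m -> {poly R}) j q x : Q' j = q * Q j ->
  (forall i, i != j -> Q' i = Q i) -> gtensor c Q' x = q.[x 0 j] * gtensor c Q x.
Proof.
move=> Qj Qi; rewrite /gtensor (bigD1 j)//= [in RHS](bigD1 j)//= Qj hornerM !mulrA.
by congr (_ * _); apply: eq_bigr => i ij; rewrite Qi.
Qed.

(** The hypothesis is the one-dimensional oscillator equation for [Q_j(t) exp(-c t^2)]; summing over
    the coordinates adds up potentials and eigenvalues. *)
Lemma laplacian_gtensor K c (Q : 'I_m -> {poly R}) (k : 'I_m -> nat) x :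
  (forall j, hstep c (hstep c (Q j)) =
    (((2 * c) ^+ 2)%:P * 'X^2 - (2 * c * (2 * k j + 1)%:R)%:P) * Q j) ->
  laplacian (fun x => K * gtensor c Q x) x =
  ((2 * c) ^+ 2 * rnorm2 x - 2 * c * (\sum_j (2 * k j + 1))%:R) * (K * gtensor c Q x).
Proof.
move=> hQ; rewrite /laplacian /rnorm2 natr_sum !mulr_sumr -sumrB mulr_suml.
apply: eq_bigr => j _; rewrite !pderiv_gtensor (@gtensor_mul c Q _ j
  (((2 * c) ^+ 2)%:P * 'X^2 - (2 * c * (2 * k j + 1)%:R)%:P)).
- rewrite hornerD hornerN hornerM hornerXn !hornerC.
  by move: (_%:R) (gtensor _ _ _) => a b; ring.
- by rewrite /gtensor_deriv eqxx.
- by move=> i /negPf ij; rewrite /gtensor_deriv ij.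
Qed.

End gaussian_polynomials.

Section hermite_polynomials.
Variable R : realType.
Implicit Types (c : R) (q : {poly R}).

Lemma deriv_CXM (a : R) q : (a%:P * 'X * q)^`() = a%:P * q + a%:P * 'X * q^`().
Proof. by rewrite !derivM derivC derivX; ring. Qed.

(* The Hermite polynomials up to sign: [hpoly k] is [(-1)^k H_k]. *)
Definition hpoly (k : nat) : {poly R} := iter k (hstep 1) 1.

Lemma hpolyS k : hpoly k.+1 = (hpoly k)^`() - 2%:P * 'X * hpoly k.
Proof. by rewrite /hpoly /= {1}/hstep mulr1. Qed.

(** The equation for [k] gives the lowering rule that the derivative of [hpoly k.+1] is [-2 (k+1)]
    times [hpoly k]; combined with the raising rule [hpolyS] it gives the equation for [k+1]. *)
Lemma hpoly_ode k : (hpoly k)^`()^`() - 2%:P * 'X * (hpoly k)^`() + (2 * k%:R)%:P * hpoly k = 0.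
Proof.
elim: k => [|k ih].
  by rewrite /hpoly /= -polyC1 !derivC polyCM polyC0 !mulr0 subr0 mul0r addr0.
have dS : (hpoly k.+1)^`() = - (2 * k.+1%:R)%:P * hpoly k.
  rewrite hpolyS derivB deriv_CXM -[RHS]addr0 -ih -natr1 !polyCM polyCD.
  by ring.
rewrite dS derivM derivN derivC oppr0 mul0r add0r hpolyS.
by ring.
Qed.

Definition dhpoly (a : R) k : {poly R} := hpoly k \Po (a *: 'X).

Lemma deriv_dilation (a : R) q : (q \Po (a *: 'X))^`() = a%:P * (q^`() \Po (a *: 'X)).
Proof. by rewrite deriv_comp derivZ derivX alg_polyC mulrC. Qed.

(** [2 c = a^2] is the rate for which [hpoly k] at [a t], times [exp(-c t^2)], is a dilated Hermite
    function. The oscillator equation is [hpoly_ode] composed with [a X] and multiplied by [a^2]. *)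
Lemma hstep_dhpoly a c k : 2 * c = a ^+ 2 ->
  hstep c (hstep c (dhpoly a k)) =
    (((2 * c) ^+ 2)%:P * 'X^2 - (2 * c * (2 * k + 1)%:R)%:P) * dhpoly a k.
Proof.
move=> ca; rewrite /hstep ca derivB deriv_CXM /dhpoly !deriv_dilation derivM derivC mul0r add0r.
rewrite deriv_dilation.
have := congr1 (fun q => (a ^+ 2)%:P * (q \Po (a *: 'X))) (hpoly_ode k).
rewrite comp_poly0 mulr0 comp_polyD comp_polyB !comp_polyM !comp_polyC comp_polyX.
rewrite -mul_polyC natrD natrM !polyCM !polyCD.
move: (hpoly k \Po _) ((hpoly k)^`() \Po _) ((hpoly k)^`()^`() \Po _) => q0 q1 q2 h.
rewrite -[RHS]addr0 -h.
by ring.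
Qed.

End hermite_polynomials.

Section hermite_functions.
Variables (R : realType) (m : nat).
Local Notation C := R[i].
Local Notation V := 'rV[R]_m.
Local Notation mu := (lebesgue_rv R m).
Local Notation leb := (@lebesgue_measure R).
Implicit Types (c : R) (Q : 'I_m -> {poly R}) (x : V) (k : 'I_m -> nat).

Lemma iter_pderiv_gtensor c Q j r :
  iter r (pderiv j) (gtensor c Q) =
  gtensor c (fun i => if i == j then iter r (hstep c) (Q i) else Q i).
Proof.
have pE P : pderiv j (gtensor c P) = gtensor c (gtensor_deriv c j P).
  by apply/funext => x; have [_] := is_derive_gtensor c j P x.
elim: r => [|r ih] /=; first by congr gtensor; apply/funext => i; case: ifP.
rewrite ih pE; congr gtensor; apply/funext => i; rewrite /gtensor_deriv.
by case: (i == j).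
Qed.

Lemma gtensor1 c x : gtensor c (fun=> 1) x = expR (- (c * rnorm2 x)).
Proof.
rewrite /rnorm2 mulr_sumr -sumrN expR_sum; apply: eq_bigr => i _.
by rewrite hornerC mul1r.
Qed.

Lemma mderiv_gauss k :
  mderiv k (fun x : V => expR (- rnorm2 x)) = gtensor 1 (fun i => hpoly R (k i)).
Proof.
have -> : (fun x : V => expR (- rnorm2 x)) = gtensor 1 (fun=> 1).
  by apply/funext => x; rewrite gtensor1 mul1r.
(* Along a list without repetitions, each coordinate still carries the constant polynomial 1 when
   its turn comes. *)
have h (s : seq 'I_m) : uniq s ->
    foldr (fun j g => iter (k j) (pderiv j) g) (gtensor 1 (fun=> 1)) s =
    gtensor 1 (fun i => if i \in s then hpoly R (k i) else 1).
  elim: s => [|j s ih] //= /andP[js us].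
  rewrite ih// iter_pderiv_gtensor; congr gtensor; apply/funext => i.
  by rewrite inE; case: eqVneq => [->|_] //=; rewrite (negPf js).
rewrite /mderiv h ?enum_uniq//; congr gtensor; apply/funext => i.
by rewrite mem_enum.
Qed.

Lemma gtensorM c d Q x :
  gtensor c Q x * expR (- (d * rnorm2 x)) = gtensor (c + d) Q x.
Proof.
rewrite -gtensor1 /gtensor -big_split; apply: eq_bigr => i _ /=.
by rewrite hornerC mul1r mulrDl opprD expRD [RHS]mulrA.
Qed.

Lemma gtensor_dilation a c k x :
  gtensor c (fun i => hpoly R (k i)) (a *: x) =
  gtensor (c * a ^+ 2) (fun i => dhpoly a (k i)) x.
Proof.
rewrite /gtensor; apply: eq_bigr => i _.
by rewrite /dhpoly horner_comp hornerZ hornerX !mxE exprMn mulrA.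
Qed.

Lemma gtensor_gint_kernel Q (z : 'rV[C]_m) x :
  (gtensor 2^-1 Q x)%:C * cexp (- (2^-1 * rnorm2 x)%:C + cdot z (to_cvec x)) =
  \prod_j pgauss (Q j) 1 (z 0 j) (x 0 j).
Proof.
rewrite cgauss_rvE /gtensor rmorph_prod -big_split; apply: eq_bigr => i _ /=.
rewrite /pgauss /cgauss (realcM (Q i).[_]) -[LHS]mulrA; congr (_ * _).
rewrite -cexp_realc -cexpD; congr cexp; rewrite addrA; congr (_ + _).
have -> : 1 * x 0 i ^+ 2 = 2^-1 * x 0 i ^+ 2 + 2^-1 * x 0 i ^+ 2 by field.
by rewrite realcD realcN opprD.
Qed.

(** [hpoly r] iterates [hstep 1], and under the integral each [hstep] is a factor [-z] by
    [pgauss_parts]. *)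
Lemma pgauss_hpoly_integral r (z : C) :
  cintegral leb (pgauss (hpoly R r) 1 z) =
  (- z) ^+ r * ((Num.sqrt pi)%:C * cexp (4^-1 * z ^+ 2)).
Proof.
elim: r => [|r ih].
  rewrite expr0 mul1r -cgauss_pgauss cgauss_integral// divr1 mulr1.
  by rewrite realcV rmorph_nat.
have -> : hpoly R r.+1 = (hpoly R r)^`() - (2 * 1)%:P * 'X * hpoly R r by rewrite mulr1 hpolyS.
by rewrite pgauss_parts// ih (exprS (- z)) -[RHS]mulrA.
Qed.

Lemma gint_gtensor k (z : 'rV[C]_m) :
  gint (fun x => (gtensor 2^-1 (fun i => hpoly R (k i)) x)%:C) z =
  (\prod_j (- z 0 j) ^+ k j) * ((Num.sqrt pi ^+ m)%:C * cexp (4^-1 * cdot z z)).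
Proof.
rewrite /gint; under eq_cintegral do rewrite gtensor_gint_kernel.
rewrite (cintegral_rv_prod (fun j => cintegrable_pgauss (hpoly R (k j)) (z 0 j) ltr01)).
under eq_bigr do rewrite pgauss_hpoly_integral.
rewrite big_split; congr (_ * _); rewrite big_split prodr_const card_ord realcX; congr (_ * _).
by rewrite /cdot mulr_sumr cexp_sum; apply: eq_bigr => j _; rewrite expr2.
Qed.

(** The square is again a product over coordinates, with polynomials [Q_j^2] and rate 1. *)
Lemma in_L2_gtensor Q : in_L2 (fun x => (gtensor 2^-1 Q x)%:C).
Proof.
have gE x : \prod_j pgauss (Q j) 2^-1 0 (x 0 j) = (gtensor 2^-1 Q x)%:C.
  rewrite /gtensor rmorph_prod; apply: eq_bigr => j _.
  by rewrite /pgauss /cgauss mul0r addr0 -realcN cexp_realc -realcM.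
have mg : cmeas (fun x => (gtensor 2^-1 Q x)%:C).
  under eq_fun do rewrite -gE.
  by apply: (@cmeas_rv_prod R m (fun j => pgauss (Q j) 2^-1 0)) => j; exact: cmeas_pgauss.
have [mr mi] := mg; split => //.
have [/integrableP[_ h] _] := cintegrable_rv_prod
    (fun j => cintegrable_pgauss (Q j * Q j) 0 (ltr01 : 0 < 1 :> R)).
apply: le_lt_trans h; rewrite le_eqVlt; apply/orP; left; apply/eqP.
apply: eq_integral => x _.
have -> : \prod_j pgauss (Q j * Q j) 1 0 (x 0 j) = (gtensor 2^-1 Q x ^+ 2)%:C.
  rewrite /gtensor -prodrXl rmorph_prod; apply: eq_bigr => j _.
  rewrite /pgauss /cgauss mul0r addr0 -realcN cexp_realc -realcM hornerM; congr (_%:C).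
  rewrite exprMn -expRM_natr; congr (_ * expR _).
  by field.
by rewrite sqmod_realc /= ger0_norm ?sqr_ge0.
Qed.

End hermite_functions.

(** * Dilated Hermite functions, [Psi] and the deformed Hermite operator *)

Section dilated_hermite_functions.
Variables (R : realType) (n : nat).
Local Notation C := R[i].
Local Notation V := 'rV[R]_(n + n).
Local Notation leb := (lebesgue_rv R (n + n)).
Implicit Types (mu : 'I_(n + n) -> nat) (x : V) (lam : R).

Let hcst mu : R :=
  (-1) ^+ mlen mu * (Num.sqrt (pi ^+ n * (mfact mu)%:R * 2 ^+ mlen mu))^-1.

Lemma hermiteE mu : hermite mu =
  fun x => (hcst mu)%:C * (gtensor 2^-1 (fun i => hpoly R (mu i)) x)%:C.
Proof.
apply/funext => x; rewrite /hermite mderiv_gauss -realcM -mulrA; congr (_ * _)%:C.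
have := gtensorM 1 (- 2^-1) (fun i => hpoly R (mu i)) x.
rewrite mulNr opprK => ->; congr gtensor; by field.
Qed.

Lemma in_L2_hermite mu : in_L2 (hermite mu : V -> C).
Proof. by rewrite hermiteE; apply: in_L2Z; exact: in_L2_gtensor. Qed.

Lemma bargmann_hermite mu : bargmann (hermite mu) = fock_monomial mu :> (_ -> C).
Proof.
apply/funext => z; rewrite bargmannE; last exact: in_L2_hermite.
rewrite hermiteE gintZ; last exact: in_L2_gtensor.
rewrite gint_gtensor /fock_monomial.
have e0 : cexp (- (4^-1 * cdot z z)) * cexp (4^-1 * cdot z z) = 1.
  by rewrite -cexpD addNr cexp0.
have -> : \prod_j (- z 0 j) ^+ mu j = (-1) ^+ mlen mu * \prod_j z 0 j ^+ mu j.
  rewrite /mlen -prodrXr -big_split; apply: eq_bigr => j _ /=.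
  by rewrite -exprMn mulN1r.
have k1 : pi ^- n * Num.sqrt pi ^+ (n + n) = 1 :> R.
  rewrite exprD -exprMn -expr2 sqr_sqrtr ?pi_ge0// mulVf// expf_neq0//.
  by rewrite gt_eqF// pi_gt0.
(* The sign in the definition of [hermite] cancels the one produced by the integrations by parts. *)
have k2 : hcst mu * (-1) ^+ mlen mu =
    (Num.sqrt (pi ^+ n))^-1 * (Num.sqrt (2 ^+ mlen mu * (mfact mu)%:R))^-1.
  rewrite /hcst mulrAC -exprMn mulrNN mulr1 expr1n mul1r -invfM -sqrtrM ?exprn_ge0 ?pi_ge0//.
  by rewrite -mulrA (mulrC (mfact mu)%:R).
transitivity ((pi ^- n * Num.sqrt pi ^+ (n + n))%:C *
    (cexp (- (4^-1 * cdot z z)) * cexp (4^-1 * cdot z z)) *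
    ((hcst mu * (-1) ^+ mlen mu)%:C * \prod_j z 0 j ^+ mu j)).
  rewrite !realcM realcX realcN.
  by move: (cexp _) (cexp _) (\prod_j _) => a b c; ring.
by rewrite k1 e0 k2 !mul1r.
Qed.

Lemma dilation_hermiteE lam mu : dilation lam (hermite mu) = fun x =>
  (kappa lam ^+ n * hcst mu *
    gtensor (kappa lam ^+ 2 / 2) (fun i => dhpoly (kappa lam) (mu i)) x)%:C.
Proof.
apply/funext => x; rewrite /dilation hermiteE gtensor_dilation -!realcM mulrA.
by rewrite (mulrC 2^-1).
Qed.

Lemma Hlam_dilation_hermite lam mu : lam != 0 -> forall x,
  Hlam lam (dilation lam (hermite mu)) x =
  (((2 * mlen mu + 2 * n)%:R * (lam / 2 * coth (lam / 2)))%:C) * dilation lam (hermite mu) x.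
Proof.
move=> lam0 x; rewrite -kappa_sq//.
rewrite /Hlam /claplacian dilation_hermiteE -kappa_sq//.
set K := kappa lam ^+ n * _; set c := kappa lam ^+ 2 / 2.
pose Q i := dhpoly (kappa lam) (mu i).
have lap0 : laplacian (fun _ : V => 0) x = 0 :> R.
  rewrite /laplacian big1// => j _.
  have p0 : pderiv j (fun _ : V => 0) = fun _ : V => 0 :> R.
    by apply/funext => y; exact: derive_cst.
  by rewrite !p0.
have cE : 2 * c = kappa lam ^+ 2 by rewrite /c; field.
have lap := @laplacian_gtensor R (n + n) K c Q mu x (fun j => hstep_dhpoly (mu j) cE).
(* The zero-point term 1 of each of the [n + n] coordinates adds up to [2 n]. *)
have sumE : (\sum_j (2 * mu j + 1) = 2 * mlen mu + 2 * n)%N.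
  by rewrite big_split -big_distrr sum_nat_const card_ord muln1 /=; congr (_ + _)%N; rewrite mul2n addnn.
rewrite -[X in - X](_ : (laplacian (fun x => K * gtensor c Q x) x)%:C = _); last first.
  by apply: complex_eq => //=; rewrite lap0.
rewrite lap cE sumE -realcN -!realcM -realcD; congr (_%:C).
by move: (_%:R) (gtensor _ _ _) => S g; ring.
Qed.

Lemma C2_cst (m : nat) (a : R) : C2 (fun _ : 'rV[R]_m => a).
Proof.
have p0 (b : R) j : pderiv j (fun _ : 'rV[R]_m => b) = fun=> 0.
  by apply/funext => y; exact: derive_cst.
move=> j; split.
- by move=> x; exact: derivable_cst.
- by rewrite p0; exact: cst_continuous.
move=> k; rewrite !p0; split; last exact: cst_continuous.
by move=> x; exact: derivable_cst.
Qed.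

(** The dilated Hermite function solves the defining equation of [Psi], because [bargmann] sends
    Hermite functions to monomials; [twisted_bargmann_inj] makes the solution unique. *)
Lemma Psi_dilation_hermite lam mu : lam != 0 ->
  in_L2 (Psi lam mu) /\ ae_eqf (Psi lam mu) (dilation lam (hermite mu)).
Proof.
move=> lam0; have lh := in_L2_hermite mu; have lD := in_L2_dilation lam0 lh.
have BD : twisted_bargmann lam (dilation lam (hermite mu)) = Tlam lam (fock_monomial mu).
  by rewrite twisted_bargmann_dilation// bargmann_hermite.
rewrite /Psi; case: xgetP => [psi _ [lpsi Bpsi]|/(_ (dilation lam (hermite mu)))[]//].
by split=> //; apply: (twisted_bargmann_inj lam0) => //; rewrite Bpsi BD.
Qed.

(** If it vanished almost everywhere, so would [hermite mu], and its Bargmann transform would be 0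
    everywhere. But that transform is a monomial, which is nonzero at [(1, ..., 1)]. *)
Lemma dilation_hermite_neq0 lam mu : lam != 0 ->
  ~ ae_eqf (dilation lam (hermite mu)) (fun=> 0).
Proof.
move=> lam0 D0; have lh := in_L2_hermite mu; have lD := in_L2_dilation lam0 lh.
have h0 : (\int[leb]_x (sqmod (hermite mu x))%:E = 0)%E.
  rewrite -(integral_sqmod_scaling (kappa_gt0 lam0) (in_L2_cmeas lh)).
  rewrite (ae_eq_integral (cst 0%E))//; first by rewrite integral_cst// mul0e.
  - by apply/measurable_EFinP; exact: measurable_sqmod (in_L2_cmeas lD).
  - apply: filterS D0 => x /= Dx _; congr (_%:E).
    by rewrite -[scaling _ _ _]/(dilation lam (hermite mu) x) Dx /sqmod /= expr2 mul0r addr0.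
have l0 : in_L2 (fun _ : V => 0 : C).
  by have := in_L2Z 0 lh; under eq_fun do rewrite mul0r.
have H0 : ae_eqf (hermite mu) (fun _ : V => 0).
  by apply: ae_eqf_L2 => //; under eq_integral do rewrite subr0.
have : bargmann (hermite mu) (const_mx 1 : 'rV[C]_(n + n)) = 0.
  rewrite (bargmannE _ lh).
  have -> : gint (hermite mu) (const_mx 1 : 'rV[C]_(n + n)) = 0.
    have m0 := cmeas_gint_kernel (const_mx 1 : 'rV[C]_(n + n)).
    transitivity (cintegral leb (fun _ : V => 0 : C)); last first.
      by rewrite (cintegral_real leb (fun=> 0)) /Rintegral integral0.
    apply: ae_eq_cintegral.
    - by apply: cmeasM => //; exact: in_L2_cmeas.
    - exact: cmeas_cst.
    - by apply: filterS H0 => x ->; rewrite mul0r.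
  by rewrite mulr0.
rewrite bargmann_hermite /fock_monomial big1 => [|j _]; last by rewrite mxE expr1n.
rewrite mulr1 => /complexI /eqP; apply/negP.
rewrite mulf_neq0// invr_neq0// gt_eqF// sqrtr_gt0.
  by rewrite exprn_gt0// pi_gt0.
rewrite mulr_gt0 ?exprn_gt0// ltr0n /mfact prodn_gt0// => j; exact: fact_gt0.
Qed.

End dilated_hermite_functions.

Theorem proposition3p10 (R : realType) (n : nat) (lam : R)
    (n_ge1 : (1 <= n)%N) (lam_neq0 : lam != 0) :
  [/\ kappa lam ^+ 2 = lam / 2 * coth (lam / 2),
      forall f : 'rV[R]_(n + n) -> R[i], in_L2 f ->
        in_L2 (dilation lam f) /\
        ae_eqf (twisted_bargmann_adj lam (Tlam lam (bargmann f)))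
          (dilation lam f),
      forall mu : 'I_(n + n) -> nat,
        ae_eqf (Psi lam mu) (dilation lam (hermite mu)) &
      forall mu : 'I_(n + n) -> nat,
        Hlam_eigenfunction lam
          ((2 * mlen mu + 2 * n)%:R * (lam / 2 * coth (lam / 2))) (Psi lam mu)].
Proof.
split.
- exact: kappa_sq.
- by move=> f lf; split; [exact: in_L2_dilation|exact: twisted_bargmann_adj_Tlam].
- by move=> mu; have [] := Psi_dilation_hermite mu lam_neq0.
move=> mu; have [lPsi PsiE] := Psi_dilation_hermite mu lam_neq0; split => //.
- move=> Psi0; apply: (dilation_hermite_neq0 (mu := mu) lam_neq0).
  by move: Psi0; apply: filterS2 PsiE => x -> ->.
(* The smooth representative of [Psi]; it is real valued, so its imaginary part is the constant
   0. *)
exists (dilation lam (hermite mu)); split => //.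
- by rewrite dilation_hermiteE; exact: C2_gtensor.
- by rewrite dilation_hermiteE; exact: C2_cst.
- exact: Hlam_dilation_hermite.
Qed.
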